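(* Put $\eta=\frac{\sqrt3+1}{\sqrt3-1}$ and let $a,b,c,d\in\mathbb{R}$ and $\mu$ satisfy: $a\in[\eta^{-1},\eta]\setminus\{1\}$; $0<\mu\le\mu^\ast:=\ln\left(\frac{|1+a|}{\sqrt3\,|1-a|}\right)$; $\left|\tfrac{bd}{c}\right|\le1$; $c\ge\tfrac{\pi^2}{8}$; $1+2(\sinh\mu+2\cosh\mu)b^2\le c$; and $|d|\le2\sqrt{\mu e^{-\mu}}$. Let $F(\mu)=2\sinh(\mu)+10\cosh(\mu)$ and suppose moreover that (1) $c\ge\frac{\pi^2}{4}$, (2) $\frac{\pi^2+2}{4}+F(\mu)b^2\le c$, (3) $|d|\le\sqrt{\mu e^{-\mu}}$. Then there exists $\varepsilon^\star>0$ such that for every $\varepsilon\in(0,\varepsilon^\star)$ and all $u_0\in H^1(0,1)$, $u_1\in L^2(0,1)$, $p_0\in L^2(0,1)$, $\bar u_0\in H^1(0,1)$, $\bar u_1\in L^2(0,1)$, $\bar p_0\in H^1(0,1)$ satisfying $u_0(0)=0$, $\bar u_0(0)=0$ together with the smallness conditions $$\|u_0-\bar u_0\|_{H^1(0,1)}+\|u_1-\bar u_1\|_{L^2(0,1)}+\left\|p_0-\bar p_0-d\,\tfrac{1+cx}{c}\,u_0(1)\right\|_{L^2(0,1)}=O(\varepsilon^{3/2})$$ and $$\|\bar p_0\|_{H^1(0,1)}=O(\varepsilon),\qquad \|\bar u_0\|_{H^1(0,1)}+\|\bar u_1\|_{L^2(0,1)}=O(\varepsilon^{3/2}),$$ the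 unique mild solution $(u,u_t,p)\in C([0,\infty);H^1(0,1)\times L^2(0,1)\times L^2(0,1))$ of the full system satisfies $$\|u(t)-\bar u(t)\|_{H^1(0,1)}+\|u_t(t)-\bar u_t(t)\|_{L^2(0,1)}=e^{-\frac{\mu}{8}t}\,O(\varepsilon^{3/2}),\qquad\forall t\ge0,$$ and $$\left\|p(t)-\bar p(\tfrac t\varepsilon)-\tfrac{1+cx}{c}\,d\,\bar u(1,t)\right\|_{L^2(0,1)}=e^{-\frac{\mu}{8}t}\,O(\varepsilon),\qquad\forall t\ge0,$$ where $\bar u\in C([0,\infty);H^1(0,1))\cap C^1([0,\infty);L^2(0,1))$ is the unique mild solution of the reduced order system and $\bar p\in C([0,\infty);H^1(0,1))$ is the unique mild solution of the boundary-layer system.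
   Context: The full system, with parameter $\varepsilon>0$, is $$\begin{cases} u_{tt}=u_{xx},\quad \varepsilon p_t=p_{xx}, & (x,t)\in(0,1)\times(0,\infty),\\ u(0,t)=0,\quad u_x(1,t)=-a\,u_t(1,t)+b\,p(0,t), & t>0,\\ p_x(0,t)=c\,p(0,t),\quad p_x(1,t)=d\,u(1,t), & t>0,\\ u(x,0)=u_0(x),\ u_t(x,0)=u_1(x),\ p(x,0)=p_0(x), & x\in(0,1).\end{cases}$$ The reduced order system is $$\begin{cases}\bar u_{tt}=\bar u_{xx}, & (x,t)\in(0,1)\times(0,\infty),\\ \bar u(0,t)=0,\quad \bar u_x(1,t)=-a\,\bar u_t(1,t)+\frac{bd}{c}\,\bar u(1,t), & t>0,\\ \bar u(x,0)=\bar u_0(x),\ \bar u_t(x,0)=\bar u_1(x), & x\in(0,1).\end{cases}$$ The boundary-layer system, in the time variable $\tau=t/\varepsilon$, is $$\begin{cases}\bar p_\tau=\bar p_{xx}, & (x,\tau)\in(0,1)\times(0,\infty),\\ \bar p_x(0,\tau)=c\,\bar p(0,\tau),\quad \bar p_x(1,\tau)=0, & \tau>0,\\ \bar p(x,0)=\bar p_0(x), & x\in(0,1).\end{cases}$$ All functions are real valued. Let $H^1_L(0,1)=\{u\in H^1(0,1):u(0)=0\}$. Each system is an abstract Cauchy problem $\dot Y=AY$, and a mild solution is a continuous function $Y$ with $\int_0^tY\,ds\in D(A)$ and $Y(t)=Y(0)+A\int_0^tY\,ds$ for all $t\ge 0$ (the semigroup orbit), where: - full system: $Y=(u,u_t,p)$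 in $H^1_L(0,1)\times L^2(0,1)\times L^2(0,1)$, $A(u,v,p)=(v,u_{xx},\varepsilon^{-1}p_{xx})$, with domain the $(u,v,p)\in(H^2\cap H^1_L)\times H^1_L\times H^2$ such that $u_x(1)=-av(1)+bp(0)$, $p_x(0)=cp(0)$, $p_x(1)=du(1)$; - reduced system: $Y=(\bar u,\bar u_t)$ in $H^1_L(0,1)\times L^2(0,1)$, $A(u,v)=(v,u_{xx})$, with domain the $(u,v)\in(H^2\cap H^1_L)\times H^1_L$ such that $u_x(1)=-av(1)+\frac{bd}{c}u(1)$; - boundary-layer system: $Y=\bar p$ in $L^2(0,1)$, $Ap=p_{xx}$, with domain $\{p\in H^2(0,1):p_x(0)=cp(0),\ p_x(1)=0\}$. The initial data may depend on $\varepsilon$; $O(\varepsilon^k)$ denotes a quantity bounded in absolute value by $C\varepsilon^k$ with $C$ independent of $\varepsilon$, and, in the conclusions, also independent of $t$. *)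

(* Defs.v *)
From HB Require Import structures.
From mathcomp Require Import all_boot all_order all_algebra.
From mathcomp Require Import all_classical all_reals all_analysis.
Set Implicit Arguments.
Unset Strict Implicit.
Unset Printing Implicit Defensive.
Import Order.TTheory GRing.Theory Num.Theory.
Import numFieldNormedType.Exports.

Local Open Scope classical_set_scope.
Local Open Scope ring_scope.

Definition sinh (R : realType) (x : R) : R := (expR x - expR (- x)) / 2.
Definition cosh (R : realType) (x : R) : R := (expR x + expR (- x)) / 2.

(** * Function spaces on the interval (0,1)

    Elements are represented by total functions [R -> R]. Values outside [0,1]
    are irrelevant; equality in L^2 or H^1 means that the norm of the difference
    is zero. *)

Definition ext0 (R : realType) (f : R -> R) : R -> R :=
  patch (cst 0) `]0, 1[ f.

Definition L2 (R : realType) (f : R -> R) : Prop :=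
  ext0 f \in Lfun (@lebesgue_measure R) 2%:E.

Definition normL2 (R : realType) (f : R -> R) : R :=
  fine ('N[@lebesgue_measure R]_2%:E[EFin \o ext0 f])%E.

(** C^1 functions with compact support in (0,1): a closed subset of the real
    line contained in ]0,1[ is compact. *)
Definition test_function (R : realType) (phi : R -> R) : Prop :=
  [/\ forall x, derivable phi x 1,
      continuous (phi^`()%classic)
    & closure [set x | phi x != 0] `<=` `]0, 1[].

Definition weak_derivative (R : realType) (u g : R -> R) : Prop :=
  [/\ L2 u, L2 g & forall phi, test_function phi ->
    (\int[@lebesgue_measure R]_(x in `]0, 1[) (u x * phi^`()%classic x) =
     - \int[@lebesgue_measure R]_(x in `]0, 1[) (g x * phi x))%R].

(** Members of H^1(0,1) are given by their continuous representative on [0,1],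
    so that the traces at 0 and 1 are the values [u 0] and [u 1]. *)
Definition H1 (R : realType) (u : R -> R) : Prop :=
  {within `[0, 1], continuous u} /\ exists g, weak_derivative u g.

Definition H1L (R : realType) (u : R -> R) : Prop := H1 u /\ u 0 = 0.

(** The weak derivative is only determined almost everywhere, hence the choice
    of one; the norm does not depend on it. *)
Definition normH1 (R : realType) (u : R -> R) : R :=
  Num.sqrt (normL2 u ^+ 2 + normL2 (get [set g | weak_derivative u g]) ^+ 2).

(** [u] is in H^2(0,1), with [ux] the continuous representative of u_x and
    [uxx] a representative of u_xx. *)
Definition H2_with (R : realType) (u ux uxx : R -> R) : Prop :=
  [/\ H1 u, H1 ux, weak_derivative u ux & weak_derivative ux uxx].

(** * Abstract Cauchy problems

    The state space is a set [X] of vectors of [V] with (semi)norm [N]. The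
    operator is given by its graph: [A y w] means that y is in D(A) and that w
    represents Ay. *)

Definition time_continuous (R : realType) (V : lmodType R) (N : V -> R)
    (Y : R -> V) : Prop :=
  forall t : R, 0 <= t ->
    N (Y s - Y t) @[s --> within [set s | 0 <= s] (nbhs t)] --> (0 : R).

(** [Z] is the integral of [Y] over [0,t], as the limit in norm of Riemann sums
    over uniform subdivisions; it is only used for continuous [Y], for which all
    Riemann sums have the same limit. *)
Definition is_time_integral (R : realType) (V : lmodType R) (N : V -> R)
    (Y : R -> V) (t : R) (Z : V) : Prop :=
  N ((t / n.+1%:R) *: (\sum_(i < n.+1) Y (i%:R * (t / n.+1%:R))) - Z)
    @[n --> \oo] --> (0 : R).

Definition mild_solution (R : realType) (V : lmodType R) (X : V -> Prop)
    (N : V -> R) (A : V -> V -> Prop) (Y0 : V) (Y : R -> V) : Prop :=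
  [/\ forall t : R, 0 <= t -> X (Y t),
      N (Y 0 - Y0) = 0,
      time_continuous N Y
    & forall t : R, 0 <= t -> exists Z W : V,
        [/\ is_time_integral N Y t Z, A Z W & N (Y t - (Y 0 + W)) = 0]].

Definition unique_mild_solution (R : realType) (V : lmodType R) (X : V -> Prop)
    (N : V -> R) (A : V -> V -> Prop) (Y0 : V) (Y : R -> V) : Prop :=
  mild_solution X N A Y0 Y /\
  forall Y' : R -> V, mild_solution X N A Y0 Y' ->
    forall t : R, 0 <= t -> N (Y' t - Y t) = 0.

(** [v] is the time derivative (one-sided at 0) of [u] in L^2(0,1). *)
Definition L2_time_derivative (R : realType) (u v : R -> R -> R) : Prop :=
  forall t : R, 0 <= t ->
    normL2 (h^-1 *: (u (t + h) - u t) - v t)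
      @[h --> within [set h | 0 <= t + h] (0 : R)^'] --> (0 : R).

(** * The three systems *)

Definition full_space (R : realType)
    (Y : (R -> R) * (R -> R) * (R -> R)) : Prop :=
  let: (u, v, p) := Y in [/\ H1L u, L2 v & L2 p].

Definition full_norm (R : realType)
    (Y : (R -> R) * (R -> R) * (R -> R)) : R :=
  let: (u, v, p) := Y in normH1 u + normL2 v + normL2 p.

Definition full_operator (R : realType) (eps a b c d : R)
    (Y W : (R -> R) * (R -> R) * (R -> R)) : Prop :=
  let: (u, v, p) := Y in
  exists ux uxx px pxx : R -> R,
  [/\ [/\ H2_with u ux uxx, u 0 = 0, H1L v & H2_with p px pxx],
      ux 1 = - a * v 1 + b * p 0,
      px 0 = c * p 0,
      px 1 = d * u 1
    & W = (v, uxx, eps^-1 *: pxx)].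

Definition reduced_space (R : realType) (Y : (R -> R) * (R -> R)) : Prop :=
  let: (u, v) := Y in H1L u /\ L2 v.

Definition reduced_norm (R : realType) (Y : (R -> R) * (R -> R)) : R :=
  let: (u, v) := Y in normH1 u + normL2 v.

Definition reduced_operator (R : realType) (a b c d : R)
    (Y W : (R -> R) * (R -> R)) : Prop :=
  let: (u, v) := Y in
  exists ux uxx : R -> R,
  [/\ H2_with u ux uxx, u 0 = 0, H1L v,
      ux 1 = - a * v 1 + b * d / c * u 1
    & W = (v, uxx)].

Definition layer_operator (R : realType) (c : R) (p w : R -> R) : Prop :=
  exists px : R -> R, [/\ H2_with p px w, px 0 = c * p 0 & px 1 = 0].

(* Main.v *)
Require Import Defs.
From HB Require Import structures.
From mathcomp Require Import all_boot all_order all_algebra.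
From mathcomp Require Import all_classical all_reals all_analysis.
From mathcomp Require Import measurable_realfun.
From mathcomp Require Import ring lra.
Set Implicit Arguments.
Unset Strict Implicit.
Unset Printing Implicit Defensive.
Import Order.TTheory GRing.Theory Num.Theory.
Import numFieldNormedType.Exports.

Local Open Scope classical_set_scope.
Local Open Scope ring_scope.

(** All data are small: the initial states of the reduced system and of the layer
    are bounded by K eps^(3/2) and K eps, and the state of the full system is close
    to them. It is therefore enough to show that each of the three systems decays
    exponentially from its own data, with constants independent of eps, and to add
    up the bounds.

    For the full system this rests on one Lyapunov functional, [energy]: the wave
    energy in Riemann invariants v + u_x and v - u_x, with the weights exp(mu x) and
    exp(- mu x), plus a weight of order eps times the squared norm of the deviation
    p - d (1 + cx)/c u(1) from the stationary heat profile. The weights make the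
    wave decay at the rate mu inside the interval; at the boundary the damping a
    is strong enough because of mu <= mu_star, the stationary feedback bd/c is
    absorbed by the decay of the wave, and the deviation at 0 by the Robin
    dissipation of the heat equation ([coupled_graph_dissipative]). As the weight
    of the heat part is of order eps, an initial deviation of order eps contributes
    eps^(3/2) to the energy norm ([initial_energy_le]), and a norm of order eps^(3/2)
    bounds the deviation by eps: these are the two rates of the theorem.

    The reduced system is the same functional without coupling. The layer has its
    own functional, the quadratic form of its operator ([layer_maximal]); it is
    equivalent to the H^1 norm and so gives the continuity in H^1 as well.

    Existence comes from a general fact: a relation on a complete space with a semi
    inner product, linear, dissipative with a positive rate and such that implicit
    Euler steps can be solved, has mild solutions that decay at that rate
    ([evolution_mild], [evolution_decay]). Dyadic Euler iterations converge, with
    the error of [half_step] on the dense domain of the square ([dom2_dense]); the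
    integrated equation holds exactly along the scheme. Uniqueness is
    [mild_unique]: the time integral of a difference of solutions has a
    nonincreasing norm.

    The Sobolev spaces are handled through absolutely continuous functions
    ([abs_cont]), for which traces and products are elementary: weak derivatives
    are of this kind ([weak_derivative_AC]), the product rule is Fubini's theorem
    ([AC_mul]), and completeness is the Riesz-Fischer theorem ([L2_complete]). *)

(** * Linear identities in modules *)

Inductive lin_expr (K : Type) :=
  | LinZero | LinVar of nat | LinAdd of lin_expr K & lin_expr K
  | LinOpp of lin_expr K | LinScale of K & lin_expr K.

Section LinExpr.
Variables (K : fieldType) (V : lmodType K).

Fixpoint lin_eval (env : seq V) (e : lin_expr K) : V :=
  match e with
  | LinZero => 0
  | LinVar i => nth 0 env i
  | LinAdd a b => lin_eval env a + lin_eval env b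
  | LinOpp a => - lin_eval env a
  | LinScale k a => k *: lin_eval env a
  end.

Fixpoint lin_coef (e : lin_expr K) (i : nat) : K :=
  match e with
  | LinZero => 0
  | LinVar j => if eqn j i then 1 else 0
  | LinAdd a b => lin_coef a i + lin_coef b i
  | LinOpp a => - lin_coef a i
  | LinScale k a => k * lin_coef a i
  end.

Lemma lin_evalE env e :
  lin_eval env e = \sum_(i < size env) lin_coef e i *: nth 0 env i.
Proof.
elim: e => [|j|a iha b ihb|a iha|k a iha] /=; rewrite ?iha ?ihb.
- by rewrite big1// => i _; rewrite scale0r.
- have [jn|nj] := ltnP j (size env).
    rewrite (bigD1 (Ordinal jn))//= eqnE eqxx scale1r big1 ?addr0// => i ij.
    by rewrite ?eqnE ifN ?scale0r// eq_sym.
  rewrite nth_default// big1// => i _.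
  by rewrite ?eqnE ifN ?scale0r// gtn_eqF// (leq_trans (ltn_ord i)).
- by rewrite -big_split/=; apply: eq_bigr => i _; rewrite scalerDl.
- by rewrite -sumrN; apply: eq_bigr => i _; rewrite scaleNr.
- by rewrite scaler_sumr; apply: eq_bigr => i _; rewrite scalerA.
Qed.

Fixpoint lin_agree (e1 e2 : lin_expr K) (n : nat) : Prop :=
  if n is m.+1 then lin_coef e1 m = lin_coef e2 m /\ lin_agree e1 e2 m else True.

(** A linear expression is determined by its coefficients on the atoms, so an
    identity in a module reduces to one field identity per atom. *)
Lemma lin_agreeP env e1 e2 :
  lin_agree e1 e2 (size env) -> lin_eval env e1 = lin_eval env e2.
Proof.
move=> h; rewrite !lin_evalE; apply: eq_bigr => i _; congr (_ *: _).
elim: (size env) h (i : nat) (ltn_ord i) => // n ih /= [h1 /ih {}ih] j.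
by rewrite ltnS leq_eqVlt => /predU1P[->//|]; exact: ih.
Qed.

End LinExpr.

Ltac lin_index x env k :=
  lazymatch env with
  | x :: _ => k O
  | _ :: ?s => lin_index x s ltac:(fun n => k (S n))
  end.
Ltac lin_add x env :=
  lazymatch env with
  | context [x :: _] => env
  | _ => constr:(x :: env)
  end.
Ltac lin_vars t env :=
  lazymatch t with
  | GRing.zero => env
  | GRing.add ?a ?b => let e := lin_vars a env in lin_vars b e
  | GRing.opp ?a => lin_vars a env
  | GRing.scale ?k ?a => lin_vars a env
  | ?x => lin_add x env
  end.
Ltac lin_reify K t env k :=
  lazymatch t with
  | GRing.zero => k constr:(@LinZero K)
  | GRing.add ?a ?b => lin_reify K a env ltac:(fun ea =>
      lin_reify K b env ltac:(fun eb => k constr:(@LinAdd K ea eb)))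
  | GRing.opp ?a => lin_reify K a env ltac:(fun ea => k constr:(@LinOpp K ea))
  | GRing.scale ?c ?a =>
      lin_reify K a env ltac:(fun ea => k constr:(@LinScale K c ea))
  | ?x => lin_index x env ltac:(fun n => k constr:(@LinVar K n))
  end.

(** The recursion of [lin_agree] goes through the atoms one by one; [field] then
    proves each identity between coefficients, with the nonvanishing of the
    denominators taken from the context. *)
Ltac lin_eq K :=
  lazymatch goal with
  | |- @eq ?V ?a ?b =>
    let env0 := constr:(@nil V) in
    let env1 := lin_vars a env0 in
    let env := lin_vars b env1 in
    lin_reify K a env ltac:(fun ea => lin_reify K b env ltac:(fun eb =>
      apply: (@lin_agreeP _ _ env ea eb)));
    cbn [lin_agree lin_coef size eqn];
    repeat split; field; try done
  end.

(** * Seminorms of semi inner products *)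

Record semi_inner (R : realType) (H : lmodType R) := SemiInner {
  sip :> H -> H -> R;
  sipC : forall x y, sip x y = sip y x;
  sipl : forall (k : R) x y z, sip (k *: x + y) z = k * sip x z + sip y z;
  sip_ge0 : forall x, 0 <= sip x x }.

(** Functions that agree almost everywhere are distinct vectors at distance zero,
    so nothing is assumed to be positive definite; every uniqueness statement is
    up to seminorm zero. *)
Definition snorm (R : realType) (H : lmodType R) (ip : semi_inner H) (x : H) : R :=
  Num.sqrt (ip x x).

Section SemiInnerTheory.
Variables (R : realType) (H : lmodType R) (ip : semi_inner H).
Implicit Types (x y z w : H) (k e : R).
Local Notation nm := (snorm ip).

Lemma sipDl x y z : ip (x + y) z = ip x z + ip y z.
Proof. by rewrite -[x]scale1r sipl scale1r mul1r. Qed.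

Lemma sip0l z : ip 0 z = 0.
Proof. by have := sipDl 0 0 z; rewrite addr0; lra. Qed.

Lemma sipZl k x z : ip (k *: x) z = k * ip x z.
Proof. by rewrite -[k *: x]addr0 sipl sip0l addr0. Qed.

Lemma sipNl x z : ip (- x) z = - ip x z.
Proof. by rewrite -scaleN1r sipZl mulN1r. Qed.

Lemma sipBl x y z : ip (x - y) z = ip x z - ip y z.
Proof. by rewrite sipDl sipNl. Qed.

Lemma sipDr x y z : ip z (x + y) = ip z x + ip z y.
Proof. by rewrite sipC sipDl !(sipC ip z). Qed.

Lemma sipZr k x z : ip z (k *: x) = k * ip z x.
Proof. by rewrite sipC sipZl sipC. Qed.

Lemma sipNr x z : ip z (- x) = - ip z x.
Proof. by rewrite sipC sipNl sipC. Qed.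

Lemma sipBr x y z : ip z (x - y) = ip z x - ip z y.
Proof. by rewrite sipDr sipNr. Qed.

Definition sipE := (sipDl, sipDr, sipNl, sipNr, sipZl, sipZr).

Lemma snorm_ge0 x : 0 <= nm x.
Proof. exact: sqrtr_ge0. Qed.

Lemma snorm_sqr x : nm x ^+ 2 = ip x x.
Proof. by rewrite sqr_sqrtr// sip_ge0. Qed.

Lemma snorm0 : nm 0 = 0.
Proof. by rewrite /snorm sip0l sqrtr0. Qed.

Lemma snormZ k x : nm (k *: x) = `|k| * nm x.
Proof.
by rewrite /snorm sipZl sipZr mulrA -expr2 sqrtrM ?sqr_ge0// sqrtr_sqr.
Qed.

Lemma snormN x : nm (- x) = nm x.
Proof. by rewrite /snorm sipNl sipNr opprK. Qed.

Lemma snorm_sym x y : nm (x - y) = nm (y - x).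
Proof. by rewrite -snormN opprB. Qed.

(** In the degenerate case [ip y y = 0] the quadratic polynomial
    [ip (x - t y) (x - t y)] is affine in [t], so positivity forces its slope to
    vanish. *)
Lemma cauchy_schwarz x y : ip x y <= nm x * nm y.
Proof.
have [xy0|xy0] := leP (ip x y) 0.
  by rewrite (le_trans xy0)// mulr_ge0 ?snorm_ge0.
rewrite -(@ler_pXn2r _ 2)// ?nnegrE ?mulr_ge0 ?snorm_ge0 ?(ltW xy0)//.
rewrite exprMn !snorm_sqr.
have [yy0|yy0] := eqVneq (ip y y) 0.
  (* this t makes the affine function equal to -1 *)
  have := sip_ge0 ip (x - ((ip x x + 1) / (2 * ip x y)) *: y).
  rewrite !sipE yy0 (sipC ip y x).
  have -> : (ip x x + 1) / (2 * ip x y) = ((ip x x + 1) / 2) * (ip x y)^-1.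
    by field; lra.
  set q := (_ / 2) * _ => h.
  have qE : q * ip x y = (ip x x + 1) / 2 by rewrite /q mulfVK// gt_eqF.
  by move: h qE; lra.
have yyp : 0 < ip y y by rewrite lt0r yy0 sip_ge0.
have := sip_ge0 ip (ip y y *: x - ip x y *: y).
rewrite !sipE (sipC ip y x) => h.
have : 0 <= ip y y * (ip x x * ip y y - ip x y ^+ 2) by move: h; lra.
by rewrite pmulr_rge0// subr_ge0.
Qed.

Lemma snormD x y : nm (x + y) <= nm x + nm y.
Proof.
rewrite -(@ler_pXn2r _ 2)// ?nnegrE ?addr_ge0 ?snorm_ge0//.
rewrite sqrrD !snorm_sqr !sipE (sipC ip y x).
by have := cauchy_schwarz x y; lra.
Qed.

Lemma snorm_abs_cs x y : `|ip x y| <= nm x * nm y.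
Proof.
rewrite ler_norml cauchy_schwarz andbT lerNl -sipNl.
by rewrite (le_trans (cauchy_schwarz _ _))// snormN.
Qed.

Lemma snorm_tri y x z : nm (x - z) <= nm (x - y) + nm (y - z).
Proof. by rewrite (le_trans _ (snormD _ _))// addrA subrK. Qed.

Lemma snorm_sum (I : eqType) (r : seq I) (F : I -> H) :
  nm (\sum_(i <- r) F i) <= \sum_(i <- r) nm (F i).
Proof.
elim/big_ind2 : _ => //; first by rewrite snorm0.
by move=> a b c d ab cd; rewrite (le_trans (snormD _ _))// lerD.
Qed.

Lemma snorm_eq0 x : nm x = 0 <-> ip x x = 0.
Proof.
split=> [x0|x0]; first by rewrite -snorm_sqr x0 expr0n.
by rewrite /snorm x0 sqrtr0.
Qed.

Definition scvg (u : nat -> H) x := nm (u n - x) @[n --> \oo] --> (0 : R).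

Lemma scvgP (u : nat -> H) x :
  scvg u x <-> forall e, 0 < e -> exists N, forall n, (N <= n)%N -> nm (u n - x) <= e.
Proof.
split=> [/cvgrPdist_le ux e /ux [N _ Nu]|h].
  exists N => n /Nu; rewrite sub0r normrN ger0_norm// snorm_ge0 //.
apply/cvgrPdist_le => e /h [N Nu]; exists N => //= n /Nu.
by rewrite sub0r normrN ger0_norm// snorm_ge0.
Qed.

(** Stated with an error [e] since the bounds on approximations hold only up to
    a term that tends to zero. *)
Lemma scvg_le (u : nat -> H) x y (B : R) :
  scvg u x -> (forall e, 0 < e -> exists N, forall n, (N <= n)%N -> nm (u n - y) <= B + e) ->
  nm (x - y) <= B.
Proof.
move=> /scvgP ux uy; apply/ler_addgt0Pl => e e0.
have e20 : 0 < e / 2 by rewrite divr_gt0.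
have [N1 h1] := ux _ e20; have [N2 h2] := uy _ e20.
have := snorm_tri (u (maxn N1 N2)) x y; rewrite (snorm_sym x (u _)).
have := h1 _ (leq_maxl N1 N2); have := h2 _ (leq_maxr N1 N2); lra.
Qed.

Definition scauchy (u : nat -> H) := forall e, 0 < e ->
  exists N, forall m n, (N <= m)%N -> (N <= n)%N -> nm (u m - u n) <= e.

Definition scomplete := forall u, scauchy u -> exists x, scvg u x.

End SemiInnerTheory.

(** * Maximal dissipative relations *)

(** An operator is given by its graph, a relation: the value of a weak second
    derivative is only determined up to null functions. *)
Record dissipative (R : realType) (H : lmodType R) (ip : semi_inner H)
    (om : R) (A : H -> H -> Prop) : Prop := Dissipative {
  dis_lin : forall k x w y v, A x w -> A y v -> A (k *: x + y) (k *: w + v);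
  dis_le : forall x w, A x w -> ip x w <= - om * ip x x }.

(** The range condition says that the implicit Euler step of length [h] from [f]
    can be solved; the null condition that the relation descends to the quotient
    by null vectors, that is, that it is the graph of an operator there. *)
Record maximal_dissipative (R : realType) (H : lmodType R) (ip : semi_inner H)
    (om : R) (A : H -> H -> Prop) : Prop := MaximalDissipative {
  md_dis :> dissipative ip om A;
  md_null : forall x w, A x w -> snorm ip x = 0 -> snorm ip w = 0;
  md_range : forall h f, 0 < h -> exists y, A y (h^-1 *: (y - f)) }.

Section Resolvent.
Variables (R : realType) (H : lmodType R) (ip : semi_inner H) (om : R).
Variable A : H -> H -> Prop.
Local Notation nm := (snorm ip).
Hypothesis dA : dissipative ip om A.

Lemma dis_sub x w y v : A x w -> A y v -> A (x - y) (w - v).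
Proof.
move=> Ax Ay; have := dis_lin dA (-1) Ay Ax.
by rewrite !scaleN1r ![- _ + _]addrC.
Qed.

Lemma dis_scale k x w : A x w -> A (k *: x) (k *: w).
Proof.
move=> Ax; have := dis_lin dA k Ax (dis_sub Ax Ax).
by rewrite !subrr !addr0.
Qed.

Lemma dis_add x w y v : A x w -> A y v -> A (x + y) (w + v).
Proof. by move=> Ax /(dis_lin dA 1 Ax); rewrite !scale1r. Qed.

(** Dissipativity makes [1 - h A] expansive with factor [1 + om h]; this is the
    source of both stability and decay of the Euler scheme. *)
Lemma resolvent_bound h d e : 0 <= h -> A d e ->
  (1 + om * h) * nm d <= nm (d - h *: e).
Proof.
move=> h0 /(dis_le dA) de.
have [->|d0] := eqVneq (nm d) 0; first by rewrite mulr0 snorm_ge0.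
have dp : 0 < nm d by rewrite lt0r d0 snorm_ge0.
rewrite -(ler_pM2l dp); apply: le_trans (cauchy_schwarz _ _ _).
rewrite !sipE mulrCA -expr2 snorm_sqr.
by have := ler_wpM2l h0 de; lra.
Qed.

Lemma resolvent_contr h d e : 0 <= h -> 0 <= om -> A d e ->
  nm d <= nm (d - h *: e).
Proof.
move=> h0 om0 /(resolvent_bound h0); apply: le_trans.
by rewrite ler_peMl ?snorm_ge0// lerDl mulr_ge0.
Qed.

(** As [om > 0] the relation is injective with bounded inverse. Convergence of
    [A z_k] therefore yields convergence of [z_k]; this is how the time integrals
    of the approximations are seen to converge. *)
Lemma coercive d e : 0 < om -> A d e -> nm d <= om^-1 * nm e.
Proof.
move=> om0 /(dis_le dA) de; rewrite ler_pdivlMl//.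
have [->|d0] := eqVneq (nm d) 0; first by rewrite mulr0 snorm_ge0.
have dp : 0 < nm d by rewrite lt0r d0 snorm_ge0.
rewrite -(ler_pM2l dp); apply: le_trans (_ : - ip d e <= _).
  by rewrite mulrCA -expr2 snorm_sqr; lra.
by rewrite -sipNr (le_trans (cauchy_schwarz _ _ _))// snormN.
Qed.

(** The domain of A^2, together with a choice of Ax and of A^2 x. *)
Definition dom2 x x1 x2 := A x x1 /\ A x1 x2.

(** The resolvent commutes with [A], so an implicit Euler step preserves the
    domain of the square and contracts along the whole chain x, Ax, A^2 x. *)
Lemma step_dom2 h x x1 x2 y : 0 < h -> 0 <= om -> dom2 x x1 x2 ->
  A y (h^-1 *: (y - x)) ->
  exists y1 y2, [/\ dom2 y y1 y2, y - h *: y1 = x, y1 - h *: y2 = x1,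
    nm y1 <= nm x1 & nm y2 <= nm x2].
Proof.
move=> h0 om0 [Ax Ax1] Ay; have hN0 : h != 0 by rewrite gt_eqF.
pose y1 := h^-1 *: (y - x); pose y2 := h^-1 *: (y1 - x1).
have A1 : A y1 y2 by apply: dis_scale; apply: dis_sub.
have A2 : A y2 (h^-1 *: (y2 - x2)) by apply: dis_scale; apply: dis_sub.
have E1 : y1 - h *: y2 = x1 by rewrite /y2; lin_eq R.
exists y1, y2; split => //.
- by rewrite /y1; lin_eq R.
- by rewrite -E1; apply: resolvent_contr => //; exact: ltW.
- rewrite (_ : x2 = y2 - h *: (h^-1 *: (y2 - x2))); last by lin_eq R.
  by apply: resolvent_contr => //; exact: ltW.
Qed.

(** One Euler step of length 2h against two of length h: since
    (1 - h A)^2 - (1 - 2 h A) = h^2 A^2, the defect is of second order. *)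
Lemma half_step h x x1 x2 z y y' : 0 < h -> 0 <= om -> dom2 x x1 x2 ->
  A z ((2 * h)^-1 *: (z - x)) -> A y (h^-1 *: (y - x)) ->
  A y' (h^-1 *: (y' - y)) -> nm (z - y') <= h ^+ 2 * nm x2.
Proof.
move=> h0 om0 dx Az Ay Ay'; have hN0 : h != 0 by rewrite gt_eqF.
have [y1 [y2 [dy E1 E2 _ n2]]] := step_dom2 h0 om0 dx Ay.
have [w1 [w2 [[Aw1 _] F1 F2 _ m2]]] := step_dom2 h0 om0 dy Ay'.
have Azw := dis_sub Az Aw1.
apply: (@le_trans _ _ (nm (h ^+ 2 *: w2))); last first.
  by rewrite snormZ ger0_norm ?sqr_ge0// ler_wpM2l ?sqr_ge0// (le_trans m2).
rewrite (_ : h ^+ 2 *: w2 =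
    z - y' - (2 * h) *: ((2 * h)^-1 *: (z - x) - w1)); last first.
  by rewrite -E1 -F1 -F2; lin_eq R.
by apply: resolvent_contr => //; rewrite mulr_ge0// ltW.
Qed.

End Resolvent.

Section SemiNormMore.
Variables (R : realType) (H : lmodType R) (ip : semi_inner H).
Local Notation nm := (snorm ip).

Lemma snorm_eqvl x y z : nm (x - y) = 0 -> nm (x - z) = nm (y - z).
Proof.
move=> xy; apply/eqP; rewrite eq_le.
have := snorm_tri ip y x z; have := snorm_tri ip x y z.
by rewrite (snorm_sym ip y x) xy !add0r => -> ->.
Qed.

Lemma snorm_eqvr x y z : nm (x - y) = 0 -> nm (z - x) = nm (z - y).
Proof. by rewrite !(snorm_sym ip z); exact: snorm_eqvl. Qed.

Lemma snorm_eqv x y : nm (x - y) = 0 -> nm x = nm y.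
Proof. by move/(@snorm_eqvl _ _ 0); rewrite !subr0. Qed.

Lemma scvg_lin k (u v : nat -> H) x y : scvg ip u x -> scvg ip v y ->
  scvg ip (fun n => k *: u n + v n) (k *: x + y).
Proof.
move=> /scvgP ux /scvgP vy; apply/scvgP => e e0.
have k0 : 0 < `|k| + 1 by rewrite ltr_pwDr.
have e1 : 0 < e / 2 / (`|k| + 1) by rewrite !divr_gt0.
have e2 : 0 < e / 2 by rewrite divr_gt0.
have [N1 h1] := ux _ e1; have [N2 h2] := vy _ e2.
exists (maxn N1 N2) => n; rewrite geq_max => /andP[/h1 {}h1 /h2 {}h2].
rewrite (_ : _ - _ = k *: (u n - x) + (v n - y)); last by lin_eq R.
rewrite (le_trans (snormD _ _ _))// snormZ.
have : `|k| * nm (u n - x) <= (`|k| + 1) * (e / 2 / (`|k| + 1)).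
  by rewrite ler_pM// ?snorm_ge0// lerDl.
by rewrite mulrCA mulfV ?gt_eqF// mulr1; lra.
Qed.

Lemma scvg_sub (u v : nat -> H) x y : scvg ip u x -> scvg ip v y ->
  scvg ip (fun n => u n - v n) (x - y).
Proof.
move=> ux vy; have := scvg_lin (-1) vy ux.
rewrite scaleN1r addrC; congr (scvg _ _ _).
by apply/funext => n; rewrite scaleN1r addrC.
Qed.

Lemma scvg_cst x : scvg ip (fun=> x) x.
Proof. by apply/scvgP => e e0; exists 0%N => n _; rewrite subrr snorm0 ltW. Qed.

Lemma scvg_norm_le (u : nat -> H) x (B : R) : scvg ip u x ->
  (forall e, 0 < e -> exists N, forall n, (N <= n)%N -> nm (u n) <= B + e) ->
  nm x <= B.
Proof.
move=> ux h; rewrite -[x]subr0; apply: (scvg_le ux) => e /h[N Nh].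
by exists N => n /Nh; rewrite subr0.
Qed.

Lemma scvg_eqv (u : nat -> H) x y : scvg ip u x -> nm (x - y) = 0 -> scvg ip u y.
Proof.
move=> /scvgP ux xy; apply/scvgP => e /ux[N h]; exists N => n /h.
by rewrite (snorm_eqvr _ xy).
Qed.

Lemma scvg_small x : (forall e, 0 < e -> nm x <= e) -> nm x = 0.
Proof.
move=> h; apply/eqP; rewrite eq_le snorm_ge0 andbT.
by apply/ler_addgt0Pl => e /h; rewrite addr0.
Qed.

End SemiNormMore.

Section Maximal.
Variables (R : realType) (H : lmodType R) (ip : semi_inner H) (om : R).
Variable A : H -> H -> Prop.
Local Notation nm := (snorm ip).
Hypothesis mA : maximal_dissipative ip om A.
Hypothesis om0 : 0 < om.
Hypothesis cH : scomplete ip.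
Let dA : dissipative ip om A := mA.
Let om0' : 0 <= om := ltW om0.

Definition resolvent h f := xget 0 [set y | A y (h^-1 *: (y - f))].
Local Notation J := resolvent.

Lemma resolventP h f : 0 < h -> A (J h f) (h^-1 *: (J h f - f)).
Proof.
move=> h0; have [y Ay] := md_range mA f h0.
by rewrite /J; case: xgetP => [z -> //|/(_ y)].
Qed.

Lemma resolvent_lip h f g : 0 < h -> nm (J h f - J h g) <= nm (f - g).
Proof.
move=> h0; have hN0 : h != 0 by rewrite gt_eqF.
have := dis_sub dA (resolventP f h0) (resolventP g h0).
move/(resolvent_contr dA (ltW h0) om0').
by congr (_ <= nm _); lin_eq R.
Qed.

Lemma resolvent_decay h f : 0 < h -> nm (J h f) <= (1 + om * h)^-1 * nm f.
Proof.
move=> h0; have hN0 : h != 0 by rewrite gt_eqF.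
rewrite ler_pdivlMl ?ltr_pwDl ?mulr_ge0 ?(ltW h0)//.
have := resolvent_bound dA (ltW h0) (resolventP f h0).
by congr (_ <= nm _); lin_eq R.
Qed.

Lemma resolvent_le h f : 0 < h -> nm (J h f) <= nm f.
Proof.
move=> h0; apply: le_trans (resolvent_decay _ h0) _.
by rewrite ler_piMl ?snorm_ge0// invf_le1 ?ltr_pwDl ?lerDl ?mulr_ge0 ?(ltW h0).
Qed.

(** If (x, y) is a limit of elements of the graph, then x is within distance zero
    of the resolvent of [x - y], by contractivity. *)
Lemma graph_closed (u w : nat -> H) x y : (forall n, A (u n) (w n)) ->
  scvg ip u x -> scvg ip w y ->
  exists x' y', [/\ A x' y', nm (x - x') = 0 & nm (y - y') = 0].
Proof.
move=> Auw ux wy; pose z := J 1 (x - y).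
have Az : A z (1^-1 *: (z - (x - y))) by exact: resolventP.
have zx : nm (x - z) = 0.
  apply/eqP; rewrite eq_le snorm_ge0 andbT.
  apply: (scvg_le ux) => e e0; rewrite add0r.
  have e20 : 0 < e / 2 by rewrite divr_gt0.
  have /scvgP/(_ _ e20)[N1 h1] := ux; have /scvgP/(_ _ e20)[N2 h2] := wy.
  exists (maxn N1 N2) => n; rewrite geq_max => /andP[/h1 {}h1 /h2 {}h2].
  apply: le_trans (resolvent_contr dA ler01 om0' (dis_sub dA (Auw n) Az)) _.
  rewrite (_ : _ - _ = (u n - x) - (w n - y)); last by lin_eq R.
  by have := snormD ip (u n - x) (- (w n - y)); rewrite snormN; lra.
exists z, (1^-1 *: (z - (x - y))); split => //.
by rewrite (_ : _ - _ = x - z)//; lin_eq R.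
Qed.

Section Density.
Variable x : H.
Let h n : R := n.+1%:R^-1.
Let y n := J (h n) x.
Let z n := y n - x.
Let h0 n : 0 < h n. Proof. by rewrite invr_gt0 ltr0n. Qed.

(** Dissipativity at [y n - y m], with [A (y n) = z n / h n], compares the scaled
    defects; with a = n + 1 and b = m + 1 it reads
    (a + b) |z n - z m|^2 <= (a - b) (|z m|^2 - |z n|^2). *)
Let zmono m n : (m <= n)%N ->
  nm (z n - z m) ^+ 2 <= nm (z m) ^+ 2 - nm (z n) ^+ 2.
Proof.
rewrite leq_eqVlt => /predU1P[->|mn]; first by rewrite !subrr snorm0 expr0n.
have := dis_le dA (dis_sub dA (resolventP x (h0 n)) (resolventP x (h0 m))).
rewrite -!/(y _) -!/(z _) (_ : y n - y m = z n - z m); last by rewrite /z; lin_eq R.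
have : 0 <= om * ip (z n - z m) (z n - z m) by rewrite mulr_ge0 ?sip_ge0.
rewrite /h !invrK; move: (z n) (z m) => u v.
rewrite !snorm_sqr; have := sip_ge0 ip (u - v).
rewrite !sipE (sipC ip v u) => d0 od.
set X := ip u u in d0 od *; set Y := ip v v in d0 od *.
set P := ip u v in d0 od *.
have mnR : m.+1%:R < n.+1%:R :> R by rewrite ltr_nat.
have m0 : 0 < m.+1%:R :> R by rewrite ltr0n.
move: mnR m0; set a := n.+1%:R : R; set b := m.+1%:R : R => ab b0 dd.
have k1 : (a + b) * (X - P - P + Y) <= (a - b) * (Y - X) by move: dd od; lra.
have YX : 0 <= Y - X.
  rewrite -(@pmulr_rge0 _ (a - b)); last lra.
  by apply: le_trans k1; rewrite mulr_ge0; lra.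
have k2 : (a + b) * (X - P - P + Y) <= (a + b) * (Y - X).
  by apply: (le_trans k1); rewrite ler_wpM2r//; lra.
by move: k2; rewrite ler_pM2l; lra.
Qed.

(** The squared norms of [J_h x - x] decrease as h goes to 0, and control the
    mutual distances; so the sequence converges. The limit z satisfies A 0 = z
    by closedness, whence it vanishes. *)
Lemma resolvent_cvg : scvg ip y x.
Proof.
have zc : scauchy ip z.
  pose v n := nm (z n) ^+ 2.
  have vd : nonincreasing_seq v.
    move=> m n mn; rewrite -subr_ge0 (le_trans _ (zmono mn))//.
    by rewrite sqr_ge0.
  have vb : has_lbound (range v) by exists 0 => _ [n _ <-]; rewrite sqr_ge0.
  have vl := nonincreasing_is_cvgn vd vb.
  move=> e e0; have e20 : 0 < e ^+ 2 by rewrite exprn_gt0.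
  have /cvgrPdist_le/(_ _ e20)[N _ NP] := vl.
  have key m n : (N <= m)%N -> (m <= n)%N -> nm (z n - z m) <= e.
    move=> Nm mn; rewrite -(@ler_pXn2r _ 2)// ?nnegrE ?snorm_ge0 ?(ltW e0)//.
    apply: le_trans (zmono mn) _; rewrite -/(v m) -/(v n).
    have := NP _ Nm; rewrite ler_norml => /andP[+ _].
    by have := nonincreasing_cvgn_ge vd vl n; lra.
  exists N => m n Nm Nn; have [mn|nm_] := leqP m n.
    by rewrite snorm_sym; exact: key.
  by apply: key => //; exact: ltnW.
have [w zw] := cH zc.
have Az n : A (h n *: y n) (z n).
  have := dis_scale dA (h n) (resolventP x (h0 n)).
  by rewrite scalerA mulfV ?gt_eqF// scale1r.
have hy : scvg ip (fun n => h n *: y n) 0.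
  apply/scvgP => e e0.
  have := @cvg_harmonic R => /cvgrPdist_le/(_ (e / (nm x + 1))).
  case=> [|N _ NP]; first by rewrite divr_gt0// ltr_pwDr// snorm_ge0.
  exists N => n /NP; rewrite sub0r normrN /= -/(h n) subr0 snormZ => hn.
  have xp : 0 < nm x + 1 by rewrite ltr_pwDr// snorm_ge0.
  rewrite (_ : e = e / (nm x + 1) * (nm x + 1)); last by field; rewrite gt_eqF.
  rewrite ler_pM// ?snorm_ge0// (le_trans (resolvent_le _ _))// lerDl//.
have [x' [w' [Aw xx' ww']]] := graph_closed Az hy zw.
have w0 : nm (w - 0) = 0.
  rewrite subr0 (snorm_eqv ww'); apply: (md_null mA Aw).
  by rewrite -(snorm_eqv xx') snorm0.
move: (scvg_eqv zw w0) => /scvgP h1; apply/scvgP => e /h1[N NP].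
by exists N => n /NP; rewrite subr0.
Qed.

End Density.

(** Two applications of the resolvent with a small parameter move x little and
    end in the domain of the square. *)
Lemma dom2_dense x e : 0 < e ->
  exists x' x1 x2, dom2 A x' x1 x2 /\ nm (x - x') <= e.
Proof.
move=> e0; have /scvgP/(_ (e / 2))[|N NP] := resolvent_cvg x.
  by rewrite divr_gt0.
pose h : R := N.+1%:R^-1; have h0 : 0 < h by rewrite invr_gt0 ltr0n.
have /NP := leqnn N; rewrite -/h => hx.
have A1 := resolventP x h0; have A2 := resolventP (J h x) h0.
exists (J h (J h x)); do 2 eexists; split.
  split; first exact: A2.
  by apply: (dis_scale dA); exact: (dis_sub dA A2 A1).
rewrite snorm_sym (le_trans (snorm_tri ip (J h x) _ _))//.
by have := resolvent_lip (J h x) x h0; move: hx; lra.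
Qed.

End Maximal.

(** * The implicit Euler scheme *)

Section Mesh.
Variable R : realType.

(** Dyadic steps: each Euler iteration is compared with the one of half the step,
    and the errors form a geometric series. *)
Definition mesh k : R := (2 ^+ k)^-1.
Definition mesh_count k (t : R) := Num.truncn (t * 2 ^+ k).

Lemma mesh_gt0 k : 0 < mesh k.
Proof. by rewrite invr_gt0 exprn_gt0. Qed.

Lemma meshS k : mesh k = 2 * mesh k.+1.
Proof. by rewrite /mesh exprS; field; rewrite expf_neq0. Qed.

Lemma mesh_le1 k : mesh k <= 1.
Proof. by rewrite invf_le1 ?exprn_gt0// exprn_ege1// ler1n. Qed.

Lemma mesh_small (C e : R) : 0 < e ->
  exists N, forall k, (N <= k)%N -> C * mesh k <= e.
Proof.
move=> e0; have C0 : 0 < `|C| + 1 by rewrite ltr_pwDr.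
have q1 : `|2^-1 : R| < 1 by rewrite ger0_norm ?invf_lt1 ?ltr1n// invr_ge0.
have /cvgrPdist_le/(_ (e / (`|C| + 1)))[|N _ NP] := cvg_expr q1.
  by rewrite divr_gt0.
exists N => k /NP; rewrite sub0r normrN /= normrX ger0_norm ?invr_ge0//.
rewrite exprVn -/(mesh k) ler_pdivlMr// => h.
apply: le_trans h; rewrite mulrC; apply: ler_wpM2l; first exact/ltW/mesh_gt0.
by rewrite (le_trans (ler_norm C))// lerDl.
Qed.

Lemma mesh_countP k (t : R) : 0 <= t ->
  (mesh_count k t)%:R * mesh k <= t /\ t < (mesh_count k t)%:R * mesh k + mesh k.
Proof.
move=> t0; have p0 : 0 < 2 ^+ k :> R by rewrite exprn_gt0.
have /andP[h1 h2] : (mesh_count k t)%:R <= t * 2 ^+ k < (mesh_count k t).+1%:R.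
  by apply: Num.Theory.truncn_itv; rewrite mulr_ge0// ltW.
rewrite /mesh; split; first by rewrite ler_pdivrMr.
by rewrite -[X in _ + X]mul1r -mulrDl natr1 ltr_pdivlMr.
Qed.

Lemma mesh_countS k (t : R) : 0 <= t ->
  exists b : bool, mesh_count k.+1 t = ((mesh_count k t).*2 + b)%N.
Proof.
move=> t0; have p0 : 0 < 2 ^+ k :> R by rewrite exprn_gt0.
have tp : 0 <= t * 2 ^+ k by rewrite mulr_ge0// ltW.
have /andP[h1 h2] := Num.Theory.truncn_itv tp.
exists ((mesh_count k t).*2.+1%:R <= t * 2 ^+ k.+1).
rewrite /mesh_count exprS in h1 h2 *; set n := Num.truncn (t * 2 ^+ k) in h1 h2 *.
have E : n.*2%:R = 2 * n%:R :> R by rewrite -mul2n natrM.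
have E0 : n.+1%:R = n%:R + 1 :> R by rewrite natr1.
have E1 : n.*2.+1%:R = 2 * n%:R + 1 :> R by rewrite -E natr1.
have E2 : n.*2.+2%:R = 2 * n%:R + 2 :> R by rewrite -natr1 E1; lra.
rewrite E0 in h2.
apply: Num.Theory.truncn_def.
case: (boolP (n.*2.+1%:R <= _)) => /= h; rewrite ?addn1 ?addn0.
  rewrite h/= E2; lra.
move: h; rewrite -ltNge E1 => h; rewrite E; apply/andP; split; lra.
Qed.

Lemma mesh_count_le k (s t : R) : s <= t -> (mesh_count k s <= mesh_count k t)%N.
Proof. by move=> st; apply: Num.Theory.le_truncn; rewrite ler_wpM2r. Qed.

End Mesh.

Section Geometric.
Variables (R : realType) (H : lmodType R) (ip : semi_inner H).
Local Notation nm := (snorm ip).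

Lemma geometric_cauchy (u : nat -> H) (C : R) :
  (forall k, nm (u k.+1 - u k) <= C * mesh R k) -> scauchy ip u.
Proof.
move=> h; have key k j : nm (u (k + j)%N - u k) <= 2 * C * (mesh R k - mesh R (k + j)).
  elim: j => [|j ih]; first by rewrite addn0 !subrr snorm0 mulr0.
  rewrite (le_trans (snorm_tri ip (u (k + j)%N) _ _))//.
  have := h (k + j)%N; rewrite -addnS.
  have := meshS R (k + j); rewrite -addnS.
  move: ih; set a := mesh R (k + j); set b := mesh R (k + j.+1) => ih ab hh.
  by rewrite ab in ih hh; lra.
have C0 : 0 <= C.
  have := le_trans (snorm_ge0 ip _) (h 0%N).
  by rewrite pmulr_lge0// mesh_gt0.
move=> e e0; have [N NP] := mesh_small (2 * C) e0.
exists N => m n; wlog mn : m n / (n <= m)%N => [w|] Nm Nn.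
  by have [/w|/ltnW/w] := leqP n m; [apply|rewrite snorm_sym; apply].
have := key n (m - n)%N; rewrite subnKC// => /le_trans; apply.
rewrite (le_trans _ (NP _ Nn))// ler_wpM2l ?mulr_ge0//.
by rewrite gerBl ltW// mesh_gt0.
Qed.

End Geometric.

Section Euler.
Variables (R : realType) (H : lmodType R) (ip : semi_inner H) (om : R).
Variable A : H -> H -> Prop.
Local Notation nm := (snorm ip).
Hypothesis mA : maximal_dissipative ip om A.
Hypothesis om0 : 0 < om.
Hypothesis cH : scomplete ip.
Let dA : dissipative ip om A := mA.
Let om0' : 0 <= om := ltW om0.
Local Notation J := (resolvent A).

Definition euler h n x := iter n (J h) x.

Lemma euler_lip h n x y : 0 < h -> nm (euler h n x - euler h n y) <= nm (x - y).
Proof.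
move=> h0; elim: n => // n ih; apply: le_trans ih.
exact: (resolvent_lip mA om0).
Qed.

Lemma euler_decay h n x : 0 < h -> nm (euler h n x) <= (1 + om * h)^-1 ^+ n * nm x.
Proof.
move=> h0; elim: n => [|n ih]; first by rewrite expr0 mul1r.
rewrite exprS -mulrA; apply: le_trans (resolvent_decay mA om0 _ h0) _.
by rewrite ler_wpM2l// invr_ge0 addr_ge0// mulr_ge0// ltW.
Qed.

Lemma euler_le h n x : 0 < h -> nm (euler h n x) <= nm x.
Proof.
move=> h0; elim: n => // n ih; apply: le_trans ih.
exact: (resolvent_le mA om0).
Qed.

Lemma euler_dom2 h n x x1 x2 : 0 < h -> dom2 A x x1 x2 ->
  exists y1 y2, [/\ dom2 A (euler h n x) y1 y2, nm y1 <= nm x1 & nm y2 <= nm x2].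
Proof.
move=> h0 dx; elim: n => [|n [y1 [y2 [dy n1 n2]]]]; first by exists x1, x2.
have [w1 [w2 [dw _ _ m1 m2]]] :=
  step_dom2 dA h0 om0' dy (resolventP mA (euler h n x) h0).
by exists w1, w2; split => //; [exact: le_trans n1|exact: le_trans n2].
Qed.

Lemma euler_lip_time h n m x x1 x2 : 0 < h -> dom2 A x x1 x2 ->
  nm (euler h (n + m) x - euler h n x) <= m%:R * h * nm x1.
Proof.
move=> h0 dx; elim: m => [|m ih]; first by rewrite addn0 subrr snorm0 !mul0r.
rewrite addnS (le_trans (snorm_tri ip (euler h (n + m) x) _ _))//.
have [y1 [y2 [dy n1 n2]]] := euler_dom2 (n + m) h0 dx.
have [w1 [w2 [dw E _ m1 m2]]] :=
  step_dom2 dA h0 om0' dy (resolventP mA (euler h (n + m) x) h0).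
have : nm (euler h (n + m).+1 x - euler h (n + m) x) <= h * nm x1.
  rewrite -[euler h (n + m) x]E opprB addrC subrK snormZ gtr0_norm//.
  by rewrite ler_pM2l// (le_trans m1).
by rewrite -natr1; move: ih; lra.
Qed.

(** The local defects of [half_step] add up, since each step is a contraction. *)
Lemma euler_half h n x x1 x2 : 0 < h -> dom2 A x x1 x2 ->
  nm (euler (2 * h) n x - euler h n.*2 x) <= n%:R * h ^+ 2 * nm x2.
Proof.
move=> h0 dx; elim: n => [|n ih]; first by rewrite subrr snorm0 !mul0r.
have h20 : 0 < 2 * h by rewrite mulr_gt0.
rewrite doubleS.
rewrite (le_trans (snorm_tri ip (J (2 * h) (euler h n.*2 x)) _ _))//.
have [y1 [y2 [dy n1 n2]]] := euler_dom2 n.*2 h0 dx.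
have := half_step dA h0 om0' dy (resolventP mA _ h20)
  (resolventP mA (euler h n.*2 x) h0) (resolventP mA _ h0).
have := le_trans (resolvent_lip mA om0 _ _ h20) ih.
have : h ^+ 2 * nm y2 <= h ^+ 2 * nm x2 by rewrite ler_wpM2l// sqr_ge0.
by rewrite -natr1 /=; lra.
Qed.

(** Both are taken at the last mesh point before t. The sum of the iterates
    starts with the first step, not with x: this makes [euler_int_graph] exact. *)
Definition euler_at k (t : R) x := euler (mesh R k) (mesh_count k t) x.
Definition euler_int k (t : R) x :=
  mesh R k *: \sum_(i < mesh_count k t) euler (mesh R k) i.+1 x.

(** The term with x1 is present because the finer mesh may contain one more point
    before t than the refinement of the coarse one. *)
Lemma euler_at_step k t x x1 x2 : 0 <= t -> dom2 A x x1 x2 ->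
  nm (euler_at k.+1 t x - euler_at k t x) <= (t * nm x2 + nm x1) * mesh R k.
Proof.
move=> t0 dx; have [b E] := mesh_countS k t0.
have h0 := mesh_gt0 R k.+1; have [c1 _] := mesh_countP k t0.
have hk := meshS R k; have hl := mesh_le1 R k.+1.
rewrite /euler_at E [in X in _ - X]hk.
set n := mesh_count k t in c1 *; set h := mesh R k.+1 in h0 hk hl *.
rewrite (le_trans (snorm_tri ip (euler h n.*2 x) _ _))//.
have := euler_lip_time n.*2 b h0 dx.
have := euler_half n h0 dx => a1 a2; rewrite snorm_sym in a1.
rewrite hk in c1 *.
have b1 : b%:R * h * nm x1 <= h * nm x1.
  by rewrite ler_wpM2r ?snorm_ge0// ler_piMl ?(ltW h0)// lern1; case: (b).
have b2 : n%:R * h ^+ 2 * nm x2 <= t * h * nm x2.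
  rewrite ler_wpM2r ?snorm_ge0// expr2 mulrA ler_wpM2r ?(ltW h0)//.
  by apply: le_trans c1; rewrite ler_wpM2l//; lra.
have p1 : 0 <= h * nm x1 by rewrite mulr_ge0 ?snorm_ge0// ltW.
have p2 : 0 <= t * h * nm x2 by rewrite !mulr_ge0 ?snorm_ge0// ltW.
by move: a1 a2 b1 b2 p1 p2; lra.
Qed.

Lemma euler_at_cauchy t x : 0 <= t -> scauchy ip (fun k => euler_at k t x).
Proof.
move=> t0 e e0; have e30 : 0 < e / 3 by rewrite divr_gt0.
have [x' [x1 [x2 [dx xx]]]] := dom2_dense mA om0 cH x e30.
have [N NP] := geometric_cauchy (fun k => euler_at_step k t0 dx) e30.
exists N => m n Nm Nn.
have h1 := euler_lip (mesh_count m t) x x' (mesh_gt0 R m).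
have h2 := euler_lip (mesh_count n t) x x' (mesh_gt0 R n).
have h3 := NP _ _ Nm Nn.
rewrite (_ : euler_at m t x - _ = (euler_at m t x - euler_at m t x') +
  (euler_at m t x' - euler_at n t x') - (euler_at n t x - euler_at n t x'));
  last by lin_eq R.
rewrite (le_trans (snormD _ _ _))// snormN.
have := snormD ip (euler_at m t x - euler_at m t x')
  (euler_at m t x' - euler_at n t x').
by rewrite /euler_at in h3 *; move: h1 h2 h3 xx; lra.
Qed.

(** The Euler steps telescope: the scheme is the integrated equation. *)
Lemma euler_int_graph k t x : A (euler_int k t x) (euler_at k t x - x).
Proof.
have h0 := mesh_gt0 R k; rewrite /euler_int /euler_at; set n := mesh_count k t.
set h := mesh R k in h0 *.
rewrite (_ : euler h n x - x = h *: (\sum_(i < n) h^-1 *: (euler h i.+1 x - euler h i x))).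
  apply: (dis_scale dA); elim: n => [|n ih].
    have A0 := resolventP mA 0 h0.
    by have := dis_sub dA A0 A0; rewrite !subrr !big_ord0.
  by rewrite !big_ord_recr; apply: (dis_add dA ih); exact: (resolventP mA _ h0).
rewrite -scaler_sumr scalerA mulfV ?gt_eqF// scale1r.
by rewrite -(big_mkord xpredT (fun i => euler h i.+1 x - euler h i x)) telescope_sumr.
Qed.

Lemma euler_int_lip k t x y : 0 <= t ->
  nm (euler_int k t x - euler_int k t y) <= t * nm (x - y).
Proof.
move=> t0; rewrite /euler_int -scalerBr snormZ gtr0_norm ?mesh_gt0//.
rewrite -sumrB; have [c1 _] := mesh_countP k t0.
apply: le_trans (_ : mesh R k * ((mesh_count k t)%:R * nm (x - y)) <= _).
  rewrite ler_pM2l ?mesh_gt0//.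
  apply: le_trans (snorm_sum _ _ _) _.
  rewrite -[X in X%:R]card_ord -sum1_card natr_sum mulr_suml.
  by apply: ler_sum => i _; rewrite mul1r euler_lip// mesh_gt0.
by rewrite mulrA ler_wpM2r ?snorm_ge0// mulrC.
Qed.

(** No estimate of the quadrature is needed: the integrals are images of a Cauchy
    sequence by the bounded inverse of [A]. *)
Lemma euler_int_cauchy t x : 0 <= t -> scauchy ip (fun k => euler_int k t x).
Proof.
move=> t0 e e0; have ee : 0 < om * e by rewrite mulr_gt0.
have [N NP] := euler_at_cauchy x t0 ee; exists N => m n Nm Nn.
have := coercive dA om0 (dis_sub dA (euler_int_graph m t x) (euler_int_graph n t x)).
move=> /le_trans; apply; rewrite ler_pdivrMl//.
have := NP _ _ Nm Nn; congr (nm _ <= _); lin_eq R.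
Qed.

End Euler.

(** * The evolution of a maximal dissipative relation *)

Section Evolution.
Variables (R : realType) (H : lmodType R) (ip : semi_inner H) (om : R).
Variable A : H -> H -> Prop.
Local Notation nm := (snorm ip).
Hypothesis mA : maximal_dissipative ip om A.
Hypothesis om0 : 0 < om.
Hypothesis cH : scomplete ip.

(** A limit is only determined up to null vectors, hence the choice of one. *)
Definition evolution (t : R) x :=
  xget 0 [set y | scvg ip (fun k => euler_at A k t x) y].
Definition evolution_int (t : R) x :=
  xget 0 [set y | scvg ip (fun k => euler_int A k t x) y].
Local Notation S := evolution.
Local Notation I := evolution_int.

Lemma evolutionP t x : 0 <= t -> scvg ip (fun k => euler_at A k t x) (S t x).
Proof.
move=> t0; have [y ys] := cH (euler_at_cauchy mA om0 cH x t0).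
by rewrite /S; case: xgetP => [z -> //|/(_ y)].
Qed.

Lemma evolution_intP t x : 0 <= t -> scvg ip (fun k => euler_int A k t x) (I t x).
Proof.
move=> t0; have [y ys] := cH (euler_int_cauchy mA om0 cH x t0).
by rewrite /I; case: xgetP => [z -> //|/(_ y)].
Qed.

Lemma evolution_lip t x y : 0 <= t -> nm (S t x - S t y) <= nm (x - y).
Proof.
move=> t0; have := scvg_sub (evolutionP x t0) (evolutionP y t0).
move/scvg_norm_le; apply => e e0; exists 0%N => n _.
by rewrite (le_trans (euler_lip mA om0 _ _ _ (mesh_gt0 R n)))// lerDl ltW.
Qed.

Lemma evolution_int_lip t x y : 0 <= t -> nm (I t x - I t y) <= t * nm (x - y).
Proof.
move=> t0; have := scvg_sub (evolution_intP x t0) (evolution_intP y t0).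
move/scvg_norm_le; apply => e e0; exists 0%N => n _.
by rewrite (le_trans (euler_int_lip mA om0 _ _ _ t0))// lerDl ltW.
Qed.

Lemma evolution0 x : nm (S 0 x - x) = 0.
Proof.
apply/eqP; rewrite eq_le snorm_ge0 andbT.
apply: (scvg_le (evolutionP x (lexx 0))) => e e0; exists 0%N => n _.
by rewrite /euler_at /mesh_count mul0r Num.Theory.truncn0 subrr snorm0 add0r ltW.
Qed.

Lemma evolution_int0 x : nm (I 0 x) = 0.
Proof.
apply/eqP; rewrite eq_le snorm_ge0 andbT.
apply: (scvg_norm_le (evolution_intP x (lexx 0))) => e e0; exists 0%N => n _.
by rewrite /euler_int /mesh_count mul0r Num.Theory.truncn0 big_ord0 scaler0 snorm0 add0r ltW.
Qed.

Lemma expR_le_1D2x (y : R) : 0 <= y <= 2^-1 -> expR y <= 1 + 2 * y.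
Proof.
move=> /andP[y0 y1]; have := expR_ge1Dx (- y).
rewrite -(ler_pM2l (expR_gt0 y)) -expRD subrr expR0 => h.
rewrite -(@ler_pM2r _ (1 + - y)); last by lra.
by apply: le_trans h _; nra.
Qed.

(** The Euler iterates decay like (1 + om h)^(-n), which is bounded by
    exp (- om n h / (1 + om h)) because 1 / (1 + y) <= exp (- y / (1 + y)). *)
Lemma evolution_decay t x : 0 <= t -> nm (S t x) <= expR (- om * t) * nm x.
Proof.
move=> t0; apply: (scvg_norm_le (evolutionP x t0)) => e e0.
pose c := om * (1 + om * t); pose P := expR (- om * t) * nm x.
have c0 : 0 <= c by rewrite /c !(mulr_ge0, addr_ge0)// ltW.
have P0 : 0 <= P by rewrite mulr_ge0 ?snorm_ge0// expR_ge0.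
have h2 : (0 : R) < 2^-1 by rewrite invr_gt0.
have [N1 N1P] := mesh_small c h2; have [N2 N2P] := mesh_small (P * (2 * c)) e0.
exists (maxn N1 N2) => k; rewrite geq_max => /andP[/N1P y1 /N2P y2].
have h0 := mesh_gt0 R k.
have [_ cnt] := mesh_countP k t0.
apply: le_trans (euler_decay mA om0 _ _ h0) _.
set n := mesh_count k t in cnt *; set h := mesh R k in cnt h0 y1 y2 *.
have oh : 0 < 1 + om * h by rewrite ltr_pwDl// mulr_ge0// ltW.
have e1 : (1 + om * h)^-1 <= expR (- (om * h / (1 + om * h))).
  apply: le_trans (expR_ge1Dx _); rewrite le_eqVlt; apply/orP; left; apply/eqP.
  by field; rewrite gt_eqF.
have e2 : (1 + om * h)^-1 ^+ n <= expR (- om * t + c * h).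
  apply: le_trans (_ : expR (- (om * h / (1 + om * h))) ^+ n <= _).
    by apply: lerXn2r; rewrite ?nnegrE ?expR_ge0// invr_ge0 ltW.
  rewrite -expRM_natl ler_expR.
  rewrite -(ler_pM2r oh).
  rewrite (_ : _ * - _ * _ = - (om * (n%:R * h))); last by field; rewrite gt_eqF.
  have a1 : om * (t - h) <= om * (n%:R * h) by rewrite ler_pM2l//; lra.
  have a2 : 0 <= om * h * (c * h) by exact: (mulr_ge0 (mulr_ge0 (ltW om0) (ltW h0)) (mulr_ge0 c0 (ltW h0))).
  by rewrite /c in a2 *; move: a1 a2; rewrite /c; lra.
apply: le_trans (_ : P * expR (c * h) <= _).
  by rewrite /P mulrAC -expRD ler_wpM2r// snorm_ge0.
apply: le_trans (_ : P * (1 + 2 * (c * h)) <= _); last first.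
  by move: y2; rewrite /P; lra.
by rewrite ler_wpM2l// expR_le_1D2x// y1 andbT; exact: mulr_ge0 c0 (ltW h0).
Qed.

Section Regular.
Variables (x x1 x2 : H).
Hypothesis dx : dom2 A x x1 x2.

Lemma evolution_lip_time s t : 0 <= s -> s <= t ->
  nm (S t x - S s x) <= (t - s) * nm x1.
Proof.
move=> s0 st; have t0 := le_trans s0 st.
have := scvg_sub (evolutionP x t0) (evolutionP x s0).
move/scvg_norm_le; apply => e e0.
have [N NP] := mesh_small (nm x1) e0; exists N => k /NP kN.
have cst := mesh_count_le k st.
have := euler_lip_time mA om0 (mesh_count k s) (mesh_count k t - mesh_count k s) (mesh_gt0 R k) dx.
rewrite subnKC// natrB// => /le_trans; apply.
have [c1 c2] := mesh_countP k s0; have [d1 d2] := mesh_countP k t0.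
apply: le_trans (_ : (t - s + mesh R k) * nm x1 <= _); last by move: kN; lra.
by rewrite ler_wpM2r ?snorm_ge0//; lra.
Qed.

(** On regular vectors the orbit is Lipschitz in time, so the increment of the
    integral is d S(t) x up to a term of second order. *)
Lemma evolution_int_incr t d : 0 <= t -> 0 <= d ->
  nm (I (t + d) x - I t x - d *: S t x) <= d ^+ 2 * nm x1.
Proof.
move=> t0 d0; have td0 : 0 <= t + d by exact: addr_ge0.
have u1 := scvg_sub (evolution_intP x td0) (evolution_intP x t0).
have := scvg_lin (- d) (evolutionP x t0) u1.
rewrite scaleNr [- _ + _]addrC => /scvg_norm_le; apply => e e0.
have [N NP] := mesh_small (2 * d * nm x1 + nm x1 + nm x) e0.
exists N => k /NP kN.
have h0 := mesh_gt0 R k; have hl := mesh_le1 R k.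
have [c1 c2] := mesh_countP k t0; have [d1 d2] := mesh_countP k td0.
have tdt : t <= t + d by rewrite lerDl.
have ct := mesh_count_le k tdt.
rewrite /euler_int /euler_at; move: kN c1 c2 d1 d2 ct h0 hl.
set h := mesh R k; set n := mesh_count k t.
move: (mesh_count k (t + d)) => p kN c1 c2 d1 d2 np h0 hl.
have [m pE] : exists m, p = (n + m)%N by exists (p - n)%N; rewrite subnKC.
move: d1 d2; rewrite {}pE natrD => d1 d2.
have -> : \sum_(i < n + m) euler A h i.+1 x =
    \sum_(i < n) euler A h i.+1 x + \sum_(i < m) euler A h (i + n).+1 x.
  by rewrite big_split_ord; congr (_ + _); apply: eq_bigr => i _; rewrite (addnC i).
rewrite (_ : - d *: _ + _ = h *: (\sum_(i < m) (euler A h (i + n).+1 x - euler A h n x))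
   + (m%:R * h - d) *: euler A h n x); last first.
  have -> : \sum_(i < m) (euler A h (i + n).+1 x - euler A h n x) =
      \sum_(i < m) euler A h (i + n).+1 x - m%:R *: euler A h n x.
    by rewrite sumrB sumr_const card_ord scaler_nat.
  by lin_eq R.
rewrite (le_trans (snormD _ _ _))// !snormZ (gtr0_norm h0).
have b1 : nm (\sum_(i < m) (euler A h (i + n).+1 x - euler A h n x)) <=
    m%:R * (m%:R * h * nm x1).
  apply: le_trans (snorm_sum _ _ _) _.
  rewrite -[X in X%:R * _]card_ord -sum1_card natr_sum mulr_suml.
  apply: ler_sum => i _; rewrite mul1r -addSn addnC.
  apply: le_trans (euler_lip_time mA om0 n i.+1 h0 dx) _.
  by rewrite ler_wpM2r ?snorm_ge0// ler_pM2r// ler_nat.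
have b2 : `|m%:R * h - d| * nm (euler A h n x) <= h * nm x.
  by rewrite ler_pM ?snorm_ge0 ?(euler_le mA om0)// ler_norml; apply/andP; split; lra.
have b3 : h * nm (\sum_(i < m) (euler A h (i + n).+1 x - euler A h n x)) <=
    (d + h) ^+ 2 * nm x1.
  apply: le_trans (ler_wpM2l (ltW h0) b1) _.
  rewrite (_ : h * _ = (m%:R * h) ^+ 2 * nm x1); last by ring.
  rewrite ler_wpM2r ?snorm_ge0//.
  by apply: lerXn2r; rewrite ?nnegrE ?mulr_ge0 ?addr_ge0 ?(ltW h0)//; lra.
have b4 : h ^+ 2 * nm x1 <= h * nm x1.
  by rewrite ler_wpM2r ?snorm_ge0// expr2 ler_piMl// ltW.
by move: b2 b3 b4 kN; rewrite sqrrD; lra.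
Qed.

Lemma evolution_riemann d n : 0 <= d ->
  nm (I (n%:R * d) x - d *: \sum_(i < n) S (i%:R * d) x) <= n%:R * d ^+ 2 * nm x1.
Proof.
move=> d0; elim: n => [|n ih].
  by rewrite big_ord0 scaler0 subr0 !mul0r evolution_int0.
have -> : \sum_(i < n.+1) S (i%:R * d) x =
    \sum_(i < n) S (i%:R * d) x + S (n%:R * d) x by rewrite big_ord_recr.
have -> : n.+1%:R * d = n%:R * d + d by rewrite -natr1 mulrDl mul1r.
rewrite (_ : _ - _ = (I (n%:R * d + d) x - I (n%:R * d) x - d *: S (n%:R * d) x) +
   (I (n%:R * d) x - d *: \sum_(i < n) S (i%:R * d) x)); last by lin_eq R.
rewrite (le_trans (snormD _ _ _))//.
have nd0 : 0 <= n%:R * d by rewrite mulr_ge0.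
by have := evolution_int_incr nd0 d0; move: ih; lra.
Qed.

End Regular.

(** The Riemann sums converge on the dense set of regular vectors, and both sides
    are Lipschitz in the initial vector. *)
Lemma evolution_time_integral t x : 0 <= t ->
  is_time_integral nm (S ^~ x) t (I t x).
Proof.
move=> t0; apply/scvgP => e e0.
have ep : 0 < e / (4 * (t + 1)) by rewrite divr_gt0 ?mulr_gt0 ?ltr_wpDl.
have [x' [x1 [x2 [dx xx]]]] := dom2_dense mA om0 cH x ep.
have cp : 0 < e / 2 / (t ^+ 2 * nm x1 + 1).
  by rewrite !divr_gt0// ltr_wpDl// mulr_ge0 ?snorm_ge0 ?sqr_ge0.
have := @cvg_harmonic R => /cvgrPdist_le/(_ _ cp)[N _ NP].
exists N => n /NP; rewrite sub0r normrN /= ger0_norm ?invr_ge0// => nP.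
set d := t / n.+1%:R.
have d0 : 0 <= d by rewrite divr_ge0.
have nd : n.+1%:R * d = t by rewrite /d mulrC divfK ?pnatr_eq0.
have h1 := evolution_riemann dx n.+1 d0; rewrite nd in h1.
pose Q y := d *: \sum_(i < n.+1) S (i%:R * d) y.
have h2 : nm (Q x - Q x') <= t * nm (x - x').
  rewrite /Q -scalerBr -sumrB snormZ (ger0_norm d0).
  apply: le_trans (_ : d * (n.+1%:R * nm (x - x')) <= _).
    rewrite ler_wpM2l//; apply: le_trans (snorm_sum _ _ _) _.
    rewrite -[X in X%:R * _]card_ord -sum1_card natr_sum mulr_suml.
    by apply: ler_sum => i _; rewrite mul1r evolution_lip// mulr_ge0.
  by rewrite mulrA [d * _]mulrC nd.
have h3 := evolution_int_lip x x' t0.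
rewrite -/(Q x) (_ : Q x - I t x = (Q x - Q x') - (I t x' - Q x') - (I t x - I t x'));
  last by lin_eq R.
rewrite (le_trans (snormD _ _ _))// snormN.
have := snormD ip (Q x - Q x') (- (I t x' - Q x')); rewrite snormN.
have h4 : t * nm (x - x') <= e / 4.
  apply: le_trans (_ : (t + 1) * (e / (4 * (t + 1))) <= _).
    by rewrite ler_pM ?snorm_ge0// lerDl.
  by rewrite le_eqVlt; apply/orP; left; apply/eqP; field; rewrite gt_eqF// ltr_wpDl.
have h5 : n.+1%:R * d ^+ 2 * nm x1 <= e / 2.
  rewrite (_ : _ * nm x1 = t ^+ 2 * nm x1 * n.+1%:R^-1); last first.
    have : n.+1%:R != 0 :> R by rewrite pnatr_eq0.
    by rewrite /d; set q := n.+1%:R => q0; field.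
  apply: le_trans (_ : (t ^+ 2 * nm x1 + 1) * (e / 2 / (t ^+ 2 * nm x1 + 1)) <= _).
    by rewrite ler_pM ?mulr_ge0 ?snorm_ge0 ?sqr_ge0 ?invr_ge0// lerDl.
  rewrite mulrCA mulfV ?mulr1// gt_eqF// ltr_wpDl// mulr_ge0 ?snorm_ge0 ?sqr_ge0//.
by move: h1 h2 h3 h4 h5; rewrite /Q; lra.
Qed.

Lemma evolution_continuous x : time_continuous nm (S ^~ x).
Proof.
move=> t t0; apply/cvgrPdist_le => e e0.
have e30 : 0 < e / 3 by rewrite divr_gt0.
have [x' [x1 [x2 [dx xx]]]] := dom2_dense mA om0 cH x e30.
have dp : 0 < e / 3 / (nm x1 + 1) by rewrite !divr_gt0// ltr_wpDl// snorm_ge0.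
apply/nbhs_ballP; exists (e / 3 / (nm x1 + 1)) => //= s st s0.
rewrite sub0r normrN ger0_norm ?snorm_ge0//.
rewrite (_ : _ - _ = (S s x - S s x') + (S s x' - S t x') - (S t x - S t x'));
  last by lin_eq R.
rewrite (le_trans (snormD _ _ _))// snormN.
have := snormD ip (S s x - S s x') (S s x' - S t x').
have : nm (S s x' - S t x') <= `|t - s| * nm x1.
  have [st'|/ltW ts] := leP s t.
    by rewrite snorm_sym ger0_norm ?subr_ge0//; exact: (evolution_lip_time dx s0 st').
  by rewrite distrC ger0_norm ?subr_ge0//; exact: (evolution_lip_time dx t0 ts).
have : `|t - s| * nm x1 <= e / 3.
  apply: le_trans (_ : (e / 3 / (nm x1 + 1)) * (nm x1 + 1) <= _).
    by rewrite ler_pM ?snorm_ge0 ?(ltW st)// lerDl.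
  rewrite divfK// gt_eqF// ltr_wpDl ?snorm_ge0//.
have := evolution_lip x x' s0; have := evolution_lip x x' t0.
by move: xx; lra.
Qed.

(** The exact relation [euler_int_graph] passes to the limit because the graph is
    closed. *)
Theorem evolution_mild x :
  mild_solution (fun=> True) nm A x (S ^~ x).
Proof.
split => //; [exact: evolution0|exact: evolution_continuous|move=> t t0].
have [Z [W [AZ IZ SW]]] := graph_closed mA om0 (fun k => euler_int_graph mA k t x)
  (evolution_intP x t0) (scvg_sub (evolutionP x t0) (scvg_cst ip x)).
exists Z, W; split => //.
  by apply: (scvg_eqv _ IZ); exact: evolution_time_integral.
have -> : S t x - (S 0 x + W) = (S t x - x - W) - (S 0 x - x) by lin_eq R.
apply/eqP; rewrite eq_le snorm_ge0 andbT (le_trans (snormD _ _ _))//.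
by rewrite snormN SW evolution0 addr0.
Qed.

End Evolution.

(** * Differentiation of time integrals *)

Section RealCalculus.
Variable R : realType.
Implicit Types (f F : R -> R).

Lemma is_derive_eps f x (l : R) :
  (forall e, 0 < e -> exists2 d, 0 < d &
     forall s, `|s - x| < d -> `|f s - f x - (s - x) * l| <= e * `|s - x|) ->
  is_derive x 1 f l.
Proof.
move=> h; have cv : h0^-1 *: (f (h0 *: (1 : R) + x) - f x) @[h0 --> 0^'] --> l.
  apply/cvgrPdist_le => e /h[d d0 dP].
  apply/nbhs_ballP; exists d => //= y; rewrite /ball/= sub0r normrN => yd y0.
  rewrite /GRing.scale/= mulr1; have := dP (y + x); rewrite addrK => /(_ yd) h1.
  have yp : 0 < `|y| by rewrite normr_gt0.
  rewrite -(ler_pM2r yp) (le_trans _ h1)// -normrM -normrN.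
  have -> : - ((l - y^-1 * (f (y + x) - f x)) * y) = f (y + x) - f x - y * l.
    by field.
  by [].
apply: DeriveDef; first by apply/cvg_ex; exists l.
by apply/cvg_lim.
Qed.

(** The antiderivative starts at -1, so that it is differentiable on both sides
    of the initial time 0. *)
Lemma antiderivative f : continuous f ->
  exists F, forall x : R, -1 < x -> is_derive x 1 F (f x).
Proof.
move=> cf; exists (fun x => \int[lebesgue_measure]_(t in `[(-1 : R), x]) f t).
move=> x x1.
have xx : x < x + 1 by rewrite ltrDl.
have fi : (@lebesgue_measure R).-integrable `[-1, x + 1] (EFin \o f).
  apply: continuous_compact_integrable; first exact: segment_compact.
  by apply: continuous_subspaceT.
have [d1 d2] := continuous_FTC1_closed xx fi x1 (cf x).
by apply: DeriveDef; [exact: d1|rewrite -derive1E].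
Qed.

Lemma increment_bound f F a b c e : -1 < a -> a <= b ->
  (forall x : R, -1 < x -> is_derive x 1 F (f x)) ->
  (forall s, a <= s -> s <= b -> `|f s - c| <= e) ->
  `|F b - F a - (b - a) * c| <= (b - a) * e.
Proof.
move=> a1 ab dF fc; have [] := @MVT_segment R F f a b ab.
- by move=> x /[!in_itv]/= /andP[ax _]; apply: dF; exact: lt_trans ax.
- apply: derivable_within_continuous => x /[!in_itv]/= /andP[ax _].
  exact/ex_derive/dF/(lt_le_trans a1).
move=> x /[!in_itv]/= /andP[ax xb] ->.
rewrite mulrC -mulrBr normrM ger0_norm ?subr_ge0//.
by rewrite ler_wpM2l ?subr_ge0// fc.
Qed.

Lemma uniform_continuity f (t : R) : continuous f -> forall e, 0 < e ->
  exists2 d, 0 < d & forall x y, 0 <= x <= t -> 0 <= y <= t ->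
    `|x - y| < d -> `|f x - f y| <= e.
Proof.
move=> cf e e0; have e20 : 0 < e / 2 by rewrite divr_gt0.
have := @segment_compact R 0 t; rewrite compact_near_coveringP.
move/(_ R (0^'+) (fun d x => forall y, `|x - y| < d -> `|f x - f y| <= e)).
case=> [x _|d /= d0 dP].
  have /cvgrPdist_le/(_ _ e20)/nbhs_ballP[r /= r0 rP] := cf x.
  exists (ball x (r / 2), [set d | d < r / 2]); rewrite /=.
    split; first exact/nbhsx_ballx/divr_gt0.
    by apply: nbhs_right_lt; rewrite divr_gt0.
  move=> [z d] [/= xz dr] y zy.
  have h1 : ball x r z by apply: lt_trans xz _; rewrite ltr_pdivrMr//; lra.
  have h2 : ball x r y.
    rewrite /ball/= -[x - y](subrKA z) (le_lt_trans (ler_normD _ _))//.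
    by move: xz zy dr; rewrite /ball/=; lra.
  have := rP _ h1; have := rP _ h2.
  rewrite -[f z - f y](subrKA (f x)) => k1 k2.
  by rewrite (le_trans (ler_normD _ _))// [X in X + _]distrC; lra.
exists (d / 2); first by rewrite divr_gt0.
move=> x y xt yt xy; have := dP (d / 2); apply => //=.
- by rewrite sub0r normrN ger0_norm ?ltr_pdivrMr ?divr_ge0 ?ltW//; lra.
- by rewrite divr_gt0.
Qed.

Lemma riemann_sum_cvg f F t : continuous f -> 0 <= t ->
  (forall x : R, -1 < x -> is_derive x 1 F (f x)) ->
  t / n.+1%:R * (\sum_(i < n.+1) f (i%:R * (t / n.+1%:R))) @[n --> \oo] -->
  F t - F 0.
Proof.
move=> cf t0 dF; apply/cvgrPdist_le => e e0.
have ep : 0 < e / (t + 1) by rewrite divr_gt0// ltr_wpDl.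
have [d d0 dP] := uniform_continuity t cf ep.
have dp : 0 < d / (t + 1) by rewrite divr_gt0// ltr_wpDl.
have := @cvg_harmonic R => /cvgrPdist_lt/(_ _ dp)[N _ NP].
exists N => // n /NP; rewrite sub0r normrN /= ger0_norm ?invr_ge0// => nP.
set r := t / n.+1%:R.
have r0 : 0 <= r by rewrite divr_ge0.
have nr : n.+1%:R * r = t by rewrite /r mulrC divfK ?pnatr_eq0.
have rd : r < d.
  apply: le_lt_trans (_ : (t + 1) * n.+1%:R^-1 < _).
    by rewrite /r ler_wpM2r ?invr_ge0// lerDl.
  by rewrite mulrC -ltr_pdivlMr// ltr_wpDl.
have key j : (j <= n.+1)%N -> `|F (j%:R * r) - F 0 - r * \sum_(i < j) f (i%:R * r)|
    <= j%:R * (r * (e / (t + 1))).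
  elim: j => [|j ih] jn; first by rewrite big_ord0 !mul0r subrr mulr0 subr0 normr0.
  rewrite big_ord_recr/= -[X in _ <= X * _]natr1.
  have jr0 : 0 <= j%:R * r by rewrite mulr_ge0.
  have jE : j.+1%:R * r = j%:R * r + r by rewrite -natr1 mulrDl mul1r.
  have jt : j%:R * r + r <= t by rewrite -jE -nr ler_wpM2r// ler_nat.
  have := @increment_bound f F (j%:R * r) (j%:R * r + r) (f (j%:R * r)) (e / (t + 1)).
  rewrite jE (_ : j%:R * r + r - j%:R * r = r); last by ring.
  have jm1 : -1 < j%:R * r by rewrite (lt_le_trans _ jr0)// ltrN10.
  have hb s : j%:R * r <= s -> s <= j%:R * r + r ->
      `|f s - f (j%:R * r)| <= e / (t + 1).
    by move=> s1 s2; apply: dP; [lra|lra|rewrite ger0_norm; lra].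
  rewrite lerDl => /(_ jm1 r0 dF hb) h.
  have := ih (ltnW jn) => {}ih.
  rewrite (_ : _ - _ - _ = (F (j%:R * r) - F 0 - r * \sum_(i < j) f (i%:R * r)) +
    (F (j%:R * r + r) - F (j%:R * r) - r * f (j%:R * r))); last by ring.
  by rewrite (le_trans (ler_normD _ _))// mulrDl mul1r lerD.
have := key _ (leqnn _); rewrite nr => /le_trans; apply.
rewrite mulrA nr mulrA ler_pdivrMr ?ltr_wpDl//.
by rewrite mulrC ler_pM2l// lerDl.
Qed.

End RealCalculus.

Section TimeIntegral.
Variables (R : realType) (H : lmodType R) (ip : semi_inner H).
Local Notation nm := (snorm ip).
Variable Y : R -> H.
Hypothesis cY : time_continuous nm Y.

(** Orbits live on nonnegative times; composing with the absolute value gives a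
    function that is continuous on the whole line. *)
Lemma sip_continuous v : continuous (fun s : R => ip (Y `|s|) v : R).
Proof.
move=> t; apply/(@cvgrPdist_le _ R^o) => e e0.
have vp : 0 < nm v + 1 by rewrite ltr_wpDl// snorm_ge0.
have ep : 0 < e / (nm v + 1) by rewrite divr_gt0.
have /(@cvgrPdist_le _ R^o)/(_ _ ep) := cY (normr_ge0 t).
move=> /nbhs_ballP[d /= d0 dP].
apply/nbhs_ballP; exists d => //= s; rewrite /ball/= => ts.
have := dP `|s|; rewrite /ball/= => /(_ (le_lt_trans (ler_dist_dist _ _) ts) (normr_ge0 s)).
rewrite sub0r normrN ger0_norm ?snorm_ge0// => h.
rewrite distrC -sipBl (le_trans (snorm_abs_cs _ _ _))//.
apply: le_trans (_ : e / (nm v + 1) * (nm v + 1) <= _); last by rewrite divfK// gt_eqF.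
by rewrite ler_pM ?snorm_ge0// lerDl.
Qed.

(** Riemann sums in [H] become scalar Riemann sums after taking the product with
    a fixed vector. *)
Lemma time_integral_sip v F t Z : 0 <= t ->
  (forall x : R, -1 < x -> is_derive x 1 F (ip (Y `|x|) v)) ->
  is_time_integral nm Y t Z -> ip Z v = F t - F 0.
Proof.
move=> t0 dF ZI; have := riemann_sum_cvg (@sip_continuous v) t0 dF.
move=> h1; have h2 : t / n.+1%:R * (\sum_(i < n.+1) ip (Y `|i%:R * (t / n.+1%:R)|) v)
     @[n --> \oo] --> ip Z v.
  apply/cvgrPdist_le => e e0.
  have vp : 0 < nm v + 1 by rewrite ltr_wpDl// snorm_ge0.
  have ep : 0 < e / (nm v + 1) by rewrite divr_gt0.
  have /cvgrPdist_le/(_ _ ep)[N _ NP] := ZI; exists N => // n /NP.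
  rewrite sub0r normrN ger0_norm ?snorm_ge0// => h.
  rewrite distrC (_ : _ - _ = ip (t / n.+1%:R *: (\sum_(i < n.+1) Y (i%:R * (t / n.+1%:R))) - Z) v).
    rewrite (le_trans (snorm_abs_cs _ _ _))//.
    apply: le_trans (_ : e / (nm v + 1) * (nm v + 1) <= _); last by rewrite divfK// gt_eqF.
    by rewrite ler_pM ?snorm_ge0// lerDl.
  rewrite sipBl sipZl; congr (_ * _ - _).
  have sipsum (m : nat) (G : nat -> H) : ip (\sum_(i < m) G i) v = \sum_(i < m) ip (G i) v.
    by elim: m => [|m ih]; rewrite ?big_ord0 ?sip0l// !big_ord_recr/= sipDl ih.
  rewrite (sipsum _ (fun i => Y (i%:R * (t / n.+1%:R)))); apply: eq_bigr => i _.
  by rewrite ger0_norm// mulr_ge0// divr_ge0.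
exact: (cvg_unique _ h2 h1).
Qed.

(** Tested against a fixed vector, the time integral is an integral of a scalar
    function; testing the increment against itself then gives a norm bound. *)
Lemma time_integral_incr a b Za Zb y e : 0 <= a -> a <= b ->
  is_time_integral nm Y a Za -> is_time_integral nm Y b Zb ->
  (forall s, a <= s -> s <= b -> nm (Y s - y) <= e) ->
  nm (Zb - Za - (b - a) *: y) <= (b - a) * e.
Proof.
move=> a0 ab Ia Ib ye; set v := _ - _ *: _.
have b0 := le_trans a0 ab.
have [F dF] := antiderivative (@sip_continuous v).
have e0 : 0 <= e by rewrite (le_trans (snorm_ge0 ip _) (ye a _ _)).
have a1 : -1 < a by rewrite (lt_le_trans _ a0)// ltrN10.
have := increment_bound a1 ab dF (_ : forall s, a <= s -> s <= b ->
   `|ip (Y `|s|) v - ip y v| <= e * nm v).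
move=> h; have {}h : ip v v <= (b - a) * (e * nm v).
  apply: le_trans (h _); last first.
    move=> s sa sb; rewrite (ger0_norm (le_trans a0 sa)) -sipBl.
    by rewrite (le_trans (snorm_abs_cs _ _ _))// ler_wpM2r ?snorm_ge0// ye.
  apply: le_trans (ler_norm _); rewrite {1}/v 2!sipBl sipZl.
  rewrite (time_integral_sip b0 dF Ib) (time_integral_sip a0 dF Ia).
  by rewrite opprB addrA subrK.
have [->|v0] := eqVneq (nm v) 0; first by rewrite mulr_ge0// subr_ge0.
have vp : 0 < nm v by rewrite lt0r v0 snorm_ge0.
by rewrite -(ler_pM2r vp) -expr2 snorm_sqr -mulrA.
Qed.

Lemma time_integral_deriv (Z : R -> H) t :
  (forall s, 0 <= s -> is_time_integral nm Y s (Z s)) -> 0 <= t ->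
  forall e, 0 < e -> exists2 d, 0 < d & forall s, 0 <= s -> `|s - t| < d ->
    nm (Z s - Z t - (s - t) *: Y t) <= e * `|s - t|.
Proof.
move=> IZ t0 e e0; have /cvgrPdist_le/(_ _ e0)/nbhs_ballP[d /= d0 dP] := cY t0.
exists d => // s s0 st.
have key r : 0 <= r -> `|r - t| < d -> nm (Y r - Y t) <= e.
  move=> r0 rt; have := dP r; rewrite /ball/= distrC => /(_ rt r0).
  by rewrite sub0r normrN ger0_norm ?snorm_ge0.
have [ts|/ltW ts] := leP t s.
  rewrite [`|s - t|]ger0_norm ?subr_ge0// mulrC.
  apply: time_integral_incr => //; try exact: IZ.
  move=> r r1 r2; apply: key; first exact: le_trans r1.
  by move: st; rewrite !ger0_norm ?subr_ge0//; lra.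
rewrite distrC [`|t - s|]ger0_norm ?subr_ge0// mulrC -snormN.
rewrite (_ : - _ = Z t - Z s - (t - s) *: Y t); last by lin_eq R.
apply: time_integral_incr => //; try exact: IZ.
move=> r r1 r2; apply: key; first exact: le_trans r1.
by move: st; rewrite distrC (distrC r) !ger0_norm ?subr_ge0//; lra.
Qed.

End TimeIntegral.

Lemma cvg0_le (R : realType) (T : Type) (F : set_system T) {FF : Filter F}
    (f h : T -> R) : (\forall x \near F, 0 <= f x <= h x) ->
  h x @[x --> F] --> (0 : R) -> f x @[x --> F] --> (0 : R).
Proof. by move=> fh h0; exact: (squeeze_cvgr fh (cvg_cst _) h0). Qed.

(** * Uniqueness and transport of mild solutions *)

Section Uniqueness.
Variables (R : realType) (H : lmodType R) (ip : semi_inner H) (om : R).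
Variable A : H -> H -> Prop.
Local Notation nm := (snorm ip).
Hypothesis dA : dissipative ip om A.
Hypothesis om0 : 0 <= om.

Lemma mild_primitive X Y0 (Y : R -> H) : mild_solution X nm A Y0 Y ->
  exists Z W : R -> H, forall t, 0 <= t ->
    [/\ is_time_integral nm Y t (Z t), A (Z t) (W t) & nm (Y t - (Y 0 + W t)) = 0].
Proof.
move=> [_ _ _ mY].
have h (t : R) : exists ZW : H * H, 0 <= t ->
  [/\ is_time_integral nm Y t ZW.1, A ZW.1 ZW.2 & nm (Y t - (Y 0 + ZW.2)) = 0].
  have [t0|t0] := leP 0 t; last by exists (0, 0).
  by have [Z [W ZW]] := mY _ t0; exists (Z, W).
have [ZW P] := choice h.
by exists (fun t => (ZW t).1), (fun t => (ZW t).2).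
Qed.

(** The integral of a continuous function is differentiable, hence so is its
    squared norm. *)
Lemma sqr_snorm_deriv (Y Z : R -> H) t : time_continuous nm Y ->
  (forall s, 0 <= s -> is_time_integral nm Y s (Z s)) -> 0 <= t ->
  forall e, 0 < e -> exists2 d, 0 < d & forall s, 0 <= s -> `|s - t| < d ->
    `|ip (Z s) (Z s) - ip (Z t) (Z t) - (s - t) * (2 * ip (Z t) (Y t))|
      <= e * `|s - t|.
Proof.
move=> cY IZ t0 e e0.
pose e1 := Num.min 1 (e / (4 * nm (Z t) + 4)).
have z4 : 0 < 4 * nm (Z t) + 4 by rewrite ltr_wpDl// mulr_ge0 ?snorm_ge0.
have e1p : 0 < e1 by rewrite lt_min ltr01 divr_gt0.
have [d d0 dP] := time_integral_deriv cY IZ t0 e1p.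
pose q := (1 + nm (Y t)) ^+ 2.
have q1 : 0 < 1 + nm (Y t) by rewrite ltr_pwDl// snorm_ge0.
have q0 : 0 < q by rewrite exprn_gt0.
exists (Num.min d (e / (2 * q))); first by rewrite lt_min d0 divr_gt0// mulr_gt0.
move=> s s0; rewrite lt_min => /andP[sd se].
have := dP _ s0 sd; set D := Z s - Z t; set r := s - t in sd se * => h.
have r0 := normr_ge0 r.
have -> : ip (Z s) (Z s) - ip (Z t) (Z t) - r * (2 * ip (Z t) (Y t)) =
    2 * ip (Z t) (D - r *: Y t) + ip D D.
  by rewrite /D !sipE (sipC ip (Z s) (Z t)); ring.
rewrite (le_trans (ler_normD _ _))// normrM [`|2|]ger0_norm// (ger0_norm (sip_ge0 ip D)).
have h1 : `|ip (Z t) (D - r *: Y t)| <= nm (Z t) * (e1 * `|r|).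
  by rewrite (le_trans (snorm_abs_cs _ _ _))// ler_wpM2l// snorm_ge0.
have h2 : nm (Z t) * (e1 * `|r|) <= e / 4 * `|r|.
  rewrite mulrA ler_wpM2r//.
  apply: le_trans (_ : (nm (Z t) + 1) * (e / (4 * nm (Z t) + 4)) <= _).
    by rewrite ler_pM ?snorm_ge0 ?(ltW e1p)// ?lerDl// ge_min lexx orbT.
  by rewrite le_eqVlt; apply/orP; left; apply/eqP; field; rewrite gt_eqF// ltr_wpDl ?snorm_ge0.
have h3 : nm D <= `|r| * (1 + nm (Y t)).
  have := snormD ip (D - r *: Y t) (r *: Y t); rewrite subrK snormZ => h4.
  have : e1 * `|r| <= 1 * `|r| by rewrite ler_wpM2r// ge_min lexx.
  by move: h h4; lra.
have h5 : ip D D <= e / 2 * `|r|.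
  rewrite -snorm_sqr; apply: le_trans (_ : (`|r| * (1 + nm (Y t))) ^+ 2 <= _).
    by apply: lerXn2r; rewrite ?nnegrE ?snorm_ge0 ?mulr_ge0// ltW.
  have h6 : `|r| * q <= e / 2.
    by move/ltW: se; rewrite ler_pdivlMr ?mulr_gt0//; lra.
  by rewrite exprMn -/q expr2 -mulrA [e / 2 * _]mulrC ler_wpM2l.
by move: h1 h2 h5; lra.
Qed.

(** For a solution that starts from 0, the time integral Z satisfies Z' = AZ, so
    its squared norm does not increase and Z vanishes; Y is the derivative of Z. *)
Lemma mild_zero X Y0 (Y : R -> H) : mild_solution X nm A Y0 Y -> nm (Y 0) = 0 ->
  forall t, 0 <= t -> nm (Y t) = 0.
Proof.
move=> mY Y00; have [Z [W ZW]] := mild_primitive mY; case: mY => _ _ cY _.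
have IZ s : 0 <= s -> is_time_integral nm Y s (Z s) by move=> /ZW[].
have dg t := sqr_snorm_deriv cY IZ (t := t).
pose g := fun s : R => ip (Z `|s|) (Z `|s|).
have Z0 : nm (Z 0) = 0.
  apply: scvg_small => e e0.
  have /scvgP/(_ _ e0)[N NP] := IZ _ (lexx 0).
  by have := NP _ (leqnn N); rewrite mul0r scale0r sub0r snormN.
have cg : continuous g.
  move=> x; apply/cvgrPdist_le => e e0.
  have [d d0 dP] := dg _ (normr_ge0 x) _ ltr01.
  set l := 2 * ip (Z `|x|) (Y `|x|) in dP.
  have l0 : 0 < 1 + `|l| by rewrite ltr_pwDl.
  apply/nbhs_ballP; exists (Num.min d (e / (1 + `|l|))) => /=.
    by rewrite lt_min d0 divr_gt0.
  move=> s; rewrite /ball/= lt_min => /andP[sd se].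
  have sx : `| `|s| - `|x| | <= `|x - s| by rewrite distrC ler_dist_dist.
  have := dP `|s| (normr_ge0 s) (le_lt_trans sx sd).
  rewrite -/(g s) -/(g x) mul1r => h.
  have := ler_normD (g s - g x - (`|s| - `|x|) * l) ((`|s| - `|x|) * l).
  rewrite subrK normrM distrC => h2.
  have h3 : `| `|s| - `|x| | * (1 + `|l|) <= `|x - s| * (1 + `|l|).
    by rewrite ler_wpM2r// ltW.
  by move: se; rewrite ltr_pdivlMr// => /ltW; move: h h2 h3; lra.
have dg' (x : R) : 0 < x -> is_derive x 1 g (2 * ip (Z x) (Y x)).
  move=> x0; apply: is_derive_eps => e e0.
  have [d d0 dP] := dg _ (ltW x0) _ e0.
  exists (Num.min d x); first by rewrite lt_min d0.
  move=> s; rewrite lt_min => /andP[sd sx].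
  have s0 : 0 <= s by move: sx; rewrite ltr_norml; lra.
  by rewrite /g (ger0_norm s0) (ger0_norm (ltW x0)); exact: dP.
have Zs t : 0 <= t -> nm (Z t) = 0.
  move=> t0; apply/snorm_eq0/eqP; rewrite eq_le sip_ge0 andbT.
  have g0 : g 0 = 0 by rewrite /g normr0; apply/snorm_eq0.
  have gt : g t = ip (Z t) (Z t) by rewrite /g (ger0_norm t0).
  rewrite -gt -g0; apply: (@ler0_derive1_le_cc R g 0 t) => //.
  - by move=> x /[!in_itv]/= /andP[x0 _]; apply/ex_derive/(dg' _ x0).
  - move=> x /[!in_itv]/= /andP[x0 _]; rewrite derive1E.
    have Dx := dg' _ x0; rewrite (derive_val (is_derive := Dx)).
    have [_ AZ YW] := ZW _ (ltW x0).
    have -> : ip (Z x) (Y x) = ip (Z x) (W x).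
      apply/eqP; rewrite -subr_eq0 -sipBr -normr_eq0 eq_le normr_ge0 andbT.
      rewrite (le_trans (snorm_abs_cs _ _ _))//.
      rewrite (_ : nm (Y x - W x) = 0) ?mulr0//.
      rewrite -[RHS]YW; apply: snorm_eqvr.
      by rewrite (_ : _ - _ = - Y 0) ?snormN//; lin_eq R.
    have := dis_le dA AZ; have := mulr_ge0 om0 (sip_ge0 ip (Z x)); lra.
  - exact: continuous_subspaceT.
  - by rewrite in_itv/= lexx t0.
  - by rewrite in_itv/= lexx t0.
move=> t t0; apply: scvg_small => e e0.
have [d d0 dP] := time_integral_deriv cY IZ t0 e0.
have d20 : 0 < d / 2 by rewrite divr_gt0.
have td : 0 <= t + d / 2 by rewrite addr_ge0// ltW.
have := dP _ td; rewrite addrAC subrr add0r ger0_norm ?(ltW d20)//.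
have -> : d / 2 < d by rewrite ltr_pdivrMr//; lra.
move=> /(_ isT) h.
have := snorm_tri ip (Z (t + d / 2) - Z t) 0 (d / 2 *: Y t).
rewrite !sub0r !snormN snormZ (ger0_norm (ltW d20)).
have := snormD ip (Z (t + d / 2)) (- Z t); rewrite snormN (Zs _ t0) (Zs _ td).
move=> h1 h2; rewrite -(ler_pM2l d20); move: h h1 h2; lra.
Qed.

Lemma time_integral_sub (Y Y' : R -> H) t Z Z' : is_time_integral nm Y t Z ->
  is_time_integral nm Y' t Z' ->
  is_time_integral nm (fun s => Y s - Y' s) t (Z - Z').
Proof.
move=> IZ IZ'; have := scvg_sub IZ IZ'; congr (scvg _ _ _).
by apply/funext => n; rewrite -scalerBr -sumrB.
Qed.

Lemma time_continuous_sub (Y Y' : R -> H) : time_continuous nm Y ->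
  time_continuous nm Y' -> time_continuous nm (fun s => Y s - Y' s).
Proof.
move=> cY cY' t t0; have h : (nm (Y s - Y t) + nm (Y' s - Y' t))
    @[s --> within [set s | 0 <= s] (nbhs t)] --> (0 : R).
  by rewrite -[X in _ --> X](addr0 0); exact: (cvgD (cY t t0) (cY' t t0)).
apply: (cvg0_le _ h).
apply: nearW => s; rewrite snorm_ge0/=.
rewrite (_ : _ - _ - _ = (Y s - Y t) - (Y' s - Y' t)); last by lin_eq R.
by rewrite (le_trans (snormD _ _ _))// snormN.
Qed.

Theorem mild_unique X Y0 Y1 (Y Y' : R -> H) : mild_solution X nm A Y0 Y ->
  mild_solution X nm A Y1 Y' -> nm (Y0 - Y1) = 0 ->
  forall t, 0 <= t -> nm (Y t - Y' t) = 0.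
Proof.
move=> mY mY' Y01.
have Y00 : nm (Y 0 - Y' 0) = 0.
  case: mY mY' => _ h _ _ [_ h' _ _].
  by rewrite (snorm_eqvl _ h) (snorm_eqvr _ h').
suff : mild_solution (fun=> True) nm A (Y 0 - Y' 0) (fun t => Y t - Y' t).
  by move/mild_zero; apply.
case: mY mY' => _ _ cY mY [_ _ cY' mY']; split => //.
- by rewrite subrr snorm0.
- exact: time_continuous_sub.
move=> t t0; have [Z [W [IZ AZ ZW]]] := mY _ t0; have [Z' [W' [IZ' AZ' ZW']]] := mY' _ t0.
exists (Z - Z'), (W - W'); split.
- exact: time_integral_sub.
- exact: (dis_sub dA).
rewrite (_ : _ - _ = (Y t - (Y 0 + W)) - (Y' t - (Y' 0 + W'))); last by lin_eq R.
by apply/eqP; rewrite eq_le snorm_ge0 andbT (le_trans (snormD _ _ _))// snormN ZW ZW' addr0.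
Qed.

End Uniqueness.

(** Transport of mild solutions by a map that is linear and bounded on the
    state space and intertwines the operators. *)
Section Transport.
Variables (R : realType) (V V' : lmodType R).
Variables (X : V -> Prop) (N : V -> R) (A : V -> V -> Prop).
Variables (X' : V' -> Prop) (N' : V' -> R) (A' : V' -> V' -> Prop).
Variables (L : V -> V') (C : R).
Hypothesis X0 : X 0.
Hypothesis Xlin : forall k x y, X x -> X y -> X (k *: x + y).
Hypothesis Llin : forall k x y, X x -> X y -> L (k *: x + y) = k *: L x + L y.
Hypothesis LX : forall x, X x -> X' (L x).
Hypothesis LN : forall x, X x -> N' (L x) <= C * N x.
Hypothesis N'0 : forall x, 0 <= N' x.
Hypothesis AX : forall x w, A x w -> [/\ X x, X w & A' (L x) (L w)].

Let L0 : L 0 = 0.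
Proof.
have := Llin 1 X0 X0; rewrite !scale1r addr0 => /eqP.
by rewrite -subr_eq0 opprD addrA subrr sub0r oppr_eq0 => /eqP.
Qed.
Let XD x y : X x -> X y -> X (x + y).
Proof. by move=> xX yX; rewrite -[x]scale1r; exact: Xlin. Qed.
Let XZ k x : X x -> X (k *: x).
Proof. by move=> xX; rewrite -[_ *: _]addr0; exact: Xlin. Qed.
Let XB x y : X x -> X y -> X (x - y).
Proof. by move=> xX yX; rewrite addrC -scaleN1r; exact: Xlin. Qed.
Let LD x y : X x -> X y -> L (x + y) = L x + L y.
Proof. by move=> xX yX; rewrite -[x in LHS]scale1r Llin// scale1r. Qed.
Let LZ k x : X x -> L (k *: x) = k *: L x.
Proof. by move=> xX; rewrite -[k *: x]addr0 Llin// L0 !addr0. Qed.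
Let LB x y : X x -> X y -> L (x - y) = L x - L y.
Proof. by move=> xX yX; rewrite addrC -scaleN1r Llin// scaleN1r addrC. Qed.

Lemma transport_time_integral (Y : R -> V) t Z : (forall s, 0 <= s -> X (Y s)) ->
  0 <= t -> X Z -> is_time_integral N Y t Z ->
  is_time_integral N' (fun s => L (Y s)) t (L Z).
Proof.
move=> XY t0 XZ' IZ; have h : (C * N (t / n.+1%:R *: (\sum_(i < n.+1) Y (i%:R * (t / n.+1%:R))) - Z))
    @[n --> \oo] --> (0 : R).
  by rewrite -[X in _ --> X](mulr0 C); exact: (cvgM (cvg_cst C) IZ).
apply: (cvg0_le _ h).
apply: nearW => n; rewrite N'0/=.
have key m : X (\sum_(i < m) Y (i%:R * (t / n.+1%:R))) /\
  L (\sum_(i < m) Y (i%:R * (t / n.+1%:R))) = \sum_(i < m) L (Y (i%:R * (t / n.+1%:R))).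
  elim: m => [|m [Xm Lm]]; first by rewrite !big_ord0 L0.
  rewrite !big_ord_recr/=; have Xn : X (Y (m%:R * (t / n.+1%:R))).
    by apply: XY; rewrite mulr_ge0// divr_ge0.
  by split; [exact: XD|rewrite LD// Lm].
have [Xn Ln] := key n.+1.
have XZn := XZ (t / n.+1%:R) Xn.
by rewrite -Ln -LZ// -LB//; apply: LN; apply: XB.
Qed.

Lemma transport_time_continuous (Y : R -> V) : (forall s, 0 <= s -> X (Y s)) ->
  time_continuous N Y -> time_continuous N' (fun s => L (Y s)).
Proof.
move=> XY cY t t0; have h : (C * N (Y s - Y t)) @[s --> within [set s | 0 <= s] (nbhs t)] --> (0 : R).
  by rewrite -[X in _ --> X](mulr0 C); exact: (cvgM (cvg_cst C) (cY t t0)).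
apply: (cvg0_le _ h).
apply: filterS (withinT _ _) => s s0; rewrite N'0/=.
have Xs := XY _ s0; have Xt := XY _ t0.
by rewrite -LB//; apply: LN; apply: XB.
Qed.

Lemma transport_mild (Y : R -> V) Y0 : X Y0 -> mild_solution X N A Y0 Y ->
  mild_solution X' N' A' (L Y0) (fun s => L (Y s)).
Proof.
move=> XY0 [XY Y00 cY mY].
have null x : X x -> N x = 0 -> N' (L x) = 0.
  by move=> /LN + Nx; rewrite Nx mulr0 => h; apply/eqP; rewrite eq_le N'0 h.
split.
- by move=> t /XY/LX.
- by have XY_0 := XY _ (lexx 0); rewrite -LB//; apply: null => //; apply: XB.
- exact: transport_time_continuous.
move=> t t0; have [Z [W [IZ AZ ZW]]] := mY _ t0; have [XZ0 XW AZ'] := AX AZ.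
exists (L Z), (L W); split => //; first exact: transport_time_integral.
have XY_0 := XY _ (lexx 0).
have XYt := XY _ t0; have XYW := XD XY_0 XW.
by rewrite -LD// -LB//; apply: null => //; apply: XB.
Qed.

End Transport.

(** * Submodules as types *)

(** The state spaces of the systems are predicates, whereas the evolution is
    built on a module: a submodule is therefore also given as a type. *)
Record submodule (R : realType) (V : lmodType R) := Submodule {
  carrier :> V -> Prop;
  carrier0 : carrier 0;
  carrier_lin : forall (k : R) x y, carrier x -> carrier y -> carrier (k *: x + y) }.

Section SubmoduleType.
Variables (R : realType) (V : lmodType R) (S : submodule V).

Definition submod_pred : {pred V} := fun v => `[< S v >].

Fact submod_pred_closed : submod_closed submod_pred.
Proof.
split; first by apply/asboolP; exact: carrier0.
by move=> k x y /asboolP xS /asboolP yS; apply/asboolP; exact: carrier_lin.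
Qed.

HB.instance Definition _ := GRing.isSubmodClosed.Build R V submod_pred submod_pred_closed.

Record submod_type := SubmodType { sm_val :> V; sm_valP : sm_val \in submod_pred }.

HB.instance Definition _ := [isSub for sm_val].
HB.instance Definition _ := [Choice of submod_type by <:].
HB.instance Definition _ := [SubChoice_isSubLmodule of submod_type by <:].

Lemma submodP (x : submod_type) : S (sm_val x).
Proof. exact/asboolP/(sm_valP x). Qed.

Definition submod_in (v : V) (Sv : S v) : submod_type :=
  SubmodType (introT (asboolP _) Sv).

Definition submod_inj (v : V) : submod_type := insubd 0 v.

Lemma submod_injK v : S v -> sm_val (submod_inj v) = v.
Proof. by move=> Sv; rewrite /submod_inj insubdK//; apply/asboolP. Qed.

Lemma sm_val_lin (k : R) (x y : submod_type) :
  sm_val (k *: x + y) = k *: sm_val x + sm_val y.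
Proof. by []. Qed.

Lemma submod_eq (x y : submod_type) : sm_val x = sm_val y -> x = y.
Proof. exact: val_inj. Qed.

End SubmoduleType.

(** * Square integrable functions on the unit interval *)

Section L2Basics.
Variable R : realType.
Local Notation mu := (@lebesgue_measure R).
Implicit Types (f g h : R -> R) (k : R).

Definition measurable01 f : Prop :=
  measurable_fun (`]0, 1[%classic : set (measurableTypeR R)) f.
Definition int01 f : R := \int[mu]_(x in `]0, 1[) f x.
Definition L1 f : Prop := mu.-integrable `]0, 1[ (EFin \o f).
Definition dot f g : R := int01 (fun x => f x * g x).

Let mD : measurable (`]0, 1[%classic : set (measurableTypeR R)).
Proof. exact: measurable_itv. Qed.
Let muD : (mu `]0%R, 1%R[%classic < +oo)%E.
Proof. by rewrite lebesgue_measure_itv/= lte01 oppr0 adde0 ltry. Qed.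

Lemma eq_int01 f g : (forall x, 0 < x < 1 -> f x = g x) -> int01 f = int01 g.
Proof.
by move=> fg; apply: eq_Rintegral => x; rewrite inE/= in_itv/=; exact: fg.
Qed.

Lemma eq_L1 f g : (forall x, 0 < x < 1 -> f x = g x) -> L1 f -> L1 g.
Proof.
move=> fg; apply: eq_integrable => // x; rewrite inE/= in_itv/= => /fg.
by move=> ->.
Qed.

Lemma L1_measurable f : L1 f -> measurable01 f.
Proof. by move/integrableP => -[/measurable_EFinP]. Qed.

Lemma L1D f g : L1 f -> L1 g -> L1 (fun x => f x + g x).
Proof. by move=> f1 g1; have := integrableD mD f1 g1. Qed.

Lemma L1Z k f : L1 f -> L1 (fun x => k * f x).
Proof. by move=> f1; have := integrableZl mD k f1. Qed.

Lemma L1N f : L1 f -> L1 (fun x => - f x).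
Proof. by move=> /(L1Z (-1)); apply: eq_L1 => x _; rewrite mulN1r. Qed.

Lemma L1B f g : L1 f -> L1 g -> L1 (fun x => f x - g x).
Proof. by move=> f1 /L1N; exact: L1D. Qed.

Lemma L1_le f g : measurable01 f -> L1 g ->
  (forall x, 0 < x < 1 -> `|f x| <= g x) -> L1 f.
Proof.
move=> mf g1 fg; apply: (le_integrable mD _ _ g1).
  exact/measurable_EFinP.
by move=> x; rewrite /= in_itv/= => /fg h; rewrite lee_fin (le_trans h)// ler_norm.
Qed.

Lemma L1_cst k : L1 (fun=> k).
Proof.
apply/integrableP; split; first exact: measurable_cst.
by rewrite /= integral_cst// lte_mul_pinfty// ?lee_fin ?normr_ge0.
Qed.

Lemma L1_bounded f M : measurable01 f ->
  (forall x, 0 < x < 1 -> `|f x| <= M) -> L1 f.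
Proof. by move=> mf; apply: L1_le => //; exact: L1_cst. Qed.

Lemma L1_mul_bounded f g M : L1 f -> measurable01 g ->
  (forall x, 0 < x < 1 -> `|g x| <= M) -> L1 (fun x => g x * f x).
Proof.
move=> f1 mg gM; apply: (@L1_le _ (fun x => M * `|f x|)).
- by apply: measurable_funM => //; exact: L1_measurable.
- by apply: L1Z; exact: integrable_norm.
- by move=> x x01; rewrite normrM ler_wpM2r// gM.
Qed.

Lemma int01D f g : L1 f -> L1 g -> int01 (fun x => f x + g x) = int01 f + int01 g.
Proof. by move=> f1 g1; rewrite /int01 RintegralD. Qed.

Lemma int01Z k f : L1 f -> int01 (fun x => k * f x) = k * int01 f.
Proof. by move=> f1; rewrite /int01 RintegralZl. Qed.

Lemma int01B f g : L1 f -> L1 g -> int01 (fun x => f x - g x) = int01 f - int01 g.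
Proof. by move=> f1 g1; rewrite /int01 RintegralB. Qed.

Lemma int01_cst k : int01 (fun=> k) = k.
Proof.
by rewrite /int01 Rintegral_cst//= lebesgue_measure_itv/= lte01 oppr0 adde0 mulr1.
Qed.

Lemma int01_ge0 f : (forall x, 0 < x < 1 -> 0 <= f x) -> 0 <= int01 f.
Proof. by move=> f0; apply: Rintegral_ge0 => x; rewrite /= in_itv/=; exact: f0. Qed.

Lemma int01_le f g : L1 f -> L1 g -> (forall x, 0 < x < 1 -> f x <= g x) ->
  int01 f <= int01 g.
Proof.
move=> f1 g1 fg; apply: le_Rintegral => // x; rewrite /= in_itv/=; exact: fg.
Qed.

Lemma L2P f : L2 f <-> measurable01 f /\ L1 (fun x => f x ^+ 2).
Proof.
have E : ext0 f = f \_ (`]0, 1[%classic : set (measurableTypeR R)) by [].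
have sq : (fun x => (ext0 f x) ^+ 2) = (fun x => f x ^+ 2) \_ `]0, 1[.
  apply/funext => x; rewrite E !patchE; case: ifP => // _.
  by rewrite /= expr0n.
have mE : measurable_fun setT (ext0 f) <-> measurable01 f.
  by rewrite E -(measurable_restrictT f mD).
have iE : mu.-integrable setT (EFin \o (fun x => (ext0 f x) ^+ 2)) <-> L1 (fun x => f x ^+ 2).
  by rewrite /L1 sq (integrable_mkcond _ mD) restrict_EFin.
split=> [f2|[mf f2]].
  split; last by apply/iE; exact: Lfun2_integrable_sqr.
  by apply/mE; move: f2; rewrite /L2 inE => /andP[/[!inE]].
apply/andP; split; first by rewrite inE; apply/mE.
rewrite inE/= /finite_norm unlock/= poweR_lty//.
move/iE: f2 => /integrableP[_]; apply: le_lt_trans.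
apply: ge0_le_integral => //=.
- apply/measurable_EFinP/(@measurableT_comp _ _ _ _ _ _ (fun x : R => x `^ 2)%R) => //.
  by apply/measurableT_comp => //; apply/mE.
- by do 2 apply/measurableT_comp => //; apply: measurable_funX; apply/mE.
- by move=> x _; rewrite lee_fin powR_mulrn// -normrX ger0_norm// sqr_ge0.
Qed.

Lemma normL2E f : L2 f -> normL2 f = Num.sqrt (dot f f).
Proof.
move=> /L2P[mf f2]; rewrite /normL2 unlock/=.
have -> : (\int[mu]_x (`|ext0 f x| `^ 2)%:E = (dot f f)%:E)%E.
  rewrite /dot /int01 /Rintegral fineK; last first.
    by apply: integrable_fin_num => //; move: f2; apply: eq_L1 => x _; rewrite expr2.
  rewrite [RHS]integral_mkcond; apply: eq_integral => x _.
  rewrite /ext0 !patchE; case: ifP => _ /=.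
    by rewrite powR_mulrn// -normrX ger0_norm ?sqr_ge0// expr2.
  by rewrite normr0 powR0.
by rewrite poweR_EFin/= powR12_sqrt// int01_ge0// => x _; rewrite -expr2 sqr_ge0.
Qed.

Lemma L2_measurable f : L2 f -> measurable01 f.
Proof. by move/L2P => []. Qed.

Lemma L2_mul f g : L2 f -> L2 g -> L1 (fun x => f x * g x).
Proof.
move=> /L2P[mf f2] /L2P[mg g2].
apply: (@L1_le _ (fun x => f x ^+ 2 + g x ^+ 2)) => [||x _].
- exact: measurable_funM.
- exact: L1D.
- by rewrite ler_norml; apply/andP; split; nra.
Qed.

Lemma L2_bounded f M : measurable01 f ->
  (forall x, 0 < x < 1 -> `|f x| <= M) -> L2 f.
Proof.
move=> mf fM; apply/L2P; split => //; apply: (@L1_bounded _ (M ^+ 2)).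
  exact: measurable_funX.
move=> x /fM h; rewrite normrX lerXn2r// nnegrE//.
by rewrite (le_trans _ h).
Qed.

Lemma L2_cst k : L2 (fun=> k).
Proof. by apply: (@L2_bounded _ `|k|) => //; exact: measurable_cst. Qed.

Lemma L2_L1 f : L2 f -> L1 f.
Proof.
move=> f2; have := L2_mul (L2_cst 1) f2; apply: eq_L1 => x _.
by rewrite mul1r.
Qed.

Lemma L2_mul_bounded f g M : measurable01 g ->
  (forall x, 0 < x < 1 -> `|g x| <= M) -> L2 f -> L2 (fun x => g x * f x).
Proof.
move=> mg gM /L2P[mf f2]; apply/L2P; split; first exact: measurable_funM.
have := @L1_mul_bounded (fun x => f x ^+ 2) (fun x => g x ^+ 2) (M ^+ 2) f2.
move=> h; apply: (eq_L1 _ (h _ _)).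
- by move=> x _; rewrite exprMn.
- exact: measurable_funX.
- move=> x /gM gx; rewrite normrX lerXn2r// nnegrE//.
  by rewrite (le_trans _ gx).
Qed.

Lemma L2D f g : L2 f -> L2 g -> L2 (f + g).
Proof.
move=> /[dup] f2 /L2P[mf ff] /[dup] g2 /L2P[mg gg]; apply/L2P; split.
  exact: measurable_funD.
apply: (eq_L1 _ (L1D (L1D ff gg) (L1Z 2 (L2_mul f2 g2)))) => x _.
by rewrite -[(f + g) x]/(f x + g x); ring.
Qed.

Lemma L2Z k f : L2 f -> L2 (k *: f).
Proof.
move=> f2; apply: (@L2_mul_bounded f (fun=> k) `|k|) => //.
exact: measurable_cst.
Qed.

Lemma L2_lin k f g : L2 f -> L2 g -> L2 (k *: f + g).
Proof. by move=> f2 g2; apply: L2D => //; exact: L2Z. Qed.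

Lemma L2N f : L2 f -> L2 (- f).
Proof. by move=> /(L2Z (-1)); rewrite scaleN1r. Qed.

Lemma L2B f g : L2 f -> L2 g -> L2 (f - g).
Proof. by move=> f2 /L2N; exact: L2D. Qed.

Lemma eq_L2 f g : (forall x, 0 < x < 1 -> f x = g x) -> L2 f -> L2 g.
Proof.
move=> fg; rewrite /L2 (_ : ext0 f = ext0 g)//; apply/funext => x.
by rewrite /ext0 !patchE; case: ifPn => // /[!inE]/=; rewrite in_itv/=; exact: fg.
Qed.

Lemma continuous_bounded f : {within `[0, 1], continuous f} ->
  exists M, forall x, 0 <= x <= 1 -> `|f x| <= M.
Proof.
move=> cf; have [a _ aP] := @EVT_max R f 0 1 ler01 cf.
have [b _ bP] := @EVT_min R f 0 1 ler01 cf.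
exists (`|f a| + `|f b|) => x x01.
have := aP x; have := bP x; rewrite !in_itv/= => /(_ x01) h1 /(_ x01) h2.
have := ler_norm (f a); have := ler_norm (- f b); rewrite normrN.
have := normr_ge0 (f a); have := normr_ge0 (f b).
by move=> *; rewrite ler_norml; apply/andP; split; lra.
Qed.

Lemma continuous_measurable f : {within `[0, 1], continuous f} ->
  measurable01 f.
Proof.
move=> cf; rewrite /measurable01.
apply: (@measurable_funS _ _ (measurableTypeR R) R `[0, 1]%classic).
- exact: measurable_itv.
- by apply: subset_itv; rewrite bnd_simp.
- by apply: subspace_continuous_measurable_fun => //; exact: measurable_itv.
Qed.

Lemma L2_continuous f : {within `[0, 1], continuous f} -> L2 f.
Proof.
move=> cf; have [M fM] := continuous_bounded cf.
apply: (@L2_bounded _ M); first exact: continuous_measurable.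
by move=> x /andP[/ltW x0 /ltW x1]; apply: fM; rewrite x0.
Qed.

Lemma L2_continuous_mul f g : {within `[0, 1], continuous g} -> L2 f ->
  L2 (fun x => g x * f x).
Proof.
move=> cg; have [M gM] := continuous_bounded cg.
apply: (@L2_mul_bounded _ _ M); first exact: continuous_measurable.
by move=> x /andP[/ltW x0 /ltW x1]; apply: gM; rewrite x0.
Qed.

End L2Basics.

Section L2Space.
Variable R : realType.
Implicit Types (f g h : R -> R) (k : R).

Lemma dotC f g : dot f g = dot g f.
Proof. by apply: eq_int01 => x _; rewrite mulrC. Qed.

Lemma dot_lin k f g h : L2 f -> L2 g -> L2 h ->
  dot (k *: f + g) h = k * dot f h + dot g h.
Proof.
move=> f2 g2 h2; have fh := L2_mul f2 h2.
rewrite /dot -(int01Z k fh) -(int01D (L1Z k fh) (L2_mul g2 h2)).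
by apply: eq_int01 => x _; rewrite -[(k *: f + g) x]/(k * f x + g x); ring.
Qed.

Lemma dot_ge0 f : 0 <= dot f f.
Proof. by apply: int01_ge0 => x _; rewrite -expr2 sqr_ge0. Qed.

Lemma L2_0 : L2 (0 : R -> R).
Proof. exact: (L2_cst 0). Qed.

Definition L2_submod : submodule (R -> R) :=
  @Submodule R (R -> R) (@L2 R) L2_0 (fun k x y => @L2_lin R k x y).

Local Notation val2 := (@sm_val _ _ L2_submod).
Let sipC2 (x y : submod_type L2_submod) : dot (val2 x) (val2 y) = dot (val2 y) (val2 x).
Proof. exact: dotC. Qed.
Let sipl2 k (x y z : submod_type L2_submod) :
  dot (val2 (k *: x + y)) (val2 z) = k * dot (val2 x) (val2 z) + dot (val2 y) (val2 z).
Proof. by rewrite sm_val_lin dot_lin//; exact: (@submodP _ _ L2_submod). Qed.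
Let sip_ge02 (x : submod_type L2_submod) : 0 <= dot (val2 x) (val2 x).
Proof. exact: dot_ge0. Qed.

Definition L2_inner : semi_inner (submod_type L2_submod) :=
  SemiInner sipC2 sipl2 sip_ge02.

Lemma normL2_snorm (x : submod_type L2_submod) : normL2 (val2 x) = snorm L2_inner x.
Proof. by rewrite normL2E//; exact: (submodP x). Qed.

Lemma normL2_sqr f : L2 f -> normL2 f ^+ 2 = dot f f.
Proof. by move=> f2; rewrite normL2E// sqr_sqrtr// dot_ge0. Qed.

Lemma normL2_ge0 f : 0 <= normL2 f.
Proof. by rewrite /normL2 fine_ge0// Lnorm_ge0. Qed.

Lemma dot_cs f g : L2 f -> L2 g -> `|dot f g| <= normL2 f * normL2 g.
Proof.
move=> f2 g2; have := snorm_abs_cs L2_inner (@submod_in _ _ L2_submod f f2)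
  (@submod_in _ _ L2_submod g g2).
by rewrite -!normL2_snorm.
Qed.

Lemma normL2_triangle f g : L2 f -> L2 g -> normL2 (f + g) <= normL2 f + normL2 g.
Proof.
move=> f2 g2; have := snormD L2_inner (@submod_in _ _ L2_submod f f2)
  (@submod_in _ _ L2_submod g g2).
by rewrite -!normL2_snorm.
Qed.

Lemma normL2Z k f : L2 f -> normL2 (k *: f) = `|k| * normL2 f.
Proof.
move=> f2; have := snormZ L2_inner k (@submod_in _ _ L2_submod f f2).
by rewrite -!normL2_snorm.
Qed.

Lemma normL2N f : L2 f -> normL2 (- f) = normL2 f.
Proof. by move=> f2; rewrite -scaleN1r normL2Z// normrN1 mul1r. Qed.

Lemma normL2_cst k : normL2 (fun=> k) = `|k|.
Proof.
rewrite (normL2E (L2_cst k)) -sqrtr_sqr; congr Num.sqrt; exact: int01_cst.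
Qed.

Lemma int01_abs_le f : L2 f -> `|int01 f| <= normL2 f.
Proof.
move=> f2; have := dot_cs f2 (L2_cst 1); rewrite normL2_cst normr1 mulr1.
by congr (`|_| <= _); apply: eq_int01 => x _; rewrite mulr1.
Qed.

Lemma L2_norm f : L2 f -> L2 (fun x => `|f x|).
Proof.
move=> /L2P[mf f2]; apply/L2P; split; first exact: measurableT_comp.
by apply: (eq_L1 _ f2) => x _; rewrite real_normK// num_real.
Qed.

Lemma normL2_norm f : L2 f -> normL2 (fun x => `|f x|) = normL2 f.
Proof.
move=> f2; rewrite !normL2E//; last exact: L2_norm.
by congr Num.sqrt; apply: eq_int01 => x _; rewrite -normrM ger0_norm// -expr2 sqr_ge0.
Qed.

Lemma int01_norm_le f : L2 f -> int01 (fun x => `|f x|) <= normL2 f.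
Proof.
move=> f2; rewrite -(normL2_norm f2) (le_trans (ler_norm _))// int01_abs_le//.
exact: L2_norm.
Qed.

End L2Space.

(** * Completeness of the space of square integrable functions *)

Section RieszFischer.
Variable R : realType.
Local Notation mu := (@lebesgue_measure R).
Local Notation D := (`]0, 1[%classic : set (measurableTypeR R)).
Let mD : measurable D. Proof. exact: measurable_itv. Qed.

Lemma fast_subsequence (u : nat -> R -> R) :
  (forall e, 0 < e -> exists N, forall m n, (N <= m)%N -> (N <= n)%N ->
     normL2 (u m - u n) <= e) ->
  exists phi : nat -> nat, (forall k, (k <= phi k)%N) /\
    forall k, normL2 (u (phi k.+1) - u (phi k)) <= mesh R k.
Proof.
move=> cu; have h k : exists N, forall m n, (N <= m)%N -> (N <= n)%N ->
    normL2 (u m - u n) <= mesh R k by apply: cu; exact: mesh_gt0.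
have [p pP] := choice h.
pose phi k := (\sum_(j < k.+1) (p j + 1))%N.
have phiS k : (p k <= phi k)%N by rewrite /phi big_ord_recr/= addnCA leq_addr.
have phi_le k : (phi k <= phi k.+1)%N by rewrite [leqRHS]/phi big_ord_recr leq_addr.
exists phi; split=> k.
  by elim: k => // k ih; rewrite /phi big_ord_recr/= addn1 addnS ltnS (leq_trans ih)// leq_addr.
by apply: pP => //; exact: leq_trans (phi_le k).
Qed.

(** The series of the absolute increments has an integrable sum, hence converges
    almost everywhere. *)
Lemma fast_cvg_ae (v : nat -> R -> R) : (forall n, L2 (v n)) ->
  (forall k, normL2 (v k.+1 - v k) <= mesh R k) ->
  {ae mu, forall x, D x -> cvgn (fun n => v n x)}.
Proof.
move=> v2 vv; pose d k x := `|v k.+1 x - v k x|.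
have dv k : L2 (v k.+1 - v k) by exact: L2B.
have d2 k : L2 (d k) by exact: (L2_norm (dv k)).
have md k : measurable_fun D (fun x => (d k x)%:E).
  by apply/measurable_EFinP; exact: L2_measurable.
have mG : measurable_fun D (fun x => \sum_(0 <= k <oo) (d k x)%:E)%E.
  by apply: ge0_emeasurable_sum => [k x _ _|k _]; [rewrite lee_fin normr_ge0|exact: md].
have iG : mu.-integrable D (fun x => \sum_(0 <= k <oo) (d k x)%:E)%E.
  apply/integrableP; split => //.
  have -> : (\int[mu]_(x in D) `| \sum_(0 <= k <oo) (d k x)%:E | =
      \int[mu]_(x in D) \sum_(0 <= k <oo) (d k x)%:E)%E.
    apply: eq_integral => x _; rewrite /= gee0_abs// nneseries_ge0// => n _ _.
    by rewrite lee_fin normr_ge0.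
  rewrite integral_nneseries//; last by move=> n x _; rewrite lee_fin normr_ge0.
  apply: (@le_lt_trans _ _ 2%:E); last exact: ltry.
  apply: lime_le.
    by apply: is_cvg_nneseries => n _ _; apply: integral_ge0 => x _; rewrite lee_fin normr_ge0.
  apply: nearW => n.
  have E k : (\int[mu]_(x in D) (d k x)%:E = (int01 (d k))%:E)%E.
    by rewrite /int01 /Rintegral fineK//; apply: integrable_fin_num => //; exact: L2_L1.
  under eq_bigr do rewrite E.
  rewrite sumEFin lee_fin big_mkord.
  apply: (@le_trans _ _ (2 * (1 - mesh R n))); last first.
    by have := mesh_gt0 R n; lra.
  elim: n => [|n ih]; first by rewrite big_ord0 /mesh expr0 invr1 subrr mulr0.
  rewrite big_ord_recr/=; have := int01_norm_le (dv n); have := vv n.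
  by have := meshS R n; rewrite -/(d n) => ->; move: ih; rewrite meshS; lra.
apply: filterS (integrable_ae mD iG) => x h Dx; have {}h := h Dx.
have dn0 n : (0 <= n)%N -> xpredT n -> (0 <= (d n x)%:E)%E by rewrite lee_fin normr_ge0.
have cs : cvgn (series (fun k => v k.+1 x - v k x)).
  apply: (@normed_cvg R R^o); apply: nondecreasing_is_cvgn.
    apply/nondecreasing_seqP => n; rewrite /= /series/= big_nat_recr//= lerDl.
    exact: normr_ge0.
  exists (fine (\sum_(0 <= k <oo) (d k x)%:E)%E) => _ [n _ <-].
  rewrite -lee_fin fineK// /series/= -sumEFin.
  exact: (nneseries_lim_ge n dn0).
have -> : (fun n => v n x) = (fun n => v 0%N x + series (fun k => v k.+1 x - v k x) n).
  apply/funext => n; rewrite /series/= telescope_sumr// addrC subrK//.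
by apply: is_cvgD => //; exact: is_cvg_cst.
Qed.

(** The pointwise limit of a fast subsequence is the limit in norm, by Fatou's
    lemma applied to the squared distances. *)
Theorem L2_complete (u : nat -> R -> R) : (forall n, L2 (u n)) ->
  (forall e, 0 < e -> exists N, forall m n, (N <= m)%N -> (N <= n)%N ->
     normL2 (u m - u n) <= e) ->
  exists f, L2 f /\ forall e, 0 < e -> exists N, forall n, (N <= n)%N ->
     normL2 (u n - f) <= e.
Proof.
move=> u2 cu; have [phi [phi_ge phiP]] := fast_subsequence cu.
pose v k := u (phi k); have v2 k : L2 (v k) by exact: u2.
have vae := fast_cvg_ae v2 phiP.
have mv n : measurable_fun D (EFin \o v n).
  by apply/measurable_EFinP; exact: L2_measurable.
(* the upper limit is measurable without knowing where the sequence converges *)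
pose f x := fine (limn_esup (fun k => (v k x)%:E)).
have mf : measurable_fun D f.
  apply: measurableT_comp; first exact: fine_measurable.
  exact: (measurable_fun_limn_esup mv).
have fE x : cvgn (fun n => v n x) -> v n x @[n --> \oo] --> f x.
  move=> cv; rewrite /f (_ : limn_esup _ = (limn (fun n => v n x))%:E)//.
  have : (v n x)%:E @[n --> \oo] --> (limn (fun n => v n x))%:E.
    by apply: cvg_EFin; [exact: nearW|exact: cv].
  by move=> /cvg_limn_einf_sup[_ ->].
have key e : 0 < e -> exists N, forall n, (N <= n)%N ->
    L2 (u n - f) /\ dot (u n - f) (u n - f) <= e ^+ 2.
  move=> e0; have [N NP] := cu _ e0; exists N => n Nn.
  have mun : measurable_fun D (u n) by exact: L2_measurable.
  have mg : measurable_fun D (fun x => u n x - f x) by exact: measurable_funB.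
  pose q k (x : R) := ((u n x - v k x) ^+ 2)%:E.
  have mq k : measurable_fun D (q k).
    apply/measurable_EFinP/measurable_funX/measurable_funB => //.
    exact: L2_measurable.
  have q0 k x : D x -> (0 <= q k x)%E by rewrite lee_fin sqr_ge0.
  have fat := fatou mu mD mq q0.
  have E : (\int[mu]_(x in D) ((u n x - f x) ^+ 2)%:E =
      \int[mu]_(x in D) limn_einf (q ^~ x))%E.
    apply: ae_eq_integral => //.
    - by apply/measurable_EFinP/measurable_funX.
    - apply: measurableT_comp => //.
      apply: (@measurable_fun_limn_esup _ _ _ _ (fun k x => - q k x)%E) => k.
      by apply: (measurableT_comp (f := -%E)) => //; exact: mq.
    apply: filterS vae => x h Dx; apply/esym.
    suff : q k x @[k --> \oo] --> ((u n x - f x) ^+ 2)%:E.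
      by move/cvg_limn_einf_sup => [].
    apply: cvg_EFin; first exact: nearW.
    rewrite expr2 /comp/=; under eq_fun do rewrite expr2.
    by apply: cvgM; apply: cvgB; (exact: cvg_cst || exact: fE (h Dx)).
  have B : (\int[mu]_(x in D) ((u n x - f x) ^+ 2)%:E <= (e ^+ 2)%:E)%E.
    rewrite E; apply: le_trans fat _; rewrite limn_einf_lim; apply: lime_le.
      exact: is_cvg_einfs.
    exists N => // k /= Nk; apply: (@le_trans _ _ (\int[mu]_(x in D) q k x)%E).
      by apply: ereal_inf_lbound; exists k => /=.
    have uv : L2 (u n - v k) by exact: L2B.
    have -> : (\int[mu]_(x in D) q k x = (dot (u n - v k) (u n - v k))%:E)%E.
      rewrite /dot /int01 /Rintegral fineK; last first.
        by apply: integrable_fin_num => //; exact: (L2_mul uv uv).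
      by apply: eq_integral => x _; rewrite /q expr2.
    rewrite lee_fin -normL2_sqr// lerXn2r// ?nnegrE ?normL2_ge0 ?(ltW e0)//.
    by apply: NP => //; exact: leq_trans (phi_ge k).
  have g2 : L2 (u n - f).
    apply/L2P; split => //; apply/integrableP; split.
      exact/measurable_EFinP/measurable_funX.
    apply: le_lt_trans (ltry (e ^+ 2)); apply: le_trans B.
    rewrite le_eqVlt; apply/orP; left; apply/eqP; apply: eq_integral => x _ /=.
    by rewrite ger0_norm// sqr_ge0.
  split => //; rewrite -lee_fin; apply: le_trans B.
  rewrite /dot /int01 /Rintegral fineK; last first.
    by apply: integrable_fin_num => //; exact: (L2_mul g2 g2).
  by rewrite le_eqVlt; apply/orP; left; apply/eqP; apply: eq_integral => x _; rewrite expr2.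
exists f; split.
  have [N /(_ _ (leqnn N))[h _]] := key _ ltr01.
  by rewrite (_ : f = u N - (u N - f)); [exact: L2B|rewrite opprB addrC subrK].
move=> e e0; have [N NP] := key _ e0; exists N => n /NP[h1 h2].
by rewrite -(@ler_pXn2r _ 2)// ?nnegrE ?normL2_ge0 ?(ltW e0)// normL2_sqr.
Qed.

End RieszFischer.

(** * Primitives *)

Section Primitive.
Variable R : realType.
Local Notation mu := (@lebesgue_measure R).
Local Notation TR := (measurableTypeR R).
Local Notation D := (`]0, 1[%classic : set (measurableTypeR R)).
Implicit Types (f g h u v : R -> R) (k x y : R).
Let mD : measurable D. Proof. exact: measurable_itv. Qed.

(** The primitive vanishing at 0, written as an integral over the whole
    interval to suit Fubini's theorem. *)
Definition prim g x : R := int01 (fun s => (s < x)%R%:R * g s).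

Lemma measurable_nat_bool d (T : measurableType d) (E : set T) (b : T -> bool) :
  measurable_fun E b -> measurable_fun E (fun t => (b t)%:R : R).
Proof.
move=> mb; have mn : measurable_fun [set: bool] (fun c : bool => c%:R : R) by move=> _ Y _.
exact: (measurableT_comp mn mb).
Qed.

Lemma measurable_lt_cst x : @measurable01 R (fun s => (s < x)%R%:R).
Proof.
by apply: measurable_nat_bool; apply: measurable_fun_ltr.
Qed.

Lemma measurable_gt_cst x : @measurable01 R (fun s => (x < s)%R%:R).
Proof.
by apply: measurable_nat_bool; apply: measurable_fun_ltr.
Qed.

Lemma bool_abs_le1 (b : bool) : `|b%:R : R| <= 1.
Proof. by case: b; rewrite ?normr1 ?normr0. Qed.

Lemma prim_L1 g x : L1 g -> L1 (fun s => (s < x)%R%:R * g s).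
Proof.
move=> g1; apply: (@L1_mul_bounded _ _ _ 1) => //; first exact: measurable_lt_cst.
by move=> s _; exact: bool_abs_le1.
Qed.

Lemma prim_L2 g x : L2 g -> L2 (fun s => (s < x)%R%:R * g s).
Proof.
move=> g1; apply: (@L2_mul_bounded _ _ _ 1) => //; first exact: measurable_lt_cst.
by move=> s _; exact: bool_abs_le1.
Qed.

Lemma prim0 g : prim g 0 = 0.
Proof.
rewrite /prim (@eq_int01 _ _ (fun=> 0)) ?int01_cst// => s /andP[s0 _].
by rewrite ltNge (ltW s0) mul0r.
Qed.

Lemma prim1 g : prim g 1 = int01 g.
Proof. by apply: eq_int01 => s /andP[_ ->]; rewrite mul1r. Qed.

Lemma prim_lin k f g x : L1 f -> L1 g ->
  prim (fun s => k * f s + g s) x = k * prim f x + prim g x.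
Proof.
move=> f1 g1; have pf := prim_L1 x f1.
rewrite /prim -(int01Z k pf) -(int01D (L1Z k pf) (prim_L1 x g1)).
by apply: eq_int01 => s _; ring.
Qed.

Lemma eq_prim f g x : (forall s, 0 < s < 1 -> f s = g s) -> prim f x = prim g x.
Proof. by move=> fg; apply: eq_int01 => s /fg ->. Qed.

Lemma int01_lt_cst x : 0 <= x <= 1 -> int01 (fun s => (s < x)%R%:R) = x.
Proof.
move=> /andP[x0 x1]; rewrite /int01.
rewrite (_ : (fun s => _) = ((fun _ : TR => 1 : R) \_ ([set` `]-oo, x[] : set TR))); last first.
  by apply/funext => s; rewrite patchE mem_setE in_itv/=; case: (s < x).
rewrite -Rintegral_mkcondr Rintegral_cst; last by apply: measurableI => //; exact: measurable_itv.
rewrite mul1r (_ : _ `&` _ = [set` `]0, x[]); last first.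
  apply/seteqP; split => s /=; rewrite !in_itv/=; first by move=> [/andP[-> _]].
  by move=> /andP[-> sx]; rewrite sx (lt_le_trans sx).
rewrite /= lebesgue_measure_itv/= lte_fin; case: ltP => [_|x0']; first by rewrite -EFinB subr0.
by rewrite /=; apply/eqP; rewrite eq_le x0 x0'.
Qed.

(** The increment is the product of g with the indicator function of [x, y), whose
    norm is the square root of y - x. *)
Lemma prim_holder g x y : L2 g -> 0 <= x -> x <= y -> y <= 1 ->
  `|prim g y - prim g x| <= Num.sqrt (y - x) * normL2 g.
Proof.
move=> g2 x0 xy y1; pose c s : R := (s < y)%R%:R - (s < x)%R%:R.
have c2 : L2 c.
  apply: (@L2_bounded _ _ 1).
    by apply: measurable_funB; exact: measurable_lt_cst.
  move=> s _; rewrite /c; case: (ltP s x) => [sx|_].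
    by rewrite (lt_le_trans sx xy) subrr normr0.
  by rewrite subr0 bool_abs_le1.
have lt1 z : @L1 R (fun s => (s < z)%R%:R).
  by apply: (@L1_bounded _ _ 1) => [|s _]; [exact: measurable_lt_cst|exact: bool_abs_le1].
have -> : prim g y - prim g x = dot c g.
  rewrite /prim -int01B; [|exact/prim_L1/L2_L1..].
  by apply: eq_int01 => s _; rewrite /c mulrBl.
apply: le_trans (dot_cs c2 g2) _; rewrite ler_wpM2r ?normL2_ge0//.
rewrite normL2E// le_eqVlt; apply/orP; left; apply/eqP; congr Num.sqrt.
have -> : dot c c = int01 (fun s => (s < y)%R%:R - (s < x)%R%:R).
  apply: eq_int01 => s _; rewrite /c; case: (ltP s x) => [sx|_].
    by rewrite (lt_le_trans sx xy) subrr mulr0.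
  by case: (s < y); rewrite subr0 ?mulr1 ?mulr0.
by rewrite int01B// !int01_lt_cst ?x0 ?y1 ?(le_trans xy) ?(le_trans x0).
Qed.

Lemma prim_bound g x : L2 g -> 0 <= x <= 1 -> `|prim g x| <= normL2 g.
Proof.
move=> g2 /andP[x0 x1]; have := prim_holder g2 (lexx 0) x0 x1.
rewrite prim0 !subr0 => /le_trans; apply.
rewrite ler_piMl ?normL2_ge0// -[leRHS]sqrtr1 ler_wsqrtr//.
Qed.

Lemma int01_point (s0 : R) h : L1 h -> int01 (fun t => (t == s0)%:R * h t) = 0.
Proof.
move=> h1; rewrite /int01 (_ : (fun t => _) = ((h : TR -> R) \_ ([set s0] : set TR))); last first.
  apply/funext => t; rewrite patchE; case: ifPn => [/[!inE] ->|].
    by rewrite eqxx mul1r.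
  by rewrite notin_setE => /eqP/negbTE ->; rewrite mul0r.
have mI : measurable (D `&` ([set s0] : set TR)).
  by apply: measurableI => //; exact: measurable_set1.
rewrite -Rintegral_mkcondr /Rintegral null_set_integral//.
- apply: (@measurable_funS _ _ TR _ D) => //.
  by apply/measurable_EFinP; exact: L1_measurable.
- apply: (@subset_measure0 _ _ _ mu _ [set s0]) => //.
  exact: lebesgue_measure_set1.
Qed.

Lemma prim_upper h s : L1 h ->
  int01 (fun t => (s < t)%R%:R * h t) = int01 h - prim h s.
Proof.
move=> h1; have p1 := prim_L1 s h1.
have u1 : L1 (fun t => (s < t)%R%:R * h t).
  apply: (@L1_mul_bounded _ _ _ 1) => //; first exact: measurable_gt_cst.
  by move=> t _; exact: bool_abs_le1.
have e1 : L1 (fun t => (t == s)%:R * h t).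
  apply: (eq_L1 _ (L1B (L1B h1 p1) u1)) => t _.
  by case: ltgtP => _; rewrite ?mul1r ?mul0r; ring.
have -> : int01 h = int01 (fun t => (t < s)%R%:R * h t + (s < t)%R%:R * h t + (t == s)%:R * h t).
  by apply: eq_int01 => t _; case: ltgtP => _; rewrite ?mul1r ?mul0r; ring.
by rewrite int01D//; [rewrite int01D// int01_point// /prim; ring|exact: L1D].
Qed.

Lemma integral_ext0 f : int01 f = \int[mu]_x ((f : TR -> R) \_ D) x.
Proof. by rewrite /int01 Rintegral_mkcond. Qed.

(** Fubini's theorem on the part s < t of the unit square. *)
Lemma fubini_triangle g h : L1 g -> L1 h ->
  int01 (fun s => g s * int01 (fun t => (s < t)%R%:R * h t)) =
  int01 (fun t => h t * prim g t).
Proof.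
move=> g1 h1; pose g0 := (g : TR -> R) \_ D; pose h0 := (h : TR -> R) \_ D.
have ig : mu.-integrable setT (EFin \o g0).
  by move: g1; rewrite /L1 (integrable_mkcond _ mD) restrict_EFin.
have ih : mu.-integrable setT (EFin \o h0).
  by move: h1; rewrite /L1 (integrable_mkcond _ mD) restrict_EFin.
have mg : measurable_fun setT (g0 : TR -> R).
  by move/integrableP : ig => -[/measurable_EFinP].
have mh : measurable_fun setT (h0 : TR -> R).
  by move/integrableP : ih => -[/measurable_EFinP].
pose f (z : TR * TR) : \bar R := (g0 z.1 * (h0 z.2 * (z.1 < z.2 :> R)%R%:R))%:E.
have mf : measurable_fun setT f.
  apply/measurable_EFinP; apply: measurable_funM.
    exact: measurableT_comp mg measurable_fst.
  apply: measurable_funM; first exact: measurableT_comp mh measurable_snd.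
  by apply: measurable_nat_bool; apply: measurable_fun_ltr; [exact: measurable_fst|exact: measurable_snd].
have mlt (s : R) : measurable_fun setT (fun t : TR => (s < t :> R)%R%:R : R).
  by apply: measurable_nat_bool; exact: measurable_fun_ltr.
have mgt (t : R) : measurable_fun setT (fun s : TR => (s < t :> R)%R%:R : R).
  by apply: measurable_nat_bool; exact: measurable_fun_ltr.
have bd (p b : R -> R) : measurable_fun setT (p : TR -> R) -> mu.-integrable setT (EFin \o p) ->
    measurable_fun setT (b : TR -> R) -> (forall t, `|b t| <= 1) ->
    mu.-integrable setT (EFin \o (fun t => p t * b t)).
  move=> mp ip mb b1; apply: (le_integrable measurableT _ _ ip).
    by apply/measurable_EFinP; exact: measurable_funM.
  by move=> t _ /=; rewrite lee_fin normrM ler_piMr.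
have i1 s : mu.-integrable setT (EFin \o (fun t => h0 t * (s < t)%R%:R)).
  by apply: bd => // t; exact: bool_abs_le1.
have i2 t : mu.-integrable setT (EFin \o (fun s => g0 s * (s < t)%R%:R)).
  by apply: bd => // s; exact: bool_abs_le1.
have intf : (mu \x mu)%E.-integrable setT f.
  apply/(integrable12ltyP mu mu mf).
  apply: (@le_lt_trans _ _ (\int[mu]_s (`|g0 s|%:E * \int[mu]_t `|h0 t|%:E))%E).
    apply: ge0_le_integral => //.
    - by move=> s _; exact: integral_ge0.
    - apply: (@measurable_fun_fubini_tonelli_F _ _ TR TR R mu (abse \o f)).
        exact: measurableT_comp.
      by move=> z; exact: abse_ge0.
    - apply: emeasurable_funM; last exact: measurable_cst.
      by apply/measurable_EFinP; exact: measurableT_comp.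
    move=> s _; rewrite -ge0_integralZl_EFin//; last first.
      by apply/measurable_EFinP; exact: measurableT_comp.
    apply: ge0_le_integral => //.
    - apply: measurableT_comp => //; apply/measurable_EFinP.
      exact: (measurable_funM (measurable_cst (g0 s)) (measurable_funM mh (mlt s))).
    - apply: emeasurable_funM; first exact: measurable_cst.
      by apply/measurable_EFinP; exact: measurableT_comp.
    move=> t _; rewrite /f/= -EFinM lee_fin !normrM ler_wpM2l//.
    by rewrite ler_piMr// bool_abs_le1.
  have ihn : (\int[mu]_t `|h0 t|%:E)%E \is a fin_num.
    by apply: integrable_fin_num => //; exact: integrable_norm.
  rewrite -(fineK ihn) ge0_integralZr//; last 2 first.
  - by apply/measurable_EFinP; exact: measurableT_comp.
  - by rewrite fineK// integral_ge0.
  have ign : (\int[mu]_t `|g0 t|%:E)%E \is a fin_num.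
    by apply: integrable_fin_num => //; exact: integrable_norm.
  by rewrite -(fineK ign) -EFinM ltry.
have E1 : (\int[mu]_s \int[mu]_t f (s, t) =
    \int[mu]_s (g0 s * \int[mu]_t (h0 t * (s < t)%R%:R))%:E)%E.
  apply: eq_integral => s _; rewrite -RintegralZl// /Rintegral fineK//.
  apply: integrable_fin_num => //; have := integrableZl measurableT (g0 s) (i1 s).
  by apply: eq_integrable.
have E2 : (\int[mu]_t \int[mu]_s f (s, t) =
    \int[mu]_t (h0 t * \int[mu]_s (g0 s * (s < t)%R%:R))%:E)%E.
  apply: eq_integral => t _; rewrite -RintegralZl// /Rintegral fineK//.
    by apply: eq_integral => s _; rewrite /f/= mulrCA.
  apply: integrable_fin_num => //; have := integrableZl measurableT (h0 t) (i2 t).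
  by apply: eq_integrable.
have := Fubini intf; rewrite E1 E2 => FE; have {}FE := congr1 fine FE.
rewrite !integral_ext0 /Rintegral; move: FE; congr (_ = _); congr fine;
  apply: eq_integral => s _; congr EFin; rewrite patchE /g0 /h0 patchE.
- case: ifP => _; last by rewrite mul0r.
  congr (_ * _); rewrite integral_ext0; apply: eq_Rintegral => t _.
  by rewrite !patchE; case: ifP => _; rewrite ?mul0r// mulrC.
- case: ifP => _; last by rewrite mul0r.
  congr (_ * _); rewrite /prim integral_ext0; apply: eq_Rintegral => t _.
  by rewrite !patchE; case: ifP => _; rewrite ?mul0r// mulrC.
Qed.

End Primitive.

(** * Absolutely continuous functions *)

Section AbsolutelyContinuous.
Variable R : realType.
Implicit Types (f g h u v : R -> R) (k x y : R).

Lemma within01P f : {within `[0, 1], continuous f} <->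
  forall x, 0 <= x <= 1 -> forall e, 0 < e -> exists2 d, 0 < d &
    forall y, 0 <= y <= 1 -> `|x - y| < d -> `|f x - f y| <= e.
Proof.
split=> [/subspace_continuousP cf x x01 e e0|h].
  have := cf x; rewrite /= in_itv/= => /(_ x01)/cvgrPdist_le/(_ _ e0)/nbhs_ballP[d /= d0 dP].
  by exists d => // y y01 xy; apply: dP => //=; rewrite in_itv.
apply/subspace_continuousP => x /=; rewrite in_itv/= => x01.
apply/cvgrPdist_le => e /(h _ x01)[d d0 dP]; apply/nbhs_ballP; exists d => //= y xy.
by rewrite in_itv/= => y01; apply: dP.
Qed.

Lemma prim_continuous g : L2 g -> {within `[0, 1], continuous (prim g)}.
Proof.
move=> g2; apply/within01P => x /andP[x0 x1] e e0.
have np : 0 < normL2 g + 1 by rewrite ltr_wpDl ?normL2_ge0.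
exists ((e / (normL2 g + 1)) ^+ 2); first by rewrite exprn_gt0// divr_gt0.
move=> y /andP[y0 y1] xy.
have h : Num.sqrt `|x - y| * normL2 g <= e.
  apply: le_trans (_ : e / (normL2 g + 1) * (normL2 g + 1) <= _); last first.
    by rewrite divfK// gt_eqF.
  rewrite ler_pM ?normL2_ge0 ?sqrtr_ge0 ?lerDl//.
  apply: le_trans (ler_wsqrtr (ltW xy)) _.
  by rewrite sqrtr_sqr ger0_norm// divr_ge0 ?(ltW e0) ?(ltW np).
have [yx|/ltW yx] := leP x y.
  by move: h; rewrite distrC ger0_norm ?subr_ge0// distrC; apply: le_trans; exact: prim_holder.
by move: h; rewrite ger0_norm ?subr_ge0//; apply: le_trans; exact: prim_holder.
Qed.

Lemma primZ k g x : L1 g -> prim (fun s => k * g s) x = k * prim g x.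
Proof.
move=> g1; rewrite /prim -(int01Z k (prim_L1 x g1)).
by apply: eq_int01 => s _; ring.
Qed.

(** The pairs of a function in H^1 and its derivative, in integrated form: unlike
    weak derivatives this is directly usable for pointwise values and traces. *)
Definition abs_cont u g := L2 g /\ forall x, 0 <= x <= 1 -> u x = u 0 + prim g x.

Lemma AC_deriv_L2 u g : abs_cont u g -> L2 g. Proof. by case. Qed.

Lemma eq_AC u v g h : (forall x, 0 <= x <= 1 -> u x = v x) ->
  (forall x, 0 < x < 1 -> g x = h x) -> abs_cont u g -> abs_cont v h.
Proof.
move=> uv gh [g2 ug]; split; first exact: eq_L2 g2.
move=> x x01; rewrite -uv// ug// uv ?lexx ?ler01//.
by rewrite (eq_prim x gh).
Qed.

Lemma AC_prim g : L2 g -> abs_cont (prim g) g.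
Proof. by move=> g2; split => // x _; rewrite prim0 add0r. Qed.

Lemma AC_continuous u g : abs_cont u g -> {within `[0, 1], continuous u}.
Proof.
move=> [g2 ug]; apply/within01P => x x01 e e0.
have /within01P/(_ _ x01 _ e0)[d d0 dP] := prim_continuous g2.
exists d => // y y01 xy; rewrite ug// [u y]ug//.
by rewrite opprD addrACA subrr add0r; exact: dP.
Qed.

Lemma AC_L2 u g : abs_cont u g -> L2 u.
Proof. by move/AC_continuous/L2_continuous. Qed.

Lemma AC_lin k u g v h : abs_cont u g -> abs_cont v h -> abs_cont (k *: u + v) (k *: g + h).
Proof.
move=> [g2 ug] [h2 vh]; split; first exact: L2_lin.
move=> x x01; have := prim_lin k x (L2_L1 g2) (L2_L1 h2).
rewrite -[prim (k *: g + h) x]/(prim (fun s => k * g s + h s) x) => ->.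
rewrite -[(k *: u + v) x]/(k * u x + v x) -[(k *: u + v) 0]/(k * u 0 + v 0).
by rewrite ug// vh//; ring.
Qed.

Lemma AC_cst k : abs_cont (fun=> k) (fun=> 0).
Proof.
split; first exact: L2_cst.
move=> x _; rewrite /prim (@eq_int01 _ _ (fun=> 0)) ?int01_cst ?addr0// => s _.
by rewrite mulr0.
Qed.

Lemma AC_scale k u g : abs_cont u g -> abs_cont (fun x => k * u x) (fun x => k * g x).
Proof.
move=> ug; apply: (eq_AC _ _ (AC_lin k ug (AC_cst 0))) => x _.
  by rewrite -[(_ + _) x]/(k * u x + 0) addr0.
by rewrite -[(_ + _) x]/(k * g x + 0) addr0.
Qed.

Lemma AC_add u g v h : abs_cont u g -> abs_cont v h ->
  abs_cont (fun x => u x + v x) (fun x => g x + h x).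
Proof.
move=> ug vh; apply: (eq_AC _ _ (AC_lin 1 ug vh)) => x _.
  by rewrite -[(_ + _) x]/(1 * u x + v x) mul1r.
by rewrite -[(_ + _) x]/(1 * g x + h x) mul1r.
Qed.

Lemma AC_sub u g v h : abs_cont u g -> abs_cont v h ->
  abs_cont (fun x => u x - v x) (fun x => g x - h x).
Proof.
move=> ug vh; apply: (eq_AC _ _ (AC_add ug (AC_scale (-1) vh))) => x _;
by rewrite mulN1r.
Qed.

Lemma AC_int u g : abs_cont u g -> int01 g = u 1 - u 0.
Proof.
by move=> [_ /(_ 1)]; rewrite ler01 lexx prim1 => /(_ isT) ->; rewrite addrC addKr.
Qed.

Lemma L2_prim_mul g h : L2 g -> L2 h -> L2 (fun s => g s * prim h s).
Proof.
move=> g2 h2; apply: eq_L2 (L2_continuous_mul (prim_continuous h2) g2) => s _.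
by rewrite mulrC.
Qed.

(** The product of the integrals is an integral over the square; its two halves
    are the terms on the right. *)
Lemma int01_mul_prim g h : L2 g -> L2 h ->
  int01 g * int01 h = int01 (fun s => g s * prim h s) + int01 (fun s => h s * prim g s).
Proof.
move=> g2 h2; have g1 := L2_L1 g2; have h1 := L2_L1 h2.
rewrite -(fubini_triangle g1 h1).
have gh := L2_L1 (L2_prim_mul g2 h2).
rewrite (@eq_int01 _ (fun s => g s * int01 _) (fun s => int01 h * g s - g s * prim h s)).
  by rewrite int01B ?int01Z//; [ring|exact: L1Z].
by move=> s _; rewrite prim_upper//; ring.
Qed.

(** [int01_mul_prim] for the functions cut off at x. *)
Lemma prim_mul g h x : L2 g -> L2 h -> 0 <= x <= 1 ->
  prim g x * prim h x = prim (fun s => g s * prim h s + prim g s * h s) x.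
Proof.
move=> g2 h2 /andP[x0 x1].
have pE (p : R -> R) s : s <= x -> prim (fun r => (r < x)%R%:R * p r) s = prim p s.
  move=> sx; apply: eq_int01 => r _; case: (ltP r s) => [rs|_]; last by rewrite !mul0r.
  by rewrite (lt_le_trans rs sx) !mul1r.
have := int01_mul_prim (prim_L2 x g2) (prim_L2 x h2).
rewrite -/(prim g x) -/(prim h x) => ->.
have tE (p q : R -> R) : int01 (fun s => (s < x)%R%:R * p s * prim (fun r => (r < x)%R%:R * q r) s) =
    prim (fun s => p s * prim q s) x.
  apply: eq_int01 => s _; case: (ltP s x) => [sx|_]; last by rewrite !mul0r.
  by rewrite pE ?mul1r// ltW.
rewrite !tE.
have gh1 := L2_L1 (L2_prim_mul g2 h2); have hg1 := L2_L1 (L2_prim_mul h2 g2).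
have := prim_lin 1 x gh1 hg1; rewrite mul1r => <-.
by apply: eq_prim => s _; ring.
Qed.

(** After expansion around the values at 0 the product rule is [prim_mul]. *)
Lemma AC_mul u g v h : abs_cont u g -> abs_cont v h ->
  abs_cont (fun x => u x * v x) (fun x => g x * v x + u x * h x).
Proof.
move=> ug vh; have cu := AC_continuous ug; have cv := AC_continuous vh.
case: ug vh => [g2 ug] [h2 vh].
have gv2 : L2 (fun x => g x * v x).
  by apply: eq_L2 (L2_continuous_mul cv g2) => s _; rewrite mulrC.
have uh2 := L2_continuous_mul cu h2.
split; first exact: (L2D gv2 uh2).
move=> x x01; rewrite ug// vh//.
have gh2 := L2_prim_mul g2 h2; have hg2 := L2_prim_mul h2 g2.
have -> : prim (fun x => g x * v x + u x * h x) x =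
    prim (fun s => 1 * (g s * prim h s + prim g s * h s) + (v 0 * g s + u 0 * h s)) x.
  apply: eq_prim => s /andP[/ltW s0 /ltW s1].
  by rewrite (ug s) ?(vh s) ?s0//; ring.
have s1 : L1 (fun s => g s * prim h s + prim g s * h s).
  apply: (eq_L1 _ (L1D (L2_L1 gh2) (L2_L1 hg2))) => s _.
  by rewrite [h s * _]mulrC.
have s2 : L1 (fun s => v 0 * g s + u 0 * h s).
  by apply: L1D; apply: L1Z; exact: L2_L1.
rewrite (prim_lin 1 x s1 s2) -prim_mul//.
rewrite (prim_lin (v 0) x (L2_L1 g2) (L1Z (u 0) (L2_L1 h2))) (primZ (u 0) x (L2_L1 h2)).
by ring.
Qed.

End AbsolutelyContinuous.

(** * Weak derivatives *)

Section SmoothAC.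
Variable R : realType.
Local Notation mu := (@lebesgue_measure R).
Local Notation TR := (measurableTypeR R).
Implicit Types (f g h u v : R -> R) (k x y : R).

Lemma prim_itv f x : 0 <= x <= 1 -> prim f x = \int[mu]_(s in `]0, x[) f s.
Proof.
move=> /andP[x0 x1]; rewrite /prim /int01.
rewrite (_ : (fun s => _) = ((f : TR -> R) \_ ([set` `]-oo, x[] : set TR))); last first.
  apply/funext => s; rewrite patchE mem_setE in_itv/=; case: (s < x).
    by rewrite mul1r.
  by rewrite mul0r.
rewrite -Rintegral_mkcondr; congr (Rintegral _ _ _).
apply/seteqP; split => s /=; rewrite !in_itv/=; first by move=> [/andP[-> _]].
by move=> /andP[-> sx]; rewrite sx (lt_le_trans sx).
Qed.

Lemma continuous_within f (A : set R) : continuous f -> {within A, continuous f}.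
Proof. by move=> cf; apply: continuous_subspaceT. Qed.

Lemma is_derive_continuous f f' : (forall x, is_derive x 1 f (f' x)) -> continuous f.
Proof.
by move=> df x; apply: differentiable_continuous; apply/derivable1_diffP/ex_derive.
Qed.

Lemma AC_smooth f f' : (forall x, is_derive x 1 f (f' x)) -> continuous f' -> abs_cont f f'.
Proof.
move=> df cf'; have cf := is_derive_continuous df.
split; first by apply: L2_continuous; exact: continuous_within.
move=> x x01; have /andP[x0 x1] := x01.
move: x0; rewrite le_eqVlt => /predU1P[<-|x0]; first by rewrite prim0 addr0.
rewrite prim_itv//.
have i1 : mu.-integrable `[0, x] (EFin \o f').
  by apply: continuous_compact_integrable; [exact: segment_compact|exact: continuous_within].
have i2 : mu.-integrable `]0, x[ (EFin \o f').
  by apply: integrableS i1 => //; exact: subset_itv_oo_cc.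
have i3 : mu.-integrable `]0, x] (EFin \o f').
  by apply: integrableS i1 => //; exact: subset_itv_oc_cc.
rewrite Rintegral_itv_bndo_bndc// Rintegral_itv_obnd_cbnd// /Rintegral.
rewrite (@continuous_FTC2 _ f' f 0 x x0).
- by rewrite -EFinB/= addrC subrK.
- exact: continuous_within.
- split.
  + by move=> y _; exact: ex_derive.
  + by apply: cvg_at_right_filter; exact: cf.
  + by apply: cvg_at_left_filter; exact: cf.
- by move=> y _; rewrite derive1E; have dy := df y; rewrite derive_val.
Qed.

(** The support is closed and contained in the open interval, so it avoids the
    endpoints. *)
Lemma test_function_facts (phi : R -> R) : test_function phi ->
  [/\ phi 0 = 0, phi 1 = 0 & abs_cont phi (phi^`()%classic)].
Proof.
move=> [dphi cphi sphi].
have z x : ~ (0 < x < 1) -> phi x = 0.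
  move=> x01; apply/eqP/negPn/negP => phix; apply: x01.
  by have := sphi x (@subset_closure _ [set y | phi y != 0] x phix); rewrite /= in_itv.
split; [by apply: z; rewrite ltxx|by apply: z; rewrite ltxx andbF|].
apply: AC_smooth => // x; rewrite derive1E; exact/derivableP/dphi.
Qed.

Lemma AC_weak_derivative u g : abs_cont u g -> weak_derivative u g.
Proof.
move=> ug; split; [exact: AC_L2 ug|exact: AC_deriv_L2 ug|].
move=> phi /test_function_facts[p0 p1 dp].
have := AC_int (AC_mul ug dp); rewrite p0 p1 !mulr0 subrr.
have g2 := AC_deriv_L2 ug; have u2 := AC_L2 ug.
rewrite int01D; [|exact: L2_mul g2 (AC_L2 dp)|exact: L2_mul u2 (AC_deriv_L2 dp)].
by rewrite /int01 => /eqP; rewrite addrC addr_eq0 => /eqP.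
Qed.

Lemma AC_H1 u g : abs_cont u g -> H1 u.
Proof.
by move=> ug; split; [exact: AC_continuous ug|exists g; exact: AC_weak_derivative].
Qed.

(** The square of the positive part is differentiable at its kink as well, by a
    quadratic estimate that covers all positions of the two points. *)
Lemma derive_quadratic f x (l K : R) :
  (forall s, `|f s - f x - (s - x) * l| <= K * (s - x) ^+ 2) -> is_derive x 1 f l.
Proof.
move=> h; apply: is_derive_eps => e e0.
have K1 : 0 < `|K| + 1 by rewrite ltr_wpDl.
exists (e / (`|K| + 1)); first by rewrite divr_gt0.
move=> s; rewrite ltr_pdivlMr// => sx; apply: le_trans (h s) _.
rewrite -real_normK ?num_real// expr2 mulrA ler_wpM2r//.
rewrite mulrC; apply: le_trans (ltW sx); rewrite ler_wpM2l//.
by rewrite (le_trans (ler_norm K))// lerDl.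
Qed.

Definition pos_part x : R := Num.max x 0.

Lemma pos_part_quadratic x s :
  `|pos_part s ^+ 2 - pos_part x ^+ 2 - (s - x) * (2 * pos_part x)| <= (s - x) ^+ 2.
Proof.
have hs := sqr_ge0 s; have hx := sqr_ge0 x; have hsx := sqr_ge0 (s - x).
rewrite /pos_part ler_norml; case: (leP s 0) => s0; case: (leP x 0) => x0.
- by rewrite expr0n/= mulr0 mulr0 !subr0 hsx oppr_le0 hsx.
- by have := mulr_ge0 (ltW x0) (_ : 0 <= - s); rewrite oppr_ge0 => /(_ s0) p; apply/andP; split; lra.
- by have := mulr_ge0 (ltW s0) (_ : 0 <= - x); rewrite oppr_ge0 => /(_ x0) p; apply/andP; split; lra.
- by apply/andP; split; lra.
Qed.

Lemma pos_part_continuous (c : R) : continuous (fun s => pos_part (s - c)).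
Proof.
move=> x; apply: (@continuous_max _ _ (fun s => s - c) (fun=> 0)).
  by apply: cvgB; [exact: cvg_id|exact: cvg_cst].
exact: cvg_cst.
Qed.

(** A smoothed step of width [2 d] around [c] : second difference of the square
    of the positive part, hence continuously differentiable, and its derivative,
    a tent of integral 1. *)
Definition smooth_step (c d x : R) : R :=
  (pos_part (x - (c - d)) ^+ 2 - 2 * pos_part (x - c) ^+ 2
   + pos_part (x - (c + d)) ^+ 2) / (2 * d ^+ 2).
Definition tent (c d x : R) : R :=
  (pos_part (x - (c - d)) - 2 * pos_part (x - c) + pos_part (x - (c + d))) / d ^+ 2.

Lemma smooth_step_derive (c d x : R) : 0 < d ->
  is_derive x 1 (smooth_step c d) (tent c d x).
Proof.
move=> d0; apply: (@derive_quadratic _ _ _ (2 / d ^+ 2)) => s.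
have h1 := pos_part_quadratic (x - (c - d)) (s - (c - d)).
have h2 := pos_part_quadratic (x - c) (s - c).
have h3 := pos_part_quadratic (x - (c + d)) (s - (c + d)).
have sub (q : R) : s - q - (x - q) = s - x by ring.
rewrite !sub in h1 h2 h3.
have d2 : 0 < d ^+ 2 by rewrite exprn_gt0.
rewrite /smooth_step /tent.
set a1 := pos_part (x - (c - d)) in h1 *; set b1 := pos_part (s - (c - d)) in h1 *.
set a2 := pos_part (x - c) in h2 *; set b2 := pos_part (s - c) in h2 *.
set a3 := pos_part (x - (c + d)) in h3 *; set b3 := pos_part (s - (c + d)) in h3 *.
rewrite (_ : _ - _ - _ = ((b1 ^+ 2 - a1 ^+ 2 - (s - x) * (2 * a1))
  - 2 * (b2 ^+ 2 - a2 ^+ 2 - (s - x) * (2 * a2))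
  + (b3 ^+ 2 - a3 ^+ 2 - (s - x) * (2 * a3))) / (2 * d ^+ 2)); last first.
  by field; rewrite gt_eqF.
have e2 : 0 < 2 * d ^+ 2 by rewrite mulr_gt0.
rewrite normrM normfV (gtr0_norm e2) ler_pdivrMr//.
rewrite (_ : _ * (2 * d ^+ 2) = 4 * (s - x) ^+ 2); last by field; rewrite gt_eqF.
move: h1 h2 h3; rewrite !ler_norml => /andP[? ?] /andP[? ?] /andP[? ?].
by apply/andP; split; lra.
Qed.

Lemma tent_continuous (c d : R) : continuous (tent c d).
Proof.
move=> x; apply: cvgM; last exact: cvg_cst.
apply: cvgD; last exact: pos_part_continuous.
apply: cvgB; first exact: pos_part_continuous.
by apply: cvgM; [exact: cvg_cst|exact: pos_part_continuous].
Qed.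

Lemma smooth_step_left (c d x : R) : 0 < d -> x <= c - d -> smooth_step c d x = 0.
Proof.
move=> d0 xc; rewrite /smooth_step /pos_part.
rewrite (max_idPr _); last lra.
rewrite (max_idPr _); last lra.
rewrite (max_idPr _); last lra.
by rewrite expr0n/= mulr0 subr0 addr0 mul0r.
Qed.

Lemma smooth_step_right (c d x : R) : 0 < d -> c + d <= x -> smooth_step c d x = 1.
Proof.
move=> d0 xc; rewrite /smooth_step /pos_part.
rewrite (max_idPl _); last lra.
rewrite (max_idPl _); last lra.
rewrite (max_idPl _); last lra.
by field; rewrite gt_eqF.
Qed.

Lemma tent_ge0 (c d x : R) : 0 < d -> 0 <= tent c d x.
Proof.
move=> d0; rewrite /tent divr_ge0 ?sqr_ge0// /pos_part.
by case: (leP (x - (c - d)) 0) => ?; case: (leP (x - c) 0) => ?; case: (leP (x - (c + d)) 0) => ?; lra.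
Qed.

Lemma tent_out (c d x : R) : 0 < d -> d <= `|x - c| -> tent c d x = 0.
Proof.
move=> d0; rewrite ler_normr /tent /pos_part => h.
suff -> : Num.max (x - (c - d)) 0 - 2 * Num.max (x - c) 0 +
  Num.max (x - (c + d)) 0 = 0 by rewrite mul0r.
by case/orP: h => h; case: (leP (x - (c - d)) 0) => ?; case: (leP (x - c) 0) => ?; case: (leP (x - (c + d)) 0) => ?; lra.
Qed.

(** The du Bois-Reymond lemma. The difference of two smoothed steps is a test
    function, whose derivative compares the averages of [w] near two points. *)
Lemma weak_constant (w : R -> R) : {within `[0, 1], continuous w} ->
  (forall phi, test_function phi -> int01 (fun x => w x * phi^`()%classic x) = 0) ->
  forall x, 0 <= x <= 1 -> w x = w 0.
Proof.
move=> cw hw; have w2 := L2_continuous cw; have /within01P wP := cw.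
have near x e : 0 < x < 1 -> 0 < e -> exists2 d, 0 < d & forall d', 0 < d' -> d' <= d ->
    [/\ 0 < x - d', x + d' < 1, L1 (fun s => w s * tent x d' s) &
      `|int01 (fun s => w s * tent x d' s) - w x| <= e].
  move=> /andP[x0 x1] e0.
  have [|d d0 dP] := wP x _ e e0; first by rewrite !ltW.
  exists (Num.min d (Num.min (x / 2) ((1 - x) / 2))).
    by rewrite !lt_min d0 !divr_gt0// subr_gt0.
  move=> d' d'0; rewrite !le_min => /and3P[d'd d'x d'1].
  have t2 : L2 (tent x d').
    by apply: L2_continuous; apply: continuous_within; exact: tent_continuous.
  have wt1 := L2_mul w2 t2.
  split; [lra|lra|exact: wt1|].
  have tS := AC_smooth (fun y => smooth_step_derive x y d'0) (@tent_continuous x d').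
  have ti : int01 (tent x d') = 1.
    rewrite (AC_int tS) (@smooth_step_left x d' 0)//; last lra.
    by rewrite (@smooth_step_right x d' 1)// ?subr0//; lra.
  have -> : int01 (fun s => w s * tent x d' s) - w x =
      int01 (fun s => (w s - w x) * tent x d' s).
    rewrite -[X in _ - X]mulr1 -ti -(int01Z (w x) (L2_L1 t2)) -(int01B wt1); last exact/L1Z/L2_L1.
    by apply: eq_int01 => s _; ring.
  have c1 : L1 (fun s => (w s - w x) * tent x d' s).
    apply: (eq_L1 _ (L1B wt1 (L1Z (w x) (L2_L1 t2)))) => s _; ring.
  apply: (@le_trans _ _ (int01 (fun s => e * tent x d' s))); last first.
    by rewrite int01Z ?ti ?mulr1//; exact: L2_L1.
  have bd s : 0 < s < 1 -> `|(w s - w x) * tent x d' s| <= e * tent x d' s.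
    move=> /andP[s0 s1]; rewrite normrM [`|tent _ _ _|]ger0_norm ?tent_ge0//.
    have [sx|sx] := leP d' `|s - x|; first by rewrite tent_out// !mulr0.
    rewrite ler_wpM2r ?tent_ge0// distrC; apply: dP; first by rewrite !ltW.
    by rewrite distrC (lt_le_trans sx).
  apply: le_trans (le_normr_Rintegral _ c1) _; first exact: measurable_itv.
  apply: int01_le; [exact: integrable_norm|exact/L1Z/L2_L1|exact: bd].
have wc x y : 0 < x < 1 -> 0 < y < 1 -> w x = w y.
  move=> x01 y01; apply/eqP; rewrite -subr_eq0 -normr_le0; apply/ler_addgt0Pl => e e0.
  rewrite addr0; have e20 : 0 < e / 2 by rewrite divr_gt0.
  have [d1 d10 h1] := near x _ x01 e20; have [d2 d20 h2] := near y _ y01 e20.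
  pose d := Num.min d1 d2; have d0 : 0 < d by rewrite lt_min d10.
  have dd1 : d <= d1 by rewrite ge_min lexx.
  have dd2 : d <= d2 by rewrite ge_min lexx orbT.
  have [a1 a2 a3 a4] := h1 d d0 dd1; have [b1 b2 b3 b4] := h2 d d0 dd2.
  pose phi s := smooth_step x d s - smooth_step y d s.
  have dphi (s : R) : is_derive s 1 phi (tent x d s - tent y d s).
    have p1 := smooth_step_derive x s d0; have p2 := smooth_step_derive y s d0.
    by have := is_deriveB p1 p2.
  have dE : phi^`()%classic = (fun s => tent x d s - tent y d s).
    by apply/funext => s; rewrite derive1E; have p := dphi s; rewrite derive_val.
  have tphi : test_function phi.
    split.
    - by move=> s; exact: ex_derive.
    - rewrite dE => s; by apply: cvgB; exact: tent_continuous.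
    apply: subset_trans (_ : `[Num.min x y - d, Num.max x y + d] `<=` _); last first.
      by move=> s; rewrite /= !in_itv/=; case: (leP x y) => xy /andP[? ?];
        apply/andP; split; lra.
    rewrite [X in _ `<=` X](closure_id _).1; last exact: itv_closed.
    apply: closureS => s /=; rewrite in_itv/= /phi => /eqP ps.
    apply/andP; split; rewrite leNgt; apply/negP => h; apply: ps.
      by rewrite !smooth_step_left ?subrr//; move: h; case: (leP x y); lra.
    by rewrite !smooth_step_right ?subrr//; move: h; case: (leP x y); lra.
  have := hw _ tphi; rewrite dE.
  rewrite (@eq_int01 _ _ (fun s => w s * tent x d s - w s * tent y d s)); last first.
    by move=> s _; rewrite mulrBr.
  rewrite int01B// => E0.
  by move: a4 b4; rewrite !ler_norml => /andP[? ?] /andP[? ?]; apply/andP; split; lra.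
have half01 : 0 < (2^-1 : R) < 1 by rewrite invr_gt0 ltr0n/= invf_lt1// ltr1n.
(* an endpoint is approached along the segment to the midpoint *)
have wend x : 0 <= x <= 1 -> w x = w 2^-1.
  move=> x01; apply/eqP; rewrite -subr_eq0 -normr_le0; apply/ler_addgt0Pl => e e0.
  rewrite addr0; have [d d0 dP] := wP x x01 e e0.
  pose r := Num.min 2^-1 (d / 2); have r0 : 0 < r by rewrite lt_min invr_gt0 ltr0n divr_gt0.
  pose y := x + r * (2^-1 - x).
  have rl : r <= 2^-1 by rewrite ge_min lexx.
  have rd : r <= d / 2 by rewrite ge_min lexx orbT.
  have y01 : 0 < y < 1 by rewrite /y; move: x01 => /andP[? ?]; apply/andP; split; nra.
  rewrite -(wc y _ y01 half01); apply: dP; first by case/andP: y01 => /ltW -> /ltW ->.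
  rewrite /y opprD addrA subrr sub0r normrN normrM (gtr0_norm r0).
  have : `|2^-1 - x| <= 1 by rewrite ler_norml; lra.
  by move: (normr_ge0 (2^-1 - x)); nra.
by move=> x x01; rewrite !wend// lexx ler01.
Qed.

(** u minus the primitive of g has weak derivative zero, hence is constant. *)
Lemma weak_derivative_AC u g : {within `[0, 1], continuous u} ->
  weak_derivative u g -> abs_cont u g.
Proof.
move=> cu [u2 g2 ug]; split => // x x01.
have P := AC_prim g2; have [_ _ pg] := AC_weak_derivative P.
have p2 := AC_L2 P.
have := @weak_constant (fun x => u x - prim g x) _ _ x x01.
rewrite prim0 subr0 => <-; first by rewrite subrK.
  by move=> y; apply: cvgB; [exact: cu|exact: prim_continuous].
move=> phi tphi; have [_ _ dp] := test_function_facts tphi.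
have dp2 := AC_deriv_L2 dp.
rewrite (@eq_int01 _ _ (fun s => u s * phi^`()%classic s - prim g s * phi^`()%classic s)); last first.
  by move=> s _; rewrite mulrBl.
rewrite int01B; [|exact: L2_mul|exact: L2_mul].
by rewrite /int01 ug// pg// subrr.
Qed.

End SmoothAC.

(** * Functions of norm zero *)

Section NullLemmas.
Variable R : realType.
Local Notation mu := (@lebesgue_measure R).
Local Notation TR := (measurableTypeR R).
Local Notation D := (`]0, 1[%classic : set (measurableTypeR R)).
Implicit Types (f g h u v : R -> R) (k x y : R).
Let mD : measurable D. Proof. exact: measurable_itv. Qed.

(** By Lebesgue's differentiation theorem g is almost everywhere the derivative
    of its primitive. *)
Lemma prim_zero g : L2 g -> (forall x, 0 <= x <= 1 -> prim g x = 0) -> dot g g = 0.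
Proof.
move=> g2 pg; pose g0 := (g : TR -> R) \_ D.
have g1 := L2_L1 g2.
have ig : mu.-integrable setT (EFin \o g0).
  by move: g1; rewrite /L1 (integrable_mkcond _ mD) restrict_EFin.
have il : locally_integrable setT g0.
  apply: open_integrable_locally => //; exact: openT.
have iy y : mu.-integrable `]-oo, y] (EFin \o g0).
  by apply: integrableS ig => //; exact: measurable_itv.
have := FTC1Ny iy il; set F := fun x : R => _.
have FE x : 0 <= x <= 1 -> F x = 0.
  move=> x01; rewrite /F -Rintegral_itv_bndo_bndc; last first.
    by apply: integrableS ig => //; exact: measurable_itv.
  rewrite -[RHS](pg x x01) /prim integral_ext0 Rintegral_mkcond.
  apply: eq_Rintegral => s _; rewrite /g0 !patchE mem_setE in_itv/=.
  by case: (s \in D) => //; case: (s < x); rewrite ?mul1r ?mul0r.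
move=> ae0; have dg : \forall x \ae mu, D x -> (g x * g x)%:E = 0%E.
  move: ae0; apply: filterS; first exact: (ae_filter_ringOfSetsType mu).
  move=> x [_ dF] Dx.
  have : F^`()%classic x = 0.
    rewrite derive1E; move: Dx; rewrite /= in_itv/= => /andP[x0 x1].
    have Fx : is_derive x 1 F 0.
      apply: is_derive_eps => e e0.
      exists (Num.min x (1 - x)); first by rewrite lt_min x0 subr_gt0.
      move=> s; rewrite lt_min !ltr_norml => /andP[/andP[? ?] /andP[? ?]].
      rewrite !FE ?(ltW x0) ?(ltW x1)//; last by apply/andP; split; lra.
      by rewrite mulr0 !subr0 normr0 mulr_ge0// ltW.
    by rewrite derive_val.
  by rewrite dF /g0 patchE (mem_set Dx) => ->; rewrite mul0r.
rewrite /dot /int01 /Rintegral.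
have -> : (\int[mu]_(x in D) (g x * g x)%:E = \int[mu]_(x in D) (cst 0 x))%E.
  apply: ae_eq_integral => //.
  have m : measurable_fun D (fun x => g x * g x) := L1_measurable (L2_mul g2 g2).
  exact/measurable_EFinP.
by rewrite integral0.
Qed.

Lemma AC_derive_null u g : abs_cont u g -> (forall x, 0 <= x <= 1 -> u x = u 0) ->
  dot g g = 0.
Proof.
move=> [g2 ug] u0; apply: prim_zero => // x x01.
by have := ug x x01; rewrite u0//; lra.
Qed.

Lemma normL2_eq0 f : L2 f -> normL2 f = 0 <-> dot f f = 0.
Proof.
move=> f2; rewrite -normL2_sqr//; split=> [->|/eqP]; first by rewrite expr0n.
by rewrite sqrf_eq0 => /eqP.
Qed.

Lemma dot_null f h : L2 f -> L2 h -> dot f f = 0 -> dot f h = 0.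
Proof.
move=> f2 h2 /(normL2_eq0 f2) f0; have := dot_cs f2 h2.
by rewrite f0 mul0r normr_le0 => /eqP.
Qed.

Lemma dot_subl f g h : L2 f -> L2 g -> L2 h -> dot (f - g) h = dot f h - dot g h.
Proof.
move=> f2 g2 h2; have := dot_lin (-1) g2 f2 h2.
by rewrite scaleN1r [- g + f]addrC => ->; ring.
Qed.

Lemma dot_eqv f g h : L2 f -> L2 g -> L2 h -> dot (f - g) (f - g) = 0 ->
  dot f h = dot g h.
Proof.
move=> f2 g2 h2 fg; apply/eqP; rewrite -subr_eq0 -dot_subl//; apply/eqP.
by apply: dot_null => //; exact: L2B.
Qed.

Lemma AC_unique u g h : abs_cont u g -> abs_cont u h -> dot (g - h) (g - h) = 0.
Proof.
move=> ug uh; apply: (AC_derive_null (AC_sub ug uh)) => x x01.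
by rewrite /= !subrr.
Qed.

(** By the product rule f^2 has derivative 2fg, which is zero almost everywhere;
    so f^2 is constant, and its integral is zero. *)
Lemma AC_null f g : abs_cont f g -> dot f f = 0 ->
  (forall x, 0 <= x <= 1 -> f x = 0) /\ dot g g = 0.
Proof.
move=> fg f0; have f2 := AC_L2 fg; have g2 := AC_deriv_L2 fg.
have [_ ff] := AC_mul fg fg.
have sq x : 0 <= x <= 1 -> f x * f x = f 0 * f 0.
  move=> x01; rewrite ff// -[RHS]addr0; congr (_ + _).
  have h2 := L2Z 2 (prim_L2 x g2).
  rewrite -(dot_null f2 h2 f0); apply: eq_int01 => s _.
  by rewrite -[(2 *: _) s]/(2 * ((s < x)%R%:R * g s)); ring.
have z : f 0 * f 0 = 0.
  rewrite -[RHS]f0 -[LHS](int01_cst (f 0 * f 0)); apply: eq_int01 => s /andP[s0 s1].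
  by rewrite sq// !ltW.
have fz x : 0 <= x <= 1 -> f x = 0.
  by move=> x01; apply/eqP; rewrite -sqrf_eq0 expr2 sq// z.
by split => //; apply: (AC_derive_null fg) => x x01; rewrite !fz// lexx ler01.
Qed.

End NullLemmas.

(** * The Sobolev norm *)

Section SobolevSpace.
Variable R : realType.
Implicit Types (f g h u v : R -> R) (k x y : R).

Definition wderiv u : R -> R := get [set g | weak_derivative u g].

Lemma wderivP u : H1 u -> abs_cont u (wderiv u).
Proof.
move=> [cu [g ug]]; apply: weak_derivative_AC => //.
rewrite /wderiv; case: xgetP => [h -> //|/(_ g)]; exact.
Qed.

Lemma wderiv_L2 u : H1 u -> L2 (wderiv u).
Proof. by move=> /wderivP/AC_deriv_L2. Qed.

Lemma H1_L2 u : H1 u -> L2 u.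
Proof. by move=> /wderivP/AC_L2. Qed.

Lemma wderiv_eqv u g : abs_cont u g -> dot (wderiv u - g) (wderiv u - g) = 0.
Proof. by move=> ug; apply: (AC_unique _ ug); apply: wderivP; exact: AC_H1 ug. Qed.

Lemma dot_wderiv u g h : abs_cont u g -> L2 h -> dot (wderiv u) h = dot g h.
Proof.
move=> ug h2; apply: dot_eqv => //; last exact: wderiv_eqv.
  exact/wderiv_L2/(AC_H1 ug).
exact: AC_deriv_L2 ug.
Qed.

Lemma normL2_wderiv u g : abs_cont u g -> normL2 (wderiv u) = normL2 g.
Proof.
move=> ug; have d2 := wderiv_L2 (AC_H1 ug); have g2 := AC_deriv_L2 ug.
by rewrite !normL2E// (dot_wderiv ug d2) dotC (dot_wderiv ug g2).
Qed.

Lemma normH1E u g : abs_cont u g ->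
  normH1 u = Num.sqrt (normL2 u ^+ 2 + normL2 g ^+ 2).
Proof. by move=> ug; rewrite /normH1 -/(wderiv u) (normL2_wderiv ug). Qed.

Lemma normH1_ge0 u : 0 <= normH1 u.
Proof. exact: sqrtr_ge0. Qed.

Lemma normH1_le u g : abs_cont u g -> normH1 u <= normL2 u + normL2 g.
Proof.
move=> ug; rewrite (normH1E ug) -[leRHS]ger0_norm ?addr_ge0 ?normL2_ge0//.
rewrite -sqrtr_sqr ler_wsqrtr// sqrrD.
have := mulr_ge0 (normL2_ge0 u) (normL2_ge0 g); lra.
Qed.

Lemma normL2_le_normH1 u : normL2 u <= normH1 u.
Proof.
rewrite -[leLHS]ger0_norm ?normL2_ge0// -sqrtr_sqr ler_wsqrtr//.
by rewrite lerDl sqr_ge0.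
Qed.

Lemma normL2_deriv_le_normH1 u g : abs_cont u g -> normL2 g <= normH1 u.
Proof.
move=> ug; rewrite (normH1E ug) -[leLHS]ger0_norm ?normL2_ge0//.
by rewrite -sqrtr_sqr ler_wsqrtr// lerDr sqr_ge0.
Qed.

Lemma H1_0 : H1 (0 : R -> R).
Proof. exact: (AC_H1 (AC_cst 0)). Qed.

Lemma H1_lin k u v : H1 u -> H1 v -> H1 (k *: u + v).
Proof. by move=> /wderivP u1 /wderivP v1; exact: AC_H1 (AC_lin k u1 v1). Qed.

Lemma AC_bound u g x : abs_cont u g -> 0 <= x <= 1 -> `|u x - u 0| <= normL2 g.
Proof.
move=> [g2 ug] x01; rewrite ug// addrC addKr; exact: prim_bound.
Qed.

Lemma normL2_le_const f M : L2 f -> (forall x, 0 < x < 1 -> `|f x| <= M) ->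
  0 <= M -> normL2 f <= M.
Proof.
move=> f2 fM M0; rewrite -(@ler_pXn2r _ 2)// ?nnegrE ?normL2_ge0//.
rewrite normL2_sqr// -[leRHS](int01_cst (M ^+ 2)); apply: int01_le.
- exact: L2_mul.
- exact: L1_cst.
- move=> x /fM h; rewrite -expr2 -real_normK ?num_real// lerXn2r// nnegrE//.
Qed.

(** A Poincare inequality; the trace at 0 makes up for constants. *)
Lemma normL2_le_deriv u g : abs_cont u g -> normL2 u <= `|u 0| + normL2 g.
Proof.
move=> ug; apply: normL2_le_const; first exact: AC_L2 ug.
  move=> x /andP[x0 x1]; have x01 : 0 <= x <= 1 by rewrite !ltW.
  have := AC_bound ug x01; have := ler_normD (u x - u 0) (u 0).
  by rewrite subrK; lra.
by rewrite addr_ge0// normL2_ge0.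
Qed.

Lemma wderiv_lin k u v : H1 u -> H1 v ->
  abs_cont (k *: u + v) (k *: wderiv u + wderiv v).
Proof. by move=> /wderivP u1 /wderivP v1; exact: AC_lin. Qed.

(** The factor 2 comes from comparing the norm with the sum of the two norms; it
    spares a proof that the norm is Euclidean. *)
Lemma normH1_triangle u v : H1 u -> H1 v -> normH1 (u + v) <= 2 * (normH1 u + normH1 v).
Proof.
move=> u1 v1; have := wderiv_lin 1 u1 v1; rewrite !scale1r => uv.
apply: le_trans (normH1_le uv) _.
have := normL2_triangle (H1_L2 u1) (H1_L2 v1).
have := normL2_triangle (wderiv_L2 u1) (wderiv_L2 v1).
have := normL2_deriv_le_normH1 (wderivP u1); have := normL2_deriv_le_normH1 (wderivP v1).
have := normL2_le_normH1 u; have := normL2_le_normH1 v; lra.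
Qed.

End SobolevSpace.

Lemma le_of_sqr (R : realType) (x y : R) : 0 <= y -> x ^+ 2 <= y ^+ 2 -> x <= y.
Proof.
move=> y0 xy; have := ler_sqrt (x ^+ 2) (sqr_ge0 y).
by rewrite xy !sqrtr_sqr (ger0_norm y0) => h; rewrite (le_trans (ler_norm x)).
Qed.

(** * The energy of a wave coupled with a heat equation *)

Section WeightedDot.
Variable R : realType.
Implicit Types (w f g h : R -> R) (k : R).

Definition wdot w f g : R := dot f (fun x => w x * g x).

Lemma wdotC w f g : wdot w f g = wdot w g f.
Proof. by apply: eq_int01 => x _; ring. Qed.

Lemma L2_weight w f : continuous w -> L2 f -> L2 (fun x => w x * f x).
Proof. by move=> cw; apply: L2_continuous_mul; exact: continuous_within. Qed.

Lemma wdot_eqv w f f' g : continuous w -> L2 f -> L2 f' -> L2 g ->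
  dot (f - f') (f - f') = 0 -> wdot w f g = wdot w f' g.
Proof. by move=> cw f2 f2' g2 ff; apply: dot_eqv => //; exact: L2_weight. Qed.

Lemma wdot_lin w k f g h : continuous w -> L2 f -> L2 g -> L2 h ->
  wdot w (k *: f + g) h = k * wdot w f h + wdot w g h.
Proof. by move=> cw f2 g2 h2; apply: dot_lin => //; exact: L2_weight. Qed.

Lemma wdot_bounds w f m M : continuous w -> L2 f ->
  (forall x, 0 < x < 1 -> m <= w x <= M) ->
  m * dot f f <= wdot w f f <= M * dot f f.
Proof.
move=> cw f2 wM; have ff := L2_mul f2 f2; have wf := L2_mul f2 (L2_weight cw f2).
rewrite /dot -!int01Z//; apply/andP; split; apply: int01_le => //; try exact: L1Z;
  move=> x /wM /andP[w1 w2]; rewrite [f x * (_ * _)]mulrCA -expr2 ler_wpM2r ?sqr_ge0//.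
Qed.

Lemma wdot_ge0 w f : (forall x, 0 <= w x) -> 0 <= wdot w f f.
Proof.
by move=> w0; apply: int01_ge0 => x _; rewrite mulrCA -expr2 mulr_ge0 ?sqr_ge0.
Qed.

End WeightedDot.

Section EnergySpace.
Variable R : realType.
Implicit Types (k : R).
Local Notation V3 := ((R -> R) * (R -> R) * (R -> R))%type.
Implicit Types (Y Z : V3).

Lemma full_spaceP Y : full_space Y <-> [/\ H1L Y.1.1, L2 Y.1.2 & L2 Y.2].
Proof. by case: Y => [[u v] p]. Qed.

Lemma H1L_0 : H1L (0 : R -> R).
Proof. by split => //; exact: H1_0. Qed.

Lemma H1L_lin k (u v : R -> R) : H1L u -> H1L v -> H1L (k *: u + v).
Proof.
move=> [u1 u0] [v1 v0]; split; first exact: H1_lin.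
by rewrite -[LHS]/(k * u 0 + v 0) u0 v0 mulr0 addr0.
Qed.

Lemma full_space0 : full_space (0 : V3).
Proof. by apply/full_spaceP; split; [exact: H1L_0|exact: L2_0..]. Qed.

Lemma full_space_lin k Y Z : full_space Y -> full_space Z -> full_space (k *: Y + Z).
Proof.
move=> /full_spaceP[a b c] /full_spaceP[a' b' c']; apply/full_spaceP.
split; [exact: (H1L_lin k a a')|exact: (L2_lin k b b')|exact: (L2_lin k c c')].
Qed.

Definition full_submod : submodule V3 := Submodule full_space0 full_space_lin.

Local Notation H := (submod_type full_submod).
Local Notation val3 := (@sm_val _ _ full_submod).

Lemma fullP (x : H) : [/\ H1L (val3 x).1.1, L2 (val3 x).1.2 & L2 (val3 x).2].
Proof. exact/full_spaceP/(submodP x). Qed.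

Variables (mu c d M : R).
Hypothesis mu0 : 0 <= mu.
Hypothesis c1 : 1 <= c.
Hypothesis M0 : 0 < M.

(** The stationary solution of the heat equation with Robin condition at 0 and
    unit flux at 1. *)
Definition lift_profile (x : R) : R := (1 + c * x) / c.
Definition wplus (x : R) : R := expR (mu * x).
Definition wminus (x : R) : R := expR (- (mu * x)).

(** The Riemann invariants: for u_tt = u_xx they are transported to the left and
    to the right with unit speed. *)
Definition left_wave Y := Y.1.2 + wderiv Y.1.1.
Definition right_wave Y := Y.1.2 - wderiv Y.1.1.
(** Deviation of p from the stationary heat profile enforced by u(1). *)
Definition heat_dev Y : R -> R := Y.2 - (d * Y.1.1 1) *: lift_profile.

(** A wave travelling to the left loses weight with the factor exp (mu x), and one
    travelling to the right with exp (- mu x); so inside the interval the energy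
    decays at the rate mu, and only the boundary has to be controlled. *)
Definition energy Y Z : R :=
  2^-1 * (wdot wplus (left_wave Y) (left_wave Z)
          + wdot wminus (right_wave Y) (right_wave Z))
  + M * dot (heat_dev Y) (heat_dev Z).

Lemma wplus_derive (x : R) : is_derive x 1 wplus (mu * wplus x).
Proof. by apply: is_derive_eq; rewrite /GRing.scale/= mulr1 mulrC. Qed.

Lemma wminus_derive (x : R) : is_derive x 1 wminus (- mu * wminus x).
Proof. by apply: is_derive_eq; rewrite /GRing.scale/= mulr1 mulrC. Qed.

Lemma wplus_continuous : continuous wplus.
Proof. exact: is_derive_continuous wplus_derive. Qed.

Lemma wminus_continuous : continuous wminus.
Proof. exact: is_derive_continuous wminus_derive. Qed.

Lemma wplus_bounds (x : R) : 0 < x < 1 -> expR (- mu) <= wplus x <= expR mu.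
Proof.
move=> /andP[x0 x1]; rewrite /wplus !ler_expR; apply/andP; split.
  by rewrite (le_trans (_ : _ <= 0)) ?oppr_le0// mulr_ge0// ltW.
by rewrite ler_piMr// ltW.
Qed.

Lemma wminus_bounds (x : R) : 0 < x < 1 -> expR (- mu) <= wminus x <= expR mu.
Proof.
move=> /andP[x0 x1]; rewrite /wminus !ler_expR; apply/andP; split.
  by rewrite lerN2 ler_piMr// ltW.
by rewrite (le_trans (_ : _ <= 0)) ?oppr_le0// mulr_ge0// ltW.
Qed.

Lemma left_wave_L2 Y : full_space Y -> L2 (left_wave Y).
Proof. by move=> /full_spaceP[[/wderiv_L2 u1 _] v2 _]; exact: L2D. Qed.

Lemma right_wave_L2 Y : full_space Y -> L2 (right_wave Y).
Proof. by move=> /full_spaceP[[/wderiv_L2 u1 _] v2 _]; exact: L2B. Qed.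

Lemma lift_profile_AC : abs_cont lift_profile (fun=> 1).
Proof.
have c0 : c != 0 by rewrite gt_eqF// (lt_le_trans ltr01).
apply: AC_smooth => [x|]; last by move=> x; exact: cvg_cst.
apply: (@derive_quadratic _ _ _ _ 0) => s.
by rewrite mul0r mulr1 /lift_profile (_ : _ - _ - _ = 0) ?normr0//; field.
Qed.

Lemma lift_profile_L2 : L2 lift_profile.
Proof. exact: AC_L2 lift_profile_AC. Qed.

Lemma lift_profile_norm : normL2 lift_profile <= 2.
Proof.
have c0 : 0 < c by rewrite (lt_le_trans ltr01).
apply: normL2_le_const => //; first exact: lift_profile_L2.
move=> x /andP[x0 x1]; have cx : c * x <= c by rewrite ler_piMr ?ltW.
have cx0 : 0 <= c * x by rewrite mulr_ge0 ?ltW.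
rewrite /lift_profile ger0_norm ?ler_pdivrMr//; first by move: c1; lra.
by rewrite divr_ge0 ?(ltW c0)// addr_ge0.
Qed.

Lemma heat_dev_L2 Y : full_space Y -> L2 (heat_dev Y).
Proof.
move=> /full_spaceP[_ _ p2]; apply: L2B => //.
exact/L2Z/lift_profile_L2.
Qed.

(** The chosen weak derivative is linear only up to null functions, which the
    energy does not see. *)
Lemma left_wave_lin k Y Z : full_space Y -> full_space Z ->
  let e := left_wave (k *: Y + Z) - (k *: left_wave Y + left_wave Z) in dot e e = 0.
Proof.
move=> /full_spaceP[[u1 _] _ _] /full_spaceP[[u1' _] _ _] /=.
rewrite -(wderiv_eqv (wderiv_lin k u1 u1')).
suff -> : left_wave (k *: Y + Z) - (k *: left_wave Y + left_wave Z) =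
  wderiv (k *: Y.1.1 + Z.1.1) - (k *: wderiv Y.1.1 + wderiv Z.1.1) by [].
rewrite /left_wave -[(k *: Y + Z).1.1]/(k *: Y.1.1 + Z.1.1).
by rewrite -[(k *: Y + Z).1.2]/(k *: Y.1.2 + Z.1.2); lin_eq R.
Qed.

Lemma dotNN (f : R -> R) : dot (- f) (- f) = dot f f.
Proof. by apply: eq_int01 => x _; rewrite -[(- f) x]/(- f x) mulrNN. Qed.

Lemma right_wave_lin k Y Z : full_space Y -> full_space Z ->
  let e := right_wave (k *: Y + Z) - (k *: right_wave Y + right_wave Z) in dot e e = 0.
Proof.
move=> /full_spaceP[[u1 _] _ _] /full_spaceP[[u1' _] _ _] /=.
rewrite -(wderiv_eqv (wderiv_lin k u1 u1')) -[RHS]dotNN.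
suff -> : right_wave (k *: Y + Z) - (k *: right_wave Y + right_wave Z) =
  - (wderiv (k *: Y.1.1 + Z.1.1) - (k *: wderiv Y.1.1 + wderiv Z.1.1)) by [].
rewrite /right_wave -[(k *: Y + Z).1.1]/(k *: Y.1.1 + Z.1.1).
by rewrite -[(k *: Y + Z).1.2]/(k *: Y.1.2 + Z.1.2); lin_eq R.
Qed.

Lemma heat_dev_lin k Y Z : heat_dev (k *: Y + Z) = k *: heat_dev Y + heat_dev Z.
Proof.
rewrite /heat_dev -[(k *: Y + Z).2]/(k *: Y.2 + Z.2).
by rewrite -[(k *: Y + Z).1.1 1]/(k * Y.1.1 1 + Z.1.1 1); lin_eq R.
Qed.

Let energyC (x y : H) : energy (val3 x) (val3 y) = energy (val3 y) (val3 x).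
Proof. by rewrite /energy !(wdotC _ _ (_ (val3 y))) (dotC (heat_dev (val3 x))). Qed.

Let energy_lin k (x y z : H) :
  energy (val3 (k *: x + y)) (val3 z) = k * energy (val3 x) (val3 z) + energy (val3 y) (val3 z).
Proof.
rewrite sm_val_lin /energy.
have Xx := submodP x; have Xy := submodP y; have Xz := submodP z.
have Xxy := full_space_lin k Xx Xy.
have lx := left_wave_L2 Xx; have ly := left_wave_L2 Xy; have lz := left_wave_L2 Xz.
have rx := right_wave_L2 Xx; have ry := right_wave_L2 Xy; have rz := right_wave_L2 Xz.
have hx := heat_dev_L2 Xx; have hy := heat_dev_L2 Xy; have hz := heat_dev_L2 Xz.
rewrite (wdot_eqv wplus_continuous (left_wave_L2 Xxy) (L2_lin k lx ly) lz (left_wave_lin k Xx Xy)).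
rewrite (wdot_eqv wminus_continuous (right_wave_L2 Xxy) (L2_lin k rx ry) rz (right_wave_lin k Xx Xy)).
rewrite (wdot_lin _ wplus_continuous lx ly lz) (wdot_lin _ wminus_continuous rx ry rz).
rewrite heat_dev_lin (dot_lin _ hx hy hz).
move: (wdot wplus (left_wave (val3 x)) _) (wdot wplus (left_wave (val3 y)) _).
move: (wdot wminus (right_wave (val3 x)) _) (wdot wminus (right_wave (val3 y)) _).
move: (dot (heat_dev (val3 x)) _) (dot (heat_dev (val3 y)) _) => a1 a2 b1 b2 e1 e2.
by ring.
Qed.

Let energy_ge0 (x : H) : 0 <= energy (val3 x) (val3 x).
Proof.
rewrite /energy addr_ge0 ?mulr_ge0 ?invr_ge0 ?addr_ge0 ?dot_ge0 ?(ltW M0)//.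
  by apply: wdot_ge0 => s; exact: expR_ge0.
by apply: wdot_ge0 => s; exact: expR_ge0.
Qed.

Definition energy_inner : semi_inner H := SemiInner energyC energy_lin energy_ge0.

Local Notation nm := (snorm energy_inner).

Lemma parallelogram (f g : R -> R) : L2 f -> L2 g ->
  dot (f + g) (f + g) + dot (f - g) (f - g) = 2 * (dot f f + dot g g).
Proof.
move=> f2 g2; have a := L2D f2 g2; have b := L2B f2 g2.
rewrite /dot -int01D; [|exact: L2_mul..].
rewrite -int01D; [|exact: L2_mul..].
rewrite -int01Z; last by apply: L1D; exact: L2_mul.
apply: eq_int01 => x _; rewrite -[(f + g) x]/(f x + g x) -[(f - g) x]/(f x - g x).
by ring.
Qed.

Definition wave_energy Y : R :=
  2^-1 * (wdot wplus (left_wave Y) (left_wave Y) + wdot wminus (right_wave Y) (right_wave Y)).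

Lemma wave_energy_bounds Y : full_space Y ->
  let q := normL2 Y.1.2 ^+ 2 + normL2 (wderiv Y.1.1) ^+ 2 in
  expR (- mu) * q <= wave_energy Y <= expR mu * q.
Proof.
move=> XY /=; have /full_spaceP[[u1 _] v2 _] := XY; have w2 := wderiv_L2 u1.
rewrite !normL2_sqr//.
have /andP[a1 a2] := wdot_bounds wplus_continuous (left_wave_L2 XY) wplus_bounds.
have /andP[b1 b2] := wdot_bounds wminus_continuous (right_wave_L2 XY) wminus_bounds.
have := parallelogram v2 w2; rewrite -/(left_wave Y) -/(right_wave Y) => E.
have E1 := congr1 (fun z => expR (- mu) * z) E; have E2 := congr1 (fun z => expR mu * z) E.
rewrite /= in E1 E2; rewrite /wave_energy.
by move: a1 a2 b1 b2 E1 E2; rewrite !mulrDr => *; apply/andP; split; lra.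
Qed.

Lemma energyE Y : energy Y Y = wave_energy Y + M * dot (heat_dev Y) (heat_dev Y).
Proof. by []. Qed.

Lemma wave_energy_ge0 Y : 0 <= wave_energy Y.
Proof.
rewrite /wave_energy mulr_ge0 ?invr_ge0 ?addr_ge0//.
  by apply: wdot_ge0 => s; exact: expR_ge0.
by apply: wdot_ge0 => s; exact: expR_ge0.
Qed.

Lemma trace_le Y : full_space Y -> `|Y.1.1 1| <= normL2 (wderiv Y.1.1).
Proof.
move=> /full_spaceP[[u1 u0] _ _]; have := AC_bound (wderivP u1) (_ : 0 <= 1 <= 1).
by rewrite lexx ler01 u0 subr0; apply.
Qed.

Lemma normH1_le_wderiv Y : full_space Y -> normH1 Y.1.1 <= 2 * normL2 (wderiv Y.1.1).
Proof.
move=> /full_spaceP[[u1 u0] _ _]; apply: le_trans (normH1_le (wderivP u1)) _.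
by have := normL2_le_deriv (wderivP u1); rewrite u0 normr0; lra.
Qed.

Lemma heat_dev_le Y : full_space Y ->
  normL2 (heat_dev Y) <= normL2 Y.2 + 2 * `|d| * normL2 (wderiv Y.1.1).
Proof.
move=> XY; have /full_spaceP[_ _ p2] := XY; have l2 := lift_profile_L2.
have l2' := L2Z (d * Y.1.1 1) l2.
apply: le_trans (normL2_triangle p2 (L2N l2')) _.
rewrite normL2N// normL2Z// normrM lerD2l.
have h : `|d| * `|Y.1.1 1| * normL2 lift_profile <= `|d| * normL2 (wderiv Y.1.1) * 2.
  by rewrite ler_pM ?mulr_ge0 ?normL2_ge0 ?lift_profile_norm// ler_wpM2l// trace_le.
by apply: le_trans h _; lra.
Qed.

Lemma heat_le_dev Y : full_space Y ->
  normL2 Y.2 <= normL2 (heat_dev Y) + 2 * `|d| * normL2 (wderiv Y.1.1).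
Proof.
move=> XY; have l2' := L2Z (d * Y.1.1 1) lift_profile_L2.
have -> : Y.2 = heat_dev Y + (d * Y.1.1 1) *: lift_profile by rewrite /heat_dev subrK.
apply: le_trans (normL2_triangle (heat_dev_L2 XY) l2') _.
rewrite (normL2Z _ lift_profile_L2) normrM lerD2l.
have h : `|d| * `|Y.1.1 1| * normL2 lift_profile <= `|d| * normL2 (wderiv Y.1.1) * 2.
  by rewrite ler_pM ?mulr_ge0 ?normL2_ge0 ?lift_profile_norm// ler_wpM2l// trace_le.
by apply: le_trans h _; lra.
Qed.

(** The two bounds carry the size of each component separately, since the weight
    [M] of the heat component will be small. *)
Lemma energy_norm_ge (x : H) : let Y := val3 x in
  [/\ normL2 Y.1.2 <= expR (mu / 2) * nm x,
      normL2 (wderiv Y.1.1) <= expR (mu / 2) * nm x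
    & normL2 (heat_dev Y) <= (Num.sqrt M)^-1 * nm x].
Proof.
have XY := submodP x; set Y := val3 x in XY *; rewrite /=.
have /andP[a _] := wave_energy_bounds XY.
have e0 := energyE Y; have sq := snorm_sqr energy_inner x.
rewrite -[energy_inner x x]/(energy Y Y) e0 in sq.
have dd := dot_ge0 (heat_dev Y); have w0 := wave_energy_ge0 Y.
have E : expR mu * expR (- mu) = 1 by rewrite -expRD subrr expR0.
have E2 : expR (mu / 2) ^+ 2 = expR mu by rewrite -expRM_natl; congr expR; field.
have q : normL2 Y.1.2 ^+ 2 + normL2 (wderiv Y.1.1) ^+ 2 <= expR mu * nm x ^+ 2.
  apply: (@le_trans _ _ (expR mu * (expR (- mu) *
      (normL2 Y.1.2 ^+ 2 + normL2 (wderiv Y.1.1) ^+ 2)))).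
    by rewrite mulrA E mul1r.
  by rewrite ler_pM2l ?expR_gt0// (le_trans a)// sq lerDl mulr_ge0// ltW.
have sM : 0 < Num.sqrt M by rewrite sqrtr_gt0.
split.
- apply: le_of_sqr; first by rewrite mulr_ge0 ?expR_ge0 ?snorm_ge0.
  by rewrite exprMn E2 (le_trans _ q)// lerDl sqr_ge0.
- apply: le_of_sqr; first by rewrite mulr_ge0 ?expR_ge0 ?snorm_ge0.
  by rewrite exprMn E2 (le_trans _ q)// lerDr sqr_ge0.
- rewrite ler_pdivlMl//; apply: le_of_sqr; first exact: snorm_ge0.
  by rewrite exprMn sqr_sqrtr ?(ltW M0)// (normL2_sqr (heat_dev_L2 XY)) sq lerDr.
Qed.

Lemma energy_norm_le (x : H) : let Y := val3 x in
  nm x <= expR (mu / 2) * (normL2 Y.1.2 + normL2 (wderiv Y.1.1))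
          + Num.sqrt M * normL2 (heat_dev Y).
Proof.
have XY := submodP x; set Y := val3 x in XY *; rewrite /=.
have /andP[_ b] := wave_energy_bounds XY.
have sq := snorm_sqr energy_inner x.
rewrite -[energy_inner x x]/(energy Y Y) energyE in sq.
have E2 : expR (mu / 2) ^+ 2 = expR mu by rewrite -expRM_natl; congr expR; field.
have sM : 0 <= Num.sqrt M by rewrite sqrtr_ge0.
apply: le_of_sqr.
  by rewrite addr_ge0 ?mulr_ge0 ?addr_ge0 ?expR_ge0 ?normL2_ge0.
rewrite sq sqrrD !exprMn E2 sqr_sqrtr ?(ltW M0)// (normL2_sqr (heat_dev_L2 XY)).
have n1 := normL2_ge0 Y.1.2; have n2 := normL2_ge0 (wderiv Y.1.1).
have n3 := normL2_ge0 (heat_dev Y).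
have : 0 <= expR (mu / 2) * (normL2 Y.1.2 + normL2 (wderiv Y.1.1)) *
  (Num.sqrt M * normL2 (heat_dev Y)).
  by rewrite !mulr_ge0 ?addr_ge0 ?expR_ge0.
have : expR mu * (normL2 Y.1.2 ^+ 2 + normL2 (wderiv Y.1.1) ^+ 2) <=
   expR mu * (normL2 Y.1.2 + normL2 (wderiv Y.1.1)) ^+ 2.
  rewrite ler_pM2l ?expR_gt0// sqrrD; have := mulr_ge0 n1 n2; lra.
by move: b; rewrite /=; lra.
Qed.

Lemma full_norm_ge0 Y : 0 <= full_norm Y.
Proof. by case: Y => [[u v] p]; rewrite /= !addr_ge0 ?normH1_ge0 ?normL2_ge0. Qed.

Lemma full_normE Y : full_norm Y = normH1 Y.1.1 + normL2 Y.1.2 + normL2 Y.2.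
Proof. by case: Y => [[u v] p]. Qed.

Lemma full_norm_le_energy : exists C, forall x : H, full_norm (val3 x) <= C * nm x.
Proof.
exists (2 * expR (mu / 2) + expR (mu / 2) + ((Num.sqrt M)^-1 + 2 * `|d| * expR (mu / 2))).
move=> x; have [a b e] := energy_norm_ge x; have XY := submodP x.
have f := normH1_le_wderiv XY; have g := heat_le_dev XY.
have h : 2 * `|d| * normL2 (wderiv (val3 x).1.1) <= 2 * `|d| * (expR (mu / 2) * nm x).
  by rewrite ler_wpM2l// mulr_ge0.
by rewrite full_normE; lra.
Qed.

Lemma energy_le_full_norm : exists C, forall x : H, nm x <= C * full_norm (val3 x).
Proof.
exists (expR (mu / 2) + Num.sqrt M * (1 + 2 * `|d|)) => x.
have XY := submodP x; have [[u1 _] v2 p2] := fullP x.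
apply: le_trans (energy_norm_le x) _; rewrite full_normE.
set Y := val3 x in XY u1 v2 p2 *.
have a := normL2_deriv_le_normH1 (wderivP u1).
have n1 := normL2_ge0 Y.1.2; have n2 := normL2_ge0 Y.2; have n3 := normL2_ge0 (wderiv Y.1.1).
have n4 := normH1_ge0 Y.1.1.
have b : expR (mu / 2) * (normL2 Y.1.2 + normL2 (wderiv Y.1.1)) <=
    expR (mu / 2) * (normH1 Y.1.1 + normL2 Y.1.2 + normL2 Y.2).
  by rewrite ler_wpM2l ?expR_ge0//; lra.
have e : Num.sqrt M * normL2 (heat_dev Y) <=
    Num.sqrt M * ((1 + 2 * `|d|) * (normH1 Y.1.1 + normL2 Y.1.2 + normL2 Y.2)).
  rewrite ler_wpM2l ?sqrtr_ge0// (le_trans (heat_dev_le XY))//.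
  have : 2 * `|d| * normL2 (wderiv Y.1.1) <= 2 * `|d| * (normH1 Y.1.1 + normL2 Y.1.2 + normL2 Y.2).
    by rewrite ler_wpM2l ?mulr_ge0//; lra.
  by lra.
by move: b e; lra.
Qed.

Lemma cauchy_dominated (y : nat -> H) (a : nat -> nat -> R) C : scauchy energy_inner y ->
  (forall m n, a m n <= C * nm (y m - y n)) ->
  forall e, 0 < e -> exists N, forall m n, (N <= m)%N -> (N <= n)%N -> a m n <= e.
Proof.
move=> cy aC e e0; have C0 : 0 < `|C| + 1 by rewrite ltr_wpDl.
have [|N NP] := cy (e / (`|C| + 1)); first by rewrite divr_gt0.
exists N => m n Nm Nn; apply: le_trans (aC m n) _.
have := NP _ _ Nm Nn; rewrite ler_pdivlMr// => h; apply: le_trans h.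
by rewrite mulrC ler_wpM2l ?snorm_ge0// (le_trans (ler_norm C))// lerDl.
Qed.

(** The limit of the first component is rebuilt from the limit of its derivatives,
    with the value 0 at 0. *)
Lemma energy_complete : scomplete energy_inner.
Proof.
move=> y cy; have [C1 C1P] := full_norm_le_energy; have [C2 C2P] := energy_le_full_norm.
pose Y n := val3 (y n); have XY n : full_space (Y n) := submodP (y n).
have [v [v2 vP]] : exists f, L2 f /\ forall e, 0 < e -> exists N, forall n, (N <= n)%N ->
    normL2 ((Y n).1.2 - f) <= e.
  apply: L2_complete; first by move=> n; case/full_spaceP: (XY n).
  apply: (cauchy_dominated (C := expR (mu / 2)) cy) => m n.
  by have [h _ _] := energy_norm_ge (y m - y n).
have [w [w2 wP]] : exists f, L2 f /\ forall e, 0 < e -> exists N, forall n, (N <= n)%N ->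
    normL2 (wderiv (Y n).1.1 - f) <= e.
  apply: L2_complete; first by move=> n; case/full_spaceP: (XY n) => -[/wderiv_L2].
  apply: (cauchy_dominated (C := expR (mu / 2)) cy) => m n.
  have [_ + _] := energy_norm_ge (y m - y n).
  have /full_spaceP[[um _] _ _] := XY m; have /full_spaceP[[un _] _ _] := XY n.
  have h := normL2_wderiv (AC_sub (wderivP um) (wderivP un)).
  by rewrite -[wderiv (val3 _).1.1]/(wderiv (fun x => (Y m).1.1 x - (Y n).1.1 x)) h.
have [p [p2 pP]] : exists f, L2 f /\ forall e, 0 < e -> exists N, forall n, (N <= n)%N ->
    normL2 ((Y n).2 - f) <= e.
  apply: L2_complete; first by move=> n; case/full_spaceP: (XY n).
  apply: (cauchy_dominated (C := C1) cy) => m n.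
  apply: le_trans (C1P (y m - y n)); rewrite full_normE.
  by rewrite lerDr addr_ge0 ?normH1_ge0 ?normL2_ge0.
have Xz : full_space (prim w, v, p).
  by split => //; split; [exact: AC_H1 (AC_prim w2)|exact: prim0].
exists (submod_in (S := full_submod) Xz); apply/scvgP => e e0.
have C0 : 0 < `|C2| + 1 by rewrite ltr_wpDl.
have ep : 0 < e / (`|C2| + 1) / 4 by rewrite !divr_gt0.
have [N1 h1] := vP _ ep; have [N2 h2] := wP _ ep; have [N3 h3] := pP _ ep.
exists (maxn N1 (maxn N2 N3)) => n; rewrite !geq_max => /and3P[/h1 {}h1 /h2 {}h2 /h3 {}h3].
set z := submod_in _; apply: le_trans (C2P (y n - z)) _.
have h4 : full_norm (val3 (y n - z)) <= e / (`|C2| + 1).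
  rewrite full_normE -[(val3 _).1.2]/((Y n).1.2 - v) -[(val3 _).2]/((Y n).2 - p).
  have := normH1_le_wderiv (submodP (y n - z)).
  have /full_spaceP[[un _] _ _] := XY n.
  have -> : normL2 (wderiv (val3 (y n - z)).1.1) = normL2 (wderiv (Y n).1.1 - w).
    exact: (normL2_wderiv (AC_sub (wderivP un) (AC_prim w2))).
  by move: h1 h2 h3; lra.
apply: le_trans (_ : (`|C2| + 1) * full_norm (val3 (y n - z)) <= _).
  by rewrite ler_wpM2r ?full_norm_ge0// (le_trans (ler_norm C2))// lerDl.
by rewrite mulrC -ler_pdivlMr.
Qed.

End EnergySpace.

(** * Linear second order equations *)

Section Hyperbolic.
Variable R : realType.
Implicit Types (x k : R).

Lemma sinh_derive k x : is_derive x 1 (fun y => sinh (k * y)) (k * cosh (k * x)).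
Proof.
apply: is_derive_eq; rewrite /GRing.scale/= /cosh.
by field.
Qed.

Lemma cosh_derive k x : is_derive x 1 (fun y => cosh (k * y)) (k * sinh (k * x)).
Proof.
apply: is_derive_eq; rewrite /GRing.scale/= /sinh.
by field.
Qed.

Lemma sinh_continuous k : continuous (fun y : R => sinh (k * y)).
Proof. exact: is_derive_continuous (sinh_derive k). Qed.

Lemma cosh_continuous k : continuous (fun y : R => cosh (k * y)).
Proof. exact: is_derive_continuous (cosh_derive k). Qed.

Lemma cosh_sinh x : cosh x ^+ 2 - sinh x ^+ 2 = 1.
Proof.
transitivity (expR x * expR (- x)); first by rewrite /cosh /sinh; field.
by rewrite -expRD subrr expR0.
Qed.

Lemma cosh_ge1 x : 1 <= cosh x.
Proof.
have a := expR_ge1Dx x; have b := expR_ge1Dx (- x); rewrite /cosh.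
by move: a b; lra.
Qed.

Lemma sinh_ge0 x : 0 <= x -> 0 <= sinh x.
Proof. by move=> x0; rewrite /sinh divr_ge0// subr_ge0 ler_expR; lra. Qed.

Lemma sinh_gt0 x : 0 < x -> 0 < sinh x.
Proof. by move=> x0; rewrite /sinh divr_gt0// subr_gt0 ltr_expR; lra. Qed.

Lemma sinh0 : sinh 0 = 0 :> R.
Proof. by rewrite /sinh oppr0 subrr mul0r. Qed.

Lemma cosh0 : cosh 0 = 1 :> R.
Proof. by rewrite /cosh oppr0 expR0; field. Qed.

Lemma AC_sinh k : abs_cont (fun x => sinh (k * x)) (fun x => k * cosh (k * x)).
Proof.
apply: AC_smooth; first exact: sinh_derive.
by move=> x; apply: cvgM; [exact: cvg_cst|exact: cosh_continuous].
Qed.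

Lemma AC_cosh k : abs_cont (fun x => cosh (k * x)) (fun x => k * sinh (k * x)).
Proof.
apply: AC_smooth; first exact: cosh_derive.
by move=> x; apply: cvgM; [exact: cvg_cst|exact: sinh_continuous].
Qed.

Lemma sinh_le k : 0 <= k -> sinh k <= k * cosh k.
Proof.
move=> k0; have := AC_int (AC_sinh k); rewrite mulr1 mulr0 sinh0 subr0 => <-.
rewrite -[leRHS](@int01_cst R); apply: int01_le.
- exact/L2_L1/AC_deriv_L2/AC_sinh.
- exact: L1_cst.
move=> x /andP[x0 x1]; rewrite ler_wpM2l//.
have kx0 : 0 <= k * x by rewrite mulr_ge0// ltW.
have kx : k * x <= k by rewrite ler_piMr// ltW.
have h : sinh (k * x) <= sinh k by rewrite /sinh ler_pM2r ?invr_gt0// lerB ?ler_expR// lerN2.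
have := cosh_sinh (k * x); have := cosh_sinh k.
have a := cosh_ge1 (k * x); have b := cosh_ge1 k.
have s0 := sinh_ge0 kx0; move=> e1 e2; apply: le_of_sqr; first by lra.
have : sinh (k * x) ^+ 2 <= sinh k ^+ 2 by apply: lerXn2r; rewrite ?nnegrE// (le_trans s0).
by lra.
Qed.

(** Variation of constants for y'' = k^2 y - F with zero initial data. *)
Lemma ode_particular k (F : R -> R) : k != 0 -> L2 F ->
  exists y y1, [/\ abs_cont y y1, abs_cont y1 (fun x => k ^+ 2 * y x - F x),
    y 0 = 0 & y1 0 = 0].
Proof.
move=> k0 F2; have S := AC_sinh k; have C := AC_cosh k.
have CF2 : L2 (fun x => cosh (k * x) * F x).
  by apply: L2_continuous_mul => //; exact: AC_continuous C.
have SF2 : L2 (fun x => sinh (k * x) * F x).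
  by apply: L2_continuous_mul => //; exact: AC_continuous S.
have I1 := AC_prim CF2; have I2 := AC_prim SF2.
set i1 := prim (fun x => cosh (k * x) * F x) in I1.
set i2 := prim (fun x => sinh (k * x) * F x) in I2.
exists (fun x => - k^-1 * (sinh (k * x) * i1 x - cosh (k * x) * i2 x)).
exists (fun x => -1 * (cosh (k * x) * i1 x - sinh (k * x) * i2 x)); split.
- apply: eq_AC (AC_scale (- k^-1) (AC_sub (AC_mul S I1) (AC_mul C I2))) => // x _.
  by move: (i1 x) (i2 x) (sinh _) (cosh _) (F x) => p q s c f; field.
- apply: eq_AC (AC_scale (-1) (AC_sub (AC_mul C I1) (AC_mul S I2))) => // x _.
  have := cosh_sinh (k * x).
  move: (i1 x) (i2 x) (sinh _) (cosh _) (F x) => p q s c f cs.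
  transitivity (- k * (s * p - c * q) - (c ^+ 2 - s ^+ 2) * f); first by ring.
  by rewrite cs; field.
- by rewrite /i1 /i2 !prim0; ring.
- by rewrite /i1 /i2 !prim0; ring.
Qed.

End Hyperbolic.

(** * Energy fluxes at the boundary *)

Section WaveFlux.
Variable R : realType.
Implicit Types (u v r w : R -> R).

(** The derivative of w r^2 / 2, integrated. *)
Lemma weighted_ibp w r r' (nu : R) : (forall x : R, is_derive x 1 w (nu * w x)) ->
  abs_cont r r' ->
  wdot w r r' = 2^-1 * (w 1 * r 1 ^+ 2 - w 0 * r 0 ^+ 2) - nu / 2 * wdot w r r.
Proof.
move=> dw ar; have cw := is_derive_continuous dw.
have cw' : continuous (fun x => nu * w x).
  by move=> x; apply: cvgM; [exact: cvg_cst|exact: cw].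
have aw := AC_smooth dw cw'; have r2 := AC_L2 ar; have r2' := AC_deriv_L2 ar.
have := AC_int (AC_mul aw (AC_mul ar ar)) => /= E.
have wr := L2_mul r2 (L2_weight cw r2); have wr' := L2_mul r2 (L2_weight cw r2').
have : nu * wdot w r r + 2 * wdot w r r' = w 1 * (r 1 * r 1) - w 0 * (r 0 * r 0).
  rewrite -E /wdot /dot -(int01Z nu wr) -(int01Z 2 wr') -(int01D (L1Z nu wr) (L1Z 2 wr')).
  by apply: eq_int01 => x _; ring.
by rewrite !expr2; move: (wdot w r r) (wdot w r r') => p q; lra.
Qed.

Lemma heat_flux (q q1 q2 : R -> R) (c : R) : abs_cont q q1 -> abs_cont q1 q2 ->
  q1 0 = c * q 0 -> q1 1 = 0 -> dot q q2 = - (c * q 0 ^+ 2) - dot q1 q1.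
Proof.
move=> a1 a2 b0 b1; have := AC_int (AC_mul a1 a2); rewrite b0 b1 mulr0 => E.
have l1 := L2_mul (AC_deriv_L2 a1) (AC_L2 a2); have l2 := L2_mul (AC_L2 a1) (AC_deriv_L2 a2).
move: E; rewrite int01D// -/(dot q q2) -/(dot q1 q1).
by move: (dot q q2) (dot q1 q1) => p r; lra.
Qed.

End WaveFlux.

(** The first square is at most 3/2 of [((1 - a) v)^2] plus 3 G^2, up to Young's
    inequality, and the second at least 3/4 of [((1 + a) v)^2] minus 3 G^2; the gap
    between the two coefficients leaves 1/16 of the latter square. *)
Lemma boundary_flux_le (R : realType) (E e a v G : R) : 0 < E -> 0 < e ->
  E * (1 - a) ^+ 2 <= e * (1 + a) ^+ 2 / 3 ->
  4^-1 * (E * ((1 - a) * v + G) ^+ 2 - e * ((1 + a) * v - G) ^+ 2) <=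
  - (e * (1 + a) ^+ 2 / 16 * v ^+ 2) + 3 / 4 * (E + e) * G ^+ 2.
Proof.
move=> E0 e0 h.
have h1 := mulr_ge0 (ltW E0) (sqr_ge0 ((1 - a) * v - 2 * G)).
have h2 := mulr_ge0 (ltW e0) (sqr_ge0 ((1 + a) * v - 4 * G)).
have h3 := ler_wpM2r (sqr_ge0 v) h.
by move: h1 h2 h3; lra.
Qed.

Lemma dotZ (R : realType) (k : R) (f h : R -> R) : L2 f -> L2 h ->
  dot (k *: f) h = k * dot f h.
Proof.
move=> f2 h2; rewrite /dot -(int01Z k (L2_mul f2 h2)); apply: eq_int01 => x _.
by rewrite -[(k *: f) x]/(k * f x) mulrA.
Qed.

Lemma AC_lincomb (R : realType) (l : R) (y y1 s s1 : R -> R) : abs_cont y y1 -> abs_cont s s1 ->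
  abs_cont (fun x => l * s x + y x) (fun x => l * s1 x + y1 x).
Proof. by move=> ay az; exact: (AC_add (AC_scale l az) ay). Qed.

(** cosh(kx) + (c/k) sinh(kx); its slope at 1 is bounded below, so that a flux at 1
    can be prescribed. *)
Lemma robin_solution (R : realType) (k c : R) : 0 < k -> 0 <= c ->
  exists q q1 : R -> R, [/\ abs_cont q q1, abs_cont q1 (fun x => k ^+ 2 * q x),
    q 0 = 1, q1 0 = c & c <= q1 1].
Proof.
move=> k0 c0; have kN : k != 0 by rewrite gt_eqF.
exists (fun x => cosh (k * x) + c / k * sinh (k * x)).
exists (fun x => k * sinh (k * x) + c * cosh (k * x)); split.
- apply: eq_AC (AC_lincomb (c / k) (AC_cosh k) (AC_sinh k)) => x _; first by ring.
  by field.
- apply: eq_AC (AC_lincomb c (AC_scale k (AC_sinh k)) (AC_cosh k)) => x _; first by ring.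
  by field.
- by rewrite !mulr0 sinh0 cosh0 mulr0 addr0.
- by rewrite !mulr0 sinh0 cosh0 mulr0 add0r mulr1.
rewrite mulr1; have := mulr_ge0 (ltW k0) (sinh_ge0 (ltW k0)).
by have := ler_wpM2l c0 (cosh_ge1 k); lra.
Qed.

(** * The coupled operator *)

Section CoupledOperator.
Variable R : realType.
Local Notation V3 := ((R -> R) * (R -> R) * (R -> R))%type.
Implicit Types (Y Z W : V3).

Lemma H2_withP (u ux uxx : R -> R) :
  H2_with u ux uxx <-> abs_cont u ux /\ abs_cont ux uxx.
Proof.
split=> [[[cu _] [cux _] w1 w2]|[a1 a2]].
  by split; apply: weak_derivative_AC.
by split; [exact: AC_H1 a1|exact: AC_H1 a2|exact: AC_weak_derivative..].
Qed.

(** All three systems at once. The feedback k u(1) at the right end is added to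
    the one by b p(0): k = 0 gives the full system; b = d = 0 with k the stationary
    gain bd/c gives the reduced system next to a free heat equation; and with the
    wave at rest what is left is the boundary layer. *)
Definition coupled_operator (eps a k b c d : R) Y W : Prop :=
  exists ux uxx px pxx : R -> R,
  [/\ [/\ abs_cont Y.1.1 ux, abs_cont ux uxx, abs_cont Y.2 px & abs_cont px pxx],
      Y.1.1 0 = 0 /\ H1L Y.1.2,
      ux 1 = - a * Y.1.2 1 + k * Y.1.1 1 + b * Y.2 0,
      px 0 = c * Y.2 0 /\ px 1 = d * Y.1.1 1
    & W = (Y.1.2, uxx, eps^-1 *: pxx)].

Variables (eps a k b c d : R).
Local Notation A := (coupled_operator eps a k b c d).

Lemma coupled_operator_space Y W : A Y W -> full_space Y /\ full_space W.
Proof.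
move=> [ux [uxx [px [pxx [[u1 u2 p1 p2] [u0 v1] _ _ ->]]]]]; split; apply/full_spaceP.
  split; [by split => //; exact: AC_H1 u1|exact: H1_L2 v1.1|exact: AC_L2 p1].
by split => //; [exact: AC_deriv_L2 u2|exact/L2Z/(AC_deriv_L2 p2)].
Qed.

Lemma coupled_operator_lin l Y W Z X : A Y W -> A Z X -> A (l *: Y + Z) (l *: W + X).
Proof.
move=> [ux [uxx [px [pxx [[u1 u2 p1 p2] [u0 v1] bu [b0 b1] ->]]]]].
move=> [ux' [uxx' [px' [pxx' [[u1' u2' p1' p2'] [u0' v1'] bu' [b0' b1'] ->]]]]].
exists (l *: ux + ux'), (l *: uxx + uxx'), (l *: px + px'), (l *: pxx + pxx').
split.
- by split; [exact: (AC_lin l u1 u1')|exact: (AC_lin l u2 u2')|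
    exact: (AC_lin l p1 p1')|exact: (AC_lin l p2 p2')].
- split; last exact: (H1L_lin l v1 v1').
  by rewrite -[LHS]/(l * Y.1.1 0 + Z.1.1 0) u0 u0' mulr0 addr0.
- rewrite -[LHS]/(l * ux 1 + ux' 1) bu bu' -[(_ + Z).1.2 1]/(l * Y.1.2 1 + Z.1.2 1).
  rewrite -[(_ + Z).1.1 1]/(l * Y.1.1 1 + Z.1.1 1) -[(_ + Z).2 0]/(l * Y.2 0 + Z.2 0).
  by ring.
- rewrite -[(_ + px') 0]/(l * px 0 + px' 0) -[(_ + px') 1]/(l * px 1 + px' 1).
  rewrite -[(_ + Z).1.1 1]/(l * Y.1.1 1 + Z.1.1 1) -[(_ + Z).2 0]/(l * Y.2 0 + Z.2 0).
  by rewrite b0 b1 b0' b1'; split; ring.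
have -> : eps^-1 *: (l *: pxx + pxx') = l *: (eps^-1 *: pxx) + eps^-1 *: pxx'.
  by rewrite scalerDr !scalerA mulrC.
by [].
Qed.

Variables (mu om : R).
(** The boundary of the wave produces at most 3 cosh(mu) b^2 q^2, with q the
    deviation of p(0) from the stationary value. This weight makes it less than
    half of the Robin dissipation; the other half is left for decay. *)
Definition heat_weight : R := 6 * cosh mu * b ^+ 2 + 1.
Local Notation kap := heat_weight.
Hypothesis mu0 : 0 < mu.
Hypothesis c1 : 1 <= c.
Hypothesis eps0 : 0 < eps.

Lemma heat_weight_ge1 : 1 <= kap.
Proof.
rewrite /heat_weight lerDr mulr_ge0 ?sqr_ge0// mulr_ge0//.
exact: le_trans ler01 (cosh_ge1 mu).
Qed.

Lemma energy_weight_gt0 : 0 < kap * eps.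
Proof. by rewrite mulr_gt0// (lt_le_trans ltr01 heat_weight_ge1). Qed.

Local Notation H := (submod_type (full_submod R)).
Definition coupled_inner : semi_inner H := energy_inner mu d c1 energy_weight_gt0.
Local Notation nm := (snorm coupled_inner).
Definition coupled_graph (x w : H) : Prop := A (sm_val x) (sm_val w).

(** The time derivative of the weighted wave energy: decay at the rate mu inside,
    plus the boundary flux at 1. The fluxes at 0 cancel because v(0) = 0. *)
Lemma wave_flux (u ux uxx v g : R -> R) :
  abs_cont u ux -> abs_cont ux uxx -> abs_cont v g -> v 0 = 0 ->
  2^-1 * (wdot (wplus mu) (v + ux) (uxx + g) + wdot (wminus mu) (v - ux) (uxx - g)) =
  4^-1 * (expR mu * (v 1 + ux 1) ^+ 2 - expR (- mu) * (v 1 - ux 1) ^+ 2)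
  - mu / 2 * (2^-1 * (wdot (wplus mu) (v + ux) (v + ux)
                     + wdot (wminus mu) (v - ux) (v - ux))).
Proof.
move=> au aux av v0.
have ar : abs_cont (v + ux) (uxx + g).
  by apply: eq_AC (AC_add av aux) => // x _; rewrite addrC.
have as' := AC_sub av aux.
have := weighted_ibp (wplus_derive mu) ar.
have := weighted_ibp (wminus_derive mu) as'.
have -> : wdot (wminus mu) (v - ux) (uxx - g) =
    - wdot (wminus mu) (v - ux) (fun x => g x - uxx x).
  have l := L2_mul (AC_L2 as') (L2_weight (wminus_continuous (mu := mu)) (AC_deriv_L2 as')).
  have E := int01Z (-1) l; rewrite mulN1r in E.
  rewrite -[RHS]E; apply: eq_int01 => x _.
  by rewrite -[(uxx - g) x]/(uxx x - g x) -[(v - ux) x]/(v x - ux x); ring.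
rewrite -[(v + ux) 1]/(v 1 + ux 1) -[(v + ux) 0]/(v 0 + ux 0) v0.
have -> : wplus mu 1 = expR mu by rewrite /wplus mulr1.
have -> : wplus mu 0 = 1 by rewrite /wplus mulr0 expR0.
have -> : wminus mu 1 = expR (- mu) by rewrite /wminus mulr1.
have -> : wminus mu 0 = 1 by rewrite /wminus mulr0 oppr0 expR0.
rewrite -[fun x => v x - ux x]/(v - ux).
move: (wdot _ (v + ux) (uxx + g)) (wdot _ (v + ux) (v + ux)) => p1 p2.
move: (wdot _ (v - ux) (fun _ => _)) (wdot _ (v - ux) (v - ux)) => q1 q2.
by move=> -> ->; field.
Qed.

(** The heat component is not p itself but its deviation from the profile that
    u(1) enforces. The deviation satisfies homogeneous boundary conditions; in
    return its evolution contains u_t(1), with a factor of order eps thanks to the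
    weight, which is why the coupling is harmless for small eps. *)
Lemma coupled_energy_identity Y W ux uxx px pxx :
  [/\ abs_cont Y.1.1 ux, abs_cont ux uxx, abs_cont Y.2 px & abs_cont px pxx] ->
  Y.1.1 0 = 0 /\ H1L Y.1.2 -> px 0 = c * Y.2 0 /\ px 1 = d * Y.1.1 1 ->
  W = (Y.1.2, uxx, eps^-1 *: pxx) ->
  let q := Y.2 0 - d * Y.1.1 1 / c in
  let q1 := fun x => px x - d * Y.1.1 1 in
  [/\ abs_cont (heat_dev c d Y) q1,
      heat_dev c d Y 0 = q
    & energy mu c d (kap * eps) Y W =
  4^-1 * (expR mu * (Y.1.2 1 + ux 1) ^+ 2 - expR (- mu) * (Y.1.2 1 - ux 1) ^+ 2)
  - mu / 2 * wave_energy mu Y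
  + kap * (- (c * q ^+ 2) - dot q1 q1)
  - kap * eps * d * Y.1.2 1 * dot (heat_dev c d Y) (lift_profile c)].
Proof.
move=> [u1 u2 p1 p2] [u0 [v1 v0]] [b0 b1] WE q q1.
have XY : full_space Y.
  apply/full_spaceP; split; [by split => //; exact: AC_H1 u1|exact: H1_L2 v1|exact: AC_L2 p1].
have c0 : c != 0 by rewrite gt_eqF// (lt_le_trans ltr01).
have lp := lift_profile_AC c1; have lp2 := lift_profile_L2 c1.
have aq : abs_cont (heat_dev c d Y) q1.
  apply: eq_AC (AC_sub p1 (AC_scale (d * Y.1.1 1) lp)) => // x _.
  by rewrite mulr1.
have q0E : heat_dev c d Y 0 = q.
  by rewrite /heat_dev -[LHS]/(Y.2 0 - (d * Y.1.1 1) * lift_profile c 0) /lift_profile /q mulr0 addr0 mul1r.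
have aq1 : abs_cont q1 pxx.
  by apply: eq_AC (AC_sub p2 (AC_cst (d * Y.1.1 1))) => // x _; rewrite subr0.
split => //; rewrite /energy {}WE.
have gv := wderivP v1.
have v2 := H1_L2 v1; have ux2 := AC_L2 u2; have uxx2 := AC_deriv_L2 u2; have g2 := AC_deriv_L2 gv.
have dl := wderiv_eqv u1.
have lE : dot (left_wave Y - (Y.1.2 + ux)) (left_wave Y - (Y.1.2 + ux)) = 0.
  rewrite -[RHS]dl; suff -> : left_wave Y - (Y.1.2 + ux) = wderiv Y.1.1 - ux by [].
  by rewrite /left_wave; lin_eq R.
have rE : dot (right_wave Y - (Y.1.2 - ux)) (right_wave Y - (Y.1.2 - ux)) = 0.
  rewrite -[RHS]dl -[RHS]dotNN.
  suff -> : right_wave Y - (Y.1.2 - ux) = - (wderiv Y.1.1 - ux) by [].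
  by rewrite /right_wave; lin_eq R.
have lY := left_wave_L2 XY; have rY := right_wave_L2 XY.
have l2 := L2D v2 ux2; have r2 := L2B v2 ux2.
have cp := wplus_continuous (mu := mu); have cm := wminus_continuous (mu := mu).
have weE : wave_energy mu Y = 2^-1 * (wdot (wplus mu) (Y.1.2 + ux) (Y.1.2 + ux)
     + wdot (wminus mu) (Y.1.2 - ux) (Y.1.2 - ux)).
  rewrite /wave_energy (wdot_eqv cp lY l2 lY lE) (wdot_eqv cm rY r2 rY rE).
  rewrite (wdotC _ _ (left_wave Y)) (wdotC _ _ (right_wave Y)).
  by rewrite (wdot_eqv cp lY l2 l2 lE) (wdot_eqv cm rY r2 r2 rE).
have flux := wave_flux u1 u2 gv v0.
rewrite -[left_wave (_, uxx, _)]/(uxx + wderiv Y.1.2) -[right_wave (_, uxx, _)]/(uxx - wderiv Y.1.2).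
rewrite (wdot_eqv cp lY l2 (L2D uxx2 g2) lE) (wdot_eqv cm rY r2 (L2B uxx2 g2) rE).
rewrite flux -weE.
have hf : dot (heat_dev c d Y) pxx = - (c * q ^+ 2) - dot q1 q1.
  rewrite -q0E; apply: (heat_flux aq aq1).
    by rewrite q0E /q1 b0 /q; field.
  by rewrite /q1 b1 subrr.
have hd2 := AC_L2 aq; have pxx2 := AC_deriv_L2 p2.
have -> : dot (heat_dev c d Y) (heat_dev c d (Y.1.2, uxx, eps^-1 *: pxx)) =
   eps^-1 * dot (heat_dev c d Y) pxx - d * Y.1.2 1 * dot (heat_dev c d Y) (lift_profile c).
  have e2 := L2Z eps^-1 pxx2; have l2' := L2Z (d * Y.1.2 1) lp2.
  rewrite dotC -[heat_dev c d (_, uxx, _)]/(eps^-1 *: pxx - (d * Y.1.2 1) *: lift_profile c).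
  by rewrite (dot_subl e2 l2' hd2) !dotZ// ![dot (heat_dev c d Y) _]dotC.
rewrite hf; move: (dot q1 q1) (dot _ (lift_profile c)) (wave_energy mu Y) => z1 z2 z3.
by field; rewrite gt_eqF.
Qed.

Hypothesis ha : expR mu * (1 - a) ^+ 2 <= expR (- mu) * (1 + a) ^+ 2 / 3.
Hypothesis hk : 3 * cosh mu * (k + b * d / c) ^+ 2 <= 3 / 10 * mu * expR (- mu).
Hypothesis heps : 128 * kap * d ^+ 2 * eps ^+ 2 <= expR (- mu) * (1 + a) ^+ 2.
Hypothesis om_mu : om <= mu / 5.
Hypothesis om_eps : 8 * om * eps <= 1.

(** At the boundary, u_x(1) = - a v(1) + G, where G collects the stationary
    feedback (k + bd/c) u(1) and b q, with q the deviation at 0. The gap [ha] makes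
    the flux negative in v(1) up to G^2 ([boundary_flux_le]); the part of G^2 with
    u(1) is absorbed by the interior decay of the wave thanks to [hk], the part
    with q by the Robin dissipation of the heat equation thanks to [heat_weight],
    and the term with u_t(1) by the boundary damping and the dissipation of the
    heat equation together, thanks to [heps]. *)
Lemma coupled_graph_dissipative : dissipative coupled_inner om coupled_graph.
Proof.
split=> [l x w y v|x w]; first exact: coupled_operator_lin.
move=> Axw; have [XY XW] := coupled_operator_space Axw.
have [ux [uxx [px [pxx [as_ [u0 v0] bu bp WE]]]]] := Axw.
have [aq q0E id] := coupled_energy_identity as_ (conj u0 v0) bp WE.
set Y := sm_val x in XY u0 v0 bu bp as_ aq q0E id *.
rewrite -[coupled_inner x w]/(energy mu c d (kap * eps) Y (sm_val w)) id.
rewrite -[coupled_inner x x]/(energy mu c d (kap * eps) Y Y) energyE.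
have /andP[we _] := wave_energy_bounds (ltW mu0) XY.
have tr := trace_le XY.
have hd2 := heat_dev_L2 d c1 XY; have lp2 := lift_profile_L2 c1.
have Ib := dot_cs hd2 lp2; have lpn := lift_profile_norm c1.
have pc := normL2_le_deriv aq; rewrite q0E in pc.
have q12 := AC_deriv_L2 aq.
have P0 := normL2_sqr hd2; have P1 := normL2_sqr q12.
set hd := heat_dev c d Y in id hd2 Ib pc P0 *.
set q := Y.2 0 - d * Y.1.1 1 / c in id pc q0E aq q12 P1 *.
set q1 := (fun x => px x - d * Y.1.1 1) in id pc aq q12 P1 *.
have ch : expR mu + expR (- mu) = 2 * cosh mu by rewrite /cosh; field.
have c0 : c != 0 by rewrite gt_eqF// (lt_le_trans ltr01).
pose G := (k + b * d / c) * Y.1.1 1 + b * q.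
have GE1 : Y.1.2 1 + ux 1 = (1 - a) * Y.1.2 1 + G by rewrite bu /G /q; field.
have GE2 : Y.1.2 1 - ux 1 = (1 + a) * Y.1.2 1 - G by rewrite bu /G /q; field.
rewrite GE1 GE2.
have f1 := boundary_flux_le (Y.1.2 1) G (expR_gt0 mu) (expR_gt0 (- mu)) ha.
have e0 := expR_gt0 (- mu); have kap1 := heat_weight_ge1.
have n0 := normL2_ge0 (wderiv Y.1.1); have n1 := normL2_ge0 hd.
have n2 := normL2_ge0 q1; have n3 := normL2_ge0 (lift_profile c).
have f3 : expR (- mu) * Y.1.1 1 ^+ 2 <= wave_energy mu Y.
  apply: le_trans we; rewrite ler_pM2l// -real_normK ?num_real//.
  apply: le_trans (_ : normL2 (wderiv Y.1.1) ^+ 2 <= _); last by rewrite lerDr sqr_ge0.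
  by apply: lerXn2r; rewrite ?nnegrE.
have f5 : dot hd hd <= 2 * q ^+ 2 + 2 * dot q1 q1.
  rewrite -P0 -P1; apply: le_trans (_ : (`|q| + normL2 q1) ^+ 2 <= _).
    by apply: lerXn2r; rewrite ?nnegrE// (le_trans n1).
  rewrite -[q ^+ 2]real_normK ?num_real//.
  by have := sqr_ge0 (`|q| - normL2 q1); lra.
have f6 : dot hd (lift_profile c) ^+ 2 <= 4 * dot hd hd.
  rewrite -P0 -real_normK ?num_real//; apply: le_trans (_ : (normL2 hd * 2) ^+ 2 <= _).
    apply: lerXn2r; rewrite ?nnegrE ?mulr_ge0// (le_trans Ib)//.
    by rewrite ler_wpM2l.
  by rewrite exprMn; lra.
have P0' := dot_ge0 hd; have P1' := dot_ge0 q1.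
have W0 := wave_energy_ge0 mu Y.
move: f1 f3 f5 f6 P0' P1' W0 om_mu om_eps heps hk kap1 mu0; rewrite ch /G.
have kE : kap = 6 * cosh mu * b ^+ 2 + 1 by [].
have ch1 := cosh_ge1 mu.
move: kE ch1 {G GE1 GE2 we tr Ib lpn pc P0 P1 n0 n1 n2 n3 id aq q12 hd2 q0E}.
move: (dot hd hd) (dot hd (lift_profile c)) (dot q1 q1) (wave_energy mu Y) kap => P I P' We K.
move: (Y.1.2 1) (Y.1.1 1) q (k + b * d / c) (cosh mu) (expR (- mu)) (expR mu) e0 c1.
move=> v1 u1 q kh ch_ e E e0 c1' kE ch1 f1 f3 f5 f6 P0 P1 W0 omu oeps he hk_ kap1 mu0_.
(* g1 to g3: the square G^2 and its two parts; g4: the term with u_t(1); g5: the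
   energy to be dominated *)
have g1 : 3 / 2 * ch_ * (kh * u1 + b * q) ^+ 2 <= 3 * ch_ * kh ^+ 2 * u1 ^+ 2 + 3 * ch_ * b ^+ 2 * q ^+ 2.
  have := mulr_ge0 (le_trans ler01 ch1) (sqr_ge0 (kh * u1 - b * q)); lra.
have g2 : 3 * ch_ * kh ^+ 2 * u1 ^+ 2 <= 3 / 10 * mu * We.
  apply: le_trans (ler_wpM2r (sqr_ge0 u1) hk_) _.
  have := ler_wpM2l (_ : 0 <= 3 / 10 * mu) f3; rewrite mulrA; apply.
  by rewrite mulr_ge0// ltW.
have g3 : K * (- (c * q ^+ 2) - P') + 3 * ch_ * b ^+ 2 * q ^+ 2 <= - (K / 4 * P).
  have K0 : 0 <= K by rewrite (le_trans ler01).
  have h1 := ler_wpM2l K0 f5.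
  have h2 := ler_wpM2r (sqr_ge0 q) c1'; have h3 := ler_wpM2l K0 h2.
  have h4 := mulr_ge0 K0 P1; have h5 := sqr_ge0 q.
  have h6 : 3 * ch_ * b ^+ 2 * q ^+ 2 = (K / 2 - 2^-1) * q ^+ 2 by rewrite kE; field.
  by rewrite h6; move: h1 h3 h4 h5; lra.
have g4 : - (K * eps * d * v1 * I) <= K / 8 * P + e * (1 + a) ^+ 2 / 16 * v1 ^+ 2.
  have K0 : 0 <= K by rewrite (le_trans ler01).
  have h1 := mulr_ge0 K0 (sqr_ge0 (I + 16 * (eps * d * v1))).
  have h2 := ler_wpM2r (sqr_ge0 v1) he; have h3 := ler_wpM2l K0 f6.
  by move: h1 h2 h3; lra.
have g5 : om * (We + K * eps * P) <= mu / 5 * We + K / 8 * P.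
  have h1 := ler_wpM2r W0 omu.
  have K0 : 0 <= K * P by rewrite mulr_ge0// (le_trans ler01).
  have := ler_wpM2r K0 oeps; move: h1; lra.
by move: f1 g1 g2 g3 g4 g5; lra.
Qed.

Lemma coupled_graph_null x w : coupled_graph x w -> nm x = 0 -> nm w = 0.
Proof.
move=> Axw x0; have [XY XW] := coupled_operator_space Axw.
have [ux [uxx [px [pxx [[u1 u2 p1 p2] [u0 [v1 v0]] _ _ WE]]]]] := Axw.
have [nv nd nh] := energy_norm_ge d (ltW mu0) c1 energy_weight_gt0 x.
rewrite -/coupled_inner x0 !mulr0 in nv nd nh.
have z (f : R -> R) : L2 f -> normL2 f <= 0 -> dot f f = 0.
  by move=> f2 f0; apply/normL2_eq0 => //; apply/eqP; rewrite eq_le f0 normL2_ge0.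
have vz := z _ (H1_L2 v1) nv.
have [vz' gz] := AC_null (wderivP v1) vz.
have ux0 : dot ux ux = 0.
  apply: z; first exact: AC_L2 u2.
  by rewrite -(normL2_wderiv u1).
have [_ uxx0] := AC_null u2 ux0.
have p0 : dot (sm_val x).2 (sm_val x).2 = 0.
  apply: z; first exact: AC_L2 p1.
  apply: le_trans (heat_le_dev d c1 XY) _.
  have := ler_wpM2l (_ : 0 <= 2 * `|d|) nd; rewrite mulr0 => h.
  by move: nh (h (mulr_ge0 (ler0n _ 2) (normr_ge0 d))); lra.
have [_ px0] := AC_null p1 p0; have [_ pxx0] := AC_null p2 px0.
apply/eqP; rewrite eq_le snorm_ge0 andbT.
apply: le_trans (energy_norm_le d (ltW mu0) c1 energy_weight_gt0 w) _.
have n1 : normL2 (sm_val w).1.2 = 0 by rewrite WE; apply/normL2_eq0 => //; exact: AC_deriv_L2 u2.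
have n2 : normL2 (wderiv (sm_val w).1.1) = 0.
  by rewrite WE; apply/normL2_eq0 => //; exact: wderiv_L2.
have n3 : normL2 (sm_val w).2 = 0.
  rewrite WE /= normL2Z; last exact: AC_deriv_L2 p2.
  have -> : normL2 pxx = 0 by apply/normL2_eq0 => //; exact: AC_deriv_L2 p2.
  by rewrite mulr0.
have := heat_dev_le d c1 XW; rewrite n3 n2 mulr0 addr0 => h.
rewrite n1 addr0 mulr0 add0r.
by rewrite (le_trans (ler_wpM2l _ h)) ?mulr0 ?sqrtr_ge0.
Qed.

Hypothesis a0 : 0 < a.
Hypothesis hkbd : `|k| + `|b * d| / c <= 1.

Lemma cramer (m q s t r1 r2 : R) : m * q - s * t != 0 ->
  exists al be, al * m = r1 + s * be /\ be * q = r2 + t * al.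
Proof.
move=> D; exists ((r1 * q + s * r2) / (m * q - s * t)), ((m * r2 + t * r1) / (m * q - s * t)).
by split; field.
Qed.

(** The resolvent equation is a pair of linear second order equations. Particular
    solutions from [ode_particular], corrected by multiples of the homogeneous
    solutions that satisfy the conditions at 0, leave a two by two system for the
    conditions at 1. It is solvable since [|k| + |bd|/c <= 1], sinh(la) <= la cosh(la)
    and a > 0. *)
Lemma coupled_graph_range h f : 0 < h -> exists y, coupled_graph y (h^-1 *: (y - f)).
Proof.
move=> h0; have [[f1H f10] f22 f32] := fullP f.
set f1 := (sm_val f).1.1 in f1H f10; set f2 := (sm_val f).1.2 in f22; set f3 := (sm_val f).2 in f32.
pose la := h^-1; have la0 : 0 < la by rewrite invr_gt0.
pose kp := Num.sqrt (eps * la).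
have kp0 : 0 < kp by rewrite sqrtr_gt0 mulr_gt0.
have kp2 : kp ^+ 2 = eps * la by rewrite sqr_sqrtr// mulr_ge0// ltW.
have c0 : 0 < c by rewrite (lt_le_trans ltr01).
have laN : la != 0 by rewrite gt_eqF.
have kpN : kp != 0 by rewrite gt_eqF.
have F2 : L2 (la ^+ 2 *: f1 + la *: f2) by apply: L2_lin; [exact: H1_L2|exact: L2Z].
have [up [up1 [aup aup1 up0 up10]]] := ode_particular laN F2.
have [pp [pp1 [app app1 pp0 pp10]]] := ode_particular kpN (L2Z (eps * la) f32).
pose S1 := sinh la; pose C1 := cosh la.
have [Q [Q1 [aQ aQ1 Q0 Q10 Q11]]] := robin_solution kp0 (ltW c0).
have aS := AC_sinh la; have aC := AC_scale la (AC_cosh la).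
have S10 : 0 < S1 by exact: sinh_gt0.
have SC : S1 <= la * C1 by apply: sinh_le; exact: ltW.
pose m := la * C1 + a * la * S1 - k * S1.
have kb : k + `|b * d| / c <= 1.
  by apply: le_trans hkbd; rewrite lerD2r ler_norm.
have bdn : 0 <= `|b * d| / c by rewrite divr_ge0// ltW.
have alS : 0 < a * la * S1 := mulr_gt0 (mulr_gt0 a0 la0) S10.
have kS : k * S1 <= S1 - `|b * d| / c * S1.
  by have := ler_wpM2r (ltW S10) kb; lra.
have bS : 0 <= `|b * d| / c * S1 by rewrite mulr_ge0// ltW.
have m0 : `|b * d| / c * S1 < m by rewrite /m; lra.
have det0 : 0 < m * Q1 1 - b * d * S1.
  have h1 : c * (`|b * d| / c * S1) < c * m by rewrite ltr_pM2l.
  have h2 : c * m <= Q1 1 * m by rewrite ler_wpM2r// (le_trans bS)// ltW.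
  have h3 : b * d * S1 <= `|b * d| * S1 by rewrite ler_wpM2r ?ler_norm// ltW.
  have h4 : c * (`|b * d| / c * S1) = `|b * d| * S1 by field; rewrite gt_eqF.
  by lra.
pose r1 := - up1 1 - a * la * (up 1 - f1 1) + k * up 1 + b * pp 0.
pose r2 := d * up 1 - pp1 1.
have [al [be [eq1 eq2]]] : exists al be, al * m = r1 + b * be /\ be * Q1 1 = r2 + d * S1 * al.
  by apply: cramer; rewrite mulrA gt_eqF.
pose u x := al * sinh (la * x) + up x.
pose ux x := al * (la * cosh (la * x)) + up1 x.
pose p x := be * Q x + pp x.
pose px x := be * Q1 x + pp1 x.
pose v : R -> R := la *: (u - f1).
pose uxx : R -> R := la *: (v - f2).
pose pxx : R -> R := eps *: (la *: (p - f3)).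
have au : abs_cont u ux := AC_lincomb al aup aS.
have aux : abs_cont ux uxx.
  apply: eq_AC (AC_lincomb al aup1 aC) => // x _.
  rewrite /uxx /v -[(la *: _) x]/(la * (la * (u x - f1 x) - f2 x)).
  by rewrite -[(_ + _ : R -> R) x]/(la ^+ 2 * f1 x + la * f2 x) /u; ring.
have ap : abs_cont p px := AC_lincomb be app aQ.
have apx : abs_cont px pxx.
  apply: eq_AC (AC_lincomb be app1 aQ1) => // x _.
  rewrite /pxx -[(eps *: _) x]/(eps * (la * (p x - f3 x))).
  by rewrite -[((eps * la) *: _) x]/(eps * la * f3 x) kp2 /p; ring.
have u0 : u 0 = 0 by rewrite /u mulr0 sinh0 mulr0 up0 addr0.
have uH : H1L u by split => //; exact: AC_H1 au.
have vH : H1L v.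
  have := H1L_lin la uH (H1L_lin (- la) (conj f1H f10) (H1L_0 R)).
  by rewrite /v (_ : _ + _ = la *: (u - f1))//; lin_eq R.
have XY : full_space (u, v, p) by split => //; [exact: H1_L2 vH.1|exact: AC_L2 ap].
exists (submod_in (S := full_submod R) XY); exists ux, uxx, px, pxx.
split => //.
- rewrite -[LHS]/(al * (la * cosh (la * 1)) + up1 1) mulr1.
  rewrite -[RHS]/(- a * (la * (u 1 - f1 1)) + k * u 1 + b * (be * Q 0 + pp 0)).
  rewrite Q0.
  have -> : u 1 = al * S1 + up 1 by rewrite /u mulr1.
  rewrite -/C1;  move: eq1; rewrite /m /r1; lra.
- split.
    rewrite -[RHS]/(c * (be * Q 0 + pp 0)) -[LHS]/(be * Q1 0 + pp1 0) pp0 pp10.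
    by rewrite Q0 Q10; ring.
  rewrite -[LHS]/(be * Q1 1 + pp1 1) -[RHS]/(d * u 1).
  have -> : u 1 = al * S1 + up 1 by rewrite /u mulr1.
  by move: eq2; rewrite /r2; lra.
have -> : eps^-1 *: pxx = la *: (p - f3).
  by rewrite /pxx scalerA mulVf ?scale1r// gt_eqF.
have fE : sm_val f = (f1, f2, f3) by rewrite /f1 /f2 /f3; case: (sm_val f) => [[]].
by rewrite -[LHS]/(la *: ((u, v, p) - sm_val f)) [X in _ - X]fE.
Qed.

Theorem coupled_graph_maximal : maximal_dissipative coupled_inner om coupled_graph.
Proof.
split; [exact: coupled_graph_dissipative|exact: coupled_graph_null|].
by move=> h f; exact: coupled_graph_range.
Qed.

End CoupledOperator.

Lemma real_complete (R : realType) (u : nat -> R) :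
  (forall e : R, 0 < e -> exists N, forall m n, (N <= m)%N -> (N <= n)%N -> `|u m - u n| <= e) ->
  exists l, forall e : R, 0 < e -> exists N, forall n, (N <= n)%N -> `|u n - l| <= e.
Proof.
move=> cu; have /cvgrPdist_le lu : cvg (u @ \oo).
  apply/cauchy_cvgP/cauchy_ballP => e e0.
  have [|N NP] := cu (e / 2); first by rewrite divr_gt0.
  exists (u @` [set n | (N <= n)%N], u @` [set n | (N <= n)%N]).
    by split; exists N => // n Nn; exists n.
  move=> [_ _] /= [[m Nm <-] [n Nn <-]]; rewrite /ball/= (le_lt_trans (NP _ _ Nm Nn))//.
  by rewrite ltr_pdivrMr//; lra.
exists (lim (u @ \oo)) => e /lu[N _ NP]; exists N => n Nn.
by rewrite distrC; exact: NP.
Qed.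

(** * The boundary layer in the Sobolev space *)

Section Layer.
Variables (R : realType) (c : R).
Hypothesis c1 : 1 <= c.
Implicit Types (p r w : R -> R).

Definition H1_submod : submodule (R -> R) := Submodule (H1_0 R) (@H1_lin R).
Local Notation W := (submod_type H1_submod).
Local Notation val1 := (@sm_val _ _ H1_submod).
Let c0 : 0 < c. Proof. exact: lt_le_trans c1. Qed.

(** The form of the layer operator itself: an integration by parts turns the
    product of p with p'' into - |p''|^2. It dominates the Sobolev norm, so the
    evolution is continuous for that norm. *)
Definition layer_form p r : R := dot (wderiv p) (wderiv r) + c * p 0 * r 0.

Lemma layer_formC p r : layer_form p r = layer_form r p.
Proof. by rewrite /layer_form dotC -!mulrA (mulrC (p 0)). Qed.

Lemma layer_formE p p1 : abs_cont p p1 -> layer_form p p = normL2 p1 ^+ 2 + c * p 0 ^+ 2.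
Proof.
move=> ap; rewrite /layer_form -normL2_sqr; last exact/wderiv_L2/(AC_H1 ap).
by rewrite (normL2_wderiv ap) -mulrA -expr2.
Qed.

Lemma layer_form_lin k p r s : H1 p -> H1 r -> H1 s ->
  layer_form (k *: p + r) s = k * layer_form p s + layer_form r s.
Proof.
move=> pH rH sH; have p2 := wderiv_L2 pH; have r2 := wderiv_L2 rH; have s2 := wderiv_L2 sH.
rewrite /layer_form (dot_wderiv (wderiv_lin k pH rH) s2) (dot_lin k p2 r2 s2).
rewrite -[(k *: p + r) 0]/(k * p 0 + r 0).
by move: (dot (wderiv p) _) (dot (wderiv r) _) (p 0) (r 0) (s 0) => A B x y z; ring.
Qed.

Lemma layer_form_ge0 p : H1 p -> 0 <= layer_form p p.
Proof.
move=> /wderivP ap; rewrite (layer_formE ap) addr_ge0 ?sqr_ge0// mulr_ge0 ?sqr_ge0//.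
exact: ltW.
Qed.

Definition layer_inner : semi_inner W := @SemiInner R W
  (fun x y => layer_form (val1 x) (val1 y))
  (fun x y => layer_formC _ _)
  (fun k x y z => layer_form_lin k (submodP x) (submodP y) (submodP z))
  (fun x => layer_form_ge0 (submodP x)).
Local Notation nm := (snorm layer_inner).

Lemma layer_norm_ge (x : W) :
  `|val1 x 0| <= nm x /\ normL2 (wderiv (val1 x)) <= nm x.
Proof.
have ax := wderivP (submodP x); have sq := snorm_sqr layer_inner x.
rewrite -[layer_inner x x]/(layer_form (val1 x) (val1 x)) (layer_formE ax) in sq.
have h := ler_wpM2r (sqr_ge0 (val1 x 0)) c1; have h1 := sqr_ge0 (normL2 (wderiv (val1 x))).
have h2 := sqr_ge0 (val1 x 0); split; apply: le_of_sqr (snorm_ge0 _ _) _; rewrite sq.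
  by rewrite real_normK ?num_real//; lra.
by lra.
Qed.

Lemma layer_norm_le (x : W) : nm x <= normL2 (wderiv (val1 x)) + c * `|val1 x 0|.
Proof.
have ax := wderivP (submodP x); have sq := snorm_sqr layer_inner x.
rewrite -[layer_inner x x]/(layer_form (val1 x) (val1 x)) (layer_formE ax) in sq.
have n0 := normL2_ge0 (wderiv (val1 x)); have z0 := normr_ge0 (val1 x 0).
apply: le_of_sqr; first by rewrite addr_ge0// mulr_ge0// ltW.
rewrite sq -[val1 x 0 ^+ 2]real_normK ?num_real//.
have h1 := mulr_ge0 (mulr_ge0 (ltW c0) n0) z0.
have h2 := ler_wpM2l (mulr_ge0 (ltW c0) (sqr_ge0 `|val1 x 0|)) c1.
by move: h1 h2; move: `|_| (normL2 _) => z n; lra.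
Qed.

Lemma trace0_le p : H1 p -> `|p 0| <= 2 * normH1 p.
Proof.
move=> /wderivP ap; have := normL2_le_deriv (AC_sub ap (AC_cst (p 0))).
rewrite subrr normr0 add0r => h.
have p2 := AC_L2 ap; have ac := AC_sub ap (AC_cst (p 0)).
have -> : `|p 0| = normL2 (fun=> p 0) by rewrite normL2_cst.
have -> : (fun=> p 0) = p + - (fun x => p x - p 0).
  by apply/funext => x; rewrite -[RHS]/(p x - (p x - p 0)); ring.
apply: le_trans (normL2_triangle p2 (L2N (AC_L2 ac))) _.
rewrite (normL2N (AC_L2 ac)).
have := normL2_le_normH1 p; have := normL2_deriv_le_normH1 ap.
have -> : normL2 (wderiv p) = normL2 (fun x => wderiv p x - 0).
  by congr normL2; apply/funext => x; rewrite subr0.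
by move: h; lra.
Qed.

Lemma normH1_le_layer (x : W) : normH1 (val1 x) <= 3 * nm x.
Proof.
have ax := wderivP (submodP x); have [h1 h2] := layer_norm_ge x.
by have := normH1_le ax; have := normL2_le_deriv ax; lra.
Qed.

Lemma normL2_le_layer (x : W) : normL2 (val1 x) <= 2 * nm x.
Proof.
have ax := wderivP (submodP x); have [h1 h2] := layer_norm_ge x.
by have := normL2_le_deriv ax; lra.
Qed.

Lemma layer_le_normH1 (x : W) : nm x <= (1 + 2 * c) * normH1 (val1 x).
Proof.
have := normL2_deriv_le_normH1 (wderivP (submodP x)).
have := ler_wpM2l (ltW c0) (trace0_le (submodP x)).
by have := layer_norm_le x; lra.
Qed.

Lemma layer_complete : scomplete layer_inner.
Proof.
move=> y cy; pose p n := val1 (y n); have ap n := wderivP (submodP (y n)).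
have [l lP] : exists l, forall e : R, 0 < e -> exists N, forall n, (N <= n)%N -> `|p n 0 - l| <= e.
  apply: real_complete => e /cy[N NP]; exists N => m n Nm Nn.
  by have [h _] := layer_norm_ge (y m - y n); rewrite (le_trans h)// NP.
have [w [w2 wP]] : exists f, L2 f /\ forall e : R, 0 < e -> exists N, forall n, (N <= n)%N ->
    normL2 (wderiv (p n) - f) <= e.
  apply: L2_complete; first by move=> n; exact: AC_deriv_L2 (ap n).
  move=> e /cy[N NP]; exists N => m n Nm Nn.
  have [_ h] := layer_norm_ge (y m - y n); apply: le_trans (NP _ _ Nm Nn); apply: le_trans h.
  rewrite -[val1 (y m - y n)]/(fun x => p m x - p n x).
  by rewrite (normL2_wderiv (AC_sub (ap m) (ap n))).
have az : abs_cont (fun x => l + prim w x) w.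
  by apply: eq_AC (AC_add (AC_cst l) (AC_prim w2)) => // x _; rewrite add0r.
exists (submod_in (S := H1_submod) (AC_H1 az)); apply/scvgP => e e0.
have e20 : 0 < e / 2 by rewrite divr_gt0.
have ec : 0 < e / 2 / c by rewrite divr_gt0.
have [N1 h1] := lP _ ec; have [N2 h2] := wP _ e20.
exists (maxn N1 N2) => n; rewrite geq_max => /andP[/h1 {}h1 /h2 {}h2].
set z := submod_in _; apply: le_trans (layer_norm_le (y n - z)) _.
rewrite -[val1 (y n - z)]/(fun x => p n x - (l + prim w x)).
rewrite (normL2_wderiv (AC_sub (ap n) az)) prim0 addr0.
by move: h1 h2; rewrite ler_pdivlMr// [_ * c]mulrC; rewrite -[wderiv (p n) - w]/(fun x => wderiv (p n) x - w x); lra.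
Qed.

Lemma layer_operatorP p w : layer_operator c p w <->
  exists px, [/\ abs_cont p px, abs_cont px w, px 0 = c * p 0 & px 1 = 0].
Proof.
split=> -[px].
  by move=> [/H2_withP[? ?] ? ?]; exists px.
by move=> [? ? ? ?]; exists px; split => //; apply/H2_withP.
Qed.

Lemma layer_operator_lin k p w r s : layer_operator c p w -> layer_operator c r s ->
  layer_operator c (k *: p + r) (k *: w + s).
Proof.
move=> /layer_operatorP[px [p1 p2 p0 px1]] /layer_operatorP[rx [r1 r2 r0 rx1]].
apply/layer_operatorP; exists (k *: px + rx).
split; [exact: AC_lin|exact: AC_lin| |].
  rewrite -[LHS]/(k * px 0 + rx 0) -[(k *: p + r) 0]/(k * p 0 + r 0) p0 r0; ring.
by rewrite -[LHS]/(k * px 1 + rx 1) px1 rx1; ring.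
Qed.

Definition layer_graph (x w : W) : Prop := layer_operator c (val1 x) (val1 w).

(** Both -|p''|^2 = form(p, p'') and form(p, p) <= |p| |p''| hold, and |p| is at most
    twice the norm of the form: so that norm is at most 2 |p''|, whence the rate. *)
Theorem layer_maximal : maximal_dissipative layer_inner 4^-1 layer_graph.
Proof.
split; first split.
- by move=> k x w y v; exact: layer_operator_lin.
- move=> x w /layer_operatorP[px [a1 a2 b0 b1]].
  have aw := wderivP (submodP w); have w2 := AC_L2 aw; have p2 := AC_L2 a1.
  rewrite -[layer_inner x w]/(layer_form (val1 x) (val1 w)).
  rewrite -[layer_inner x x]/(layer_form (val1 x) (val1 x)).
  have E1 : layer_form (val1 x) (val1 w) = - normL2 (val1 w) ^+ 2.
    rewrite /layer_form (dot_wderiv a1 (AC_deriv_L2 aw)) -b0 (normL2_sqr w2).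
    have := AC_int (AC_mul a2 aw); rewrite b1 mul0r => E.
    have l1 := L2_mul w2 w2; have l2 := L2_mul (AC_L2 a2) (AC_deriv_L2 aw).
    move: E; rewrite int01D// -/(dot (val1 w) (val1 w)) -/(dot px (wderiv (val1 w))).
    by move: (dot _ _) (dot _ _) => q r; lra.
  have E2 : layer_form (val1 x) (val1 x) <= normL2 (val1 x) * normL2 (val1 w).
    have := dot_cs p2 w2; rewrite ler_norml => /andP[+ _].
    rewrite (heat_flux a1 a2 b0 b1) (layer_formE a1) (normL2_sqr (AC_deriv_L2 a1)).
    by lra.
  have E3 := normL2_le_layer x; have E4 := snorm_sqr layer_inner x.
  rewrite -[layer_inner x x]/(layer_form (val1 x) (val1 x)) in E4.
  rewrite E1 -E4; rewrite -E4 in E2; have n0 := snorm_ge0 layer_inner x.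
  have n1 := normL2_ge0 (val1 w).
  have E5 := ler_wpM2r n1 E3.
  have E6 : nm x <= 2 * normL2 (val1 w).
    have [x0|x0] := eqVneq (nm x) 0; first by rewrite x0 mulr_ge0.
    have xp : 0 < nm x by rewrite lt0r x0.
    by rewrite -(ler_pM2l xp); lra.
  have E7 : nm x * nm x <= nm x * (2 * normL2 (val1 w)) by rewrite ler_wpM2l.
  have E8 : 2 * normL2 (val1 w) * nm x <= 2 * normL2 (val1 w) * (2 * normL2 (val1 w)).
    by rewrite ler_wpM2l// mulr_ge0.
  by rewrite !expr2; lra.
- move=> x w /layer_operatorP[px [a1 a2 b0 b1]] x0; have [h1 h2] := layer_norm_ge x.
  rewrite x0 in h1 h2.
  have px0 : dot px px = 0.
    apply/normL2_eq0; first exact: AC_deriv_L2 a1.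
    by apply/eqP; rewrite eq_le normL2_ge0 andbT -(normL2_wderiv a1).
  have [_ w0] := AC_null a2 px0; have aw := wderivP (submodP w).
  have [w0' w1] := AC_null aw w0.
  apply/eqP; rewrite eq_le snorm_ge0 andbT (le_trans (layer_norm_le w))//.
  rewrite w0' ?lexx ?ler01// normr0 mulr0 addr0.
  by have -> : normL2 (wderiv (val1 w)) = 0 by apply/normL2_eq0 => //; exact: AC_deriv_L2 aw.
move=> h f h0; have fH := submodP f; pose la := h^-1; have la0 : 0 < la by rewrite invr_gt0.
pose kp := Num.sqrt la; have kp0 : 0 < kp by rewrite sqrtr_gt0.
have kp2 : kp ^+ 2 = la by rewrite sqr_sqrtr// ltW.
have kpN : kp != 0 by rewrite gt_eqF.
have [pp [pp1 [app app1 pp0 pp10]]] := ode_particular kpN (L2Z la (H1_L2 fH)).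
have [Q [Q1 [aQ aQ1 Q0 Q10 Q11]]] := robin_solution kp0 (ltW c0).
pose be := - pp1 1 / Q1 1.
have QN : Q1 1 != 0 by rewrite gt_eqF// (lt_le_trans c0).
have ap := AC_lincomb be app aQ; have ap1 := AC_lincomb be app1 aQ1.
exists (submod_in (S := H1_submod) (AC_H1 ap)); apply/layer_operatorP.
eexists; split; first exact: ap.
- apply: eq_AC ap1 => // x _.
  rewrite -[RHS]/(la * (be * Q x + pp x - val1 f x)) -[(la *: _) x]/(la * val1 f x) kp2.
  by ring.
- by rewrite -[RHS]/(c * (be * Q 0 + pp 0)) pp0 pp10 Q0 Q10; ring.
by rewrite /be; field.
Qed.

End Layer.

(** * Solutions of the coupled problem *)

Lemma mild_subgraph (R : realType) (V : lmodType R) (X : V -> Prop) (N : V -> R)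
    (A A' : V -> V -> Prop) Y0 Y : (forall x w, A x w -> A' x w) ->
  mild_solution X N A Y0 Y -> mild_solution X N A' Y0 Y.
Proof.
move=> AA' [h1 h2 h3 h4]; split => // t /h4[Z [W [? /AA' ? ?]]]; by exists Z, W.
Qed.

(** With z and w the values of a time integral and u + z, u + w close to x, y. *)
Lemma difference_quotient (R : realType) (V : lmodType R) (h : R) (x y u z w v : V) :
  h != 0 -> h^-1 *: (x - y) - v =
    h^-1 *: ((z - w - h *: v) + ((x - (u + z)) - (y - (u + w)))).
Proof. by move=> h0; lin_eq R. Qed.

(** A mild solution is differentiable in the components that the operator maps
    to components of the state: there the increments of the solution are those
    of the time integral. *)
Lemma mild_component_derivative (R : realType) (H : lmodType R) (ip : semi_inner H)
    (A : H -> H -> Prop) (U V : H -> R -> R) (C : R) X Y0 Y :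
  (forall k x y, U (k *: x + y) = k *: U x + U y) ->
  (forall k x y, V (k *: x + y) = k *: V x + V y) ->
  (forall x, L2 (U x)) -> (forall x, L2 (V x)) ->
  (forall x, normL2 (U x) <= C * snorm ip x) ->
  (forall x, normL2 (V x) <= C * snorm ip x) ->
  (forall x w, A x w -> U w = V x) ->
  mild_solution X (snorm ip) A Y0 Y ->
  L2_time_derivative (fun t => U (Y t)) (fun t => V (Y t)).
Proof.
move=> Ul Vl U2 V2 UC VC AUV mY; have [Z [W ZW]] := mild_primitive mY.
case: mY => _ _ cY _ t t0.
have IZ s : 0 <= s -> is_time_integral (snorm ip) Y s (Z s) by move=> /ZW[].
have UB x y : U (x - y) = U x - U y by rewrite addrC -scaleN1r Ul scaleN1r addrC.
have UD x y : U (x + y) = U x + U y by rewrite -[x]scale1r Ul !scale1r.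
have VB x y : V (x - y) = V x - V y by rewrite addrC -scaleN1r Vl scaleN1r addrC.
have VBZ x (l : R) y : V (x - l *: y) = V x - l *: V y.
  by rewrite addrC -scaleNr Vl scaleNr addrC.
have fP s : 0 <= s -> exists f : R -> R, [/\ f = U (Y s) - (U (Y 0) + V (Z s)), L2 f & normL2 f = 0].
  move=> s0; have [_ /AUV WV h] := ZW _ s0; exists (U (Y s - (Y 0 + W s))); split => //.
    by rewrite UB UD WV.
  by have := UC (Y s - (Y 0 + W s)); rewrite h mulr0 => h'; apply/eqP; rewrite eq_le h' normL2_ge0.
apply/cvgrPdist_le => e ep.
have C0 : 0 < `|C| + 1 by rewrite ltr_wpDl.
have ee : 0 < e / (`|C| + 1) by rewrite divr_gt0.
have [dl dl0 dlP] := time_integral_deriv cY IZ t0 ee.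
apply/nbhs_ballP; exists dl => //= h; rewrite /ball/= sub0r normrN => hd hN th.
have h0 : h != 0 by [].
rewrite sub0r normrN ger0_norm ?normL2_ge0//.
have := dlP _ th; rewrite addrAC subrr add0r => /(_ hd) hZ.
have [f1 [f1E l1 n1]] := fP _ th; have [f2 [f2E l2 n2]] := fP _ t0.
have [z [zE z2 h1]] : exists z : R -> R, [/\ z = V (Z (t + h)) - V (Z t) - h *: V (Y t),
     L2 z & normL2 z <= C * snorm ip (Z (t + h) - Z t - h *: Y t)].
  by exists (V (Z (t + h) - Z t - h *: Y t)); split => //; rewrite VBZ VB.
rewrite (difference_quotient _ _ (U (Y 0)) (V (Z (t + h))) (V (Z t)) _ h0) -zE -f1E -f2E.
rewrite (normL2Z _ (L2D z2 (L2B l1 l2))) normrV ?unitfE// ler_pdivrMl ?normr_gt0//.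
apply: le_trans (normL2_triangle z2 (L2B l1 l2)) _.
have := normL2_triangle l1 (L2N l2); rewrite (normL2N l2) n1 n2 addr0 => h2.
have n0 := snorm_ge0 ip (Z (t + h) - Z t - h *: Y t).
have h3 : C * snorm ip (Z (t + h) - Z t - h *: Y t) <= (`|C| + 1) * (e / (`|C| + 1) * `|h|).
  apply: le_trans (_ : (`|C| + 1) * snorm ip (Z (t + h) - Z t - h *: Y t) <= _).
    by rewrite ler_wpM2r// (le_trans (ler_norm C))// lerDl.
  by rewrite ler_wpM2l// ltW.
have h4 : (`|C| + 1) * (e / (`|C| + 1) * `|h|) = `|h| * e by field; rewrite gt_eqF.
by move: h1 h2 h3; rewrite h4; lra.
Qed.

Section CoupledSolution.
Variable R : realType.
Local Notation V3 := ((R -> R) * (R -> R) * (R -> R))%type.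
Local Notation H := (submod_type (full_submod R)).
Variables (eps a k b c d mu om : R).
Hypothesis mu0 : 0 < mu.
Hypothesis c1 : 1 <= c.
Hypothesis eps0 : 0 < eps.
Hypothesis ha : expR mu * (1 - a) ^+ 2 <= expR (- mu) * (1 + a) ^+ 2 / 3.
Hypothesis hk : 3 * cosh mu * (k + b * d / c) ^+ 2 <= 3 / 10 * mu * expR (- mu).
Hypothesis heps : 128 * heat_weight b mu * d ^+ 2 * eps ^+ 2 <= expR (- mu) * (1 + a) ^+ 2.
Hypothesis om0 : 0 <= om.
Hypothesis om_mu : om <= mu / 5.
Hypothesis om_eps : 8 * om * eps <= 1.
Local Notation A := (coupled_operator eps a k b c d).
Local Notation ip := (coupled_inner b d mu c1 eps0).
Local Notation nm := (snorm ip).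
Local Notation G := (coupled_graph eps a k b c d).

Lemma coupled_dissipative : dissipative ip om G.
Proof. exact: coupled_graph_dissipative. Qed.

(** Solutions in the sense of the Sobolev norm are solutions for the energy, which
    is an equivalent norm. *)
Lemma coupled_lift Y0 (Y : R -> V3) : full_space Y0 ->
  mild_solution (@full_space R) (@full_norm R) A Y0 Y ->
  mild_solution (fun=> True) nm G (submod_inj (full_submod R) Y0)
    (fun t => submod_inj (full_submod R) (Y t)).
Proof.
have [C CP] := energy_le_full_norm d (ltW mu0) c1 (energy_weight_gt0 b mu eps0).
apply: (transport_mild (C := C) (full_space0 R) (@full_space_lin R)) => //.
- move=> l x y Xx Xy; apply: submod_eq; rewrite sm_val_lin !submod_injK//.
  exact: full_space_lin.
- by move=> x Xx; have := CP (submod_inj (full_submod R) x); rewrite submod_injK.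
- by move=> x; exact: snorm_ge0.
move=> x w Axw; have [Xx Xw] := coupled_operator_space Axw; split => //.
by rewrite /coupled_graph !submod_injK.
Qed.

Lemma coupled_unique Y0 (Y Y' : R -> V3) : full_space Y0 ->
  mild_solution (@full_space R) (@full_norm R) A Y0 Y ->
  mild_solution (@full_space R) (@full_norm R) A Y0 Y' ->
  forall t, 0 <= t -> full_norm (Y t - Y' t) = 0.
Proof.
move=> X0 mY mY' t t0; have [C CP] := full_norm_le_energy d (ltW mu0) c1 (energy_weight_gt0 b mu eps0).
have := mild_unique coupled_dissipative om0 (coupled_lift X0 mY) (coupled_lift X0 mY').
rewrite subrr snorm0 => /(_ erefl _ t0) h.
have := CP (submod_inj (full_submod R) (Y t) - submod_inj (full_submod R) (Y' t)).
rewrite h mulr0; case: mY mY' => XY _ _ _ [XY' _ _ _].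
rewrite -[sm_val (_ - _)]/(sm_val (submod_inj _ _) - sm_val (submod_inj _ _)).
rewrite !submod_injK; [|exact: XY'..|exact: XY] => h1.
by apply/eqP; rewrite eq_le h1 full_norm_ge0.
Qed.

Hypothesis omp : 0 < om.
Hypothesis a0 : 0 < a.
Hypothesis hkbd : `|k| + `|b * d| / c <= 1.

Let M := heat_weight b mu * eps.

(** The right-hand side of [energy_norm_le]: it bounds the energy norm, and shows
    the size of each component. *)
Definition initial_energy (Y0 : V3) : R :=
  expR (mu / 2) * (normL2 Y0.1.2 + normL2 (wderiv Y0.1.1)) + Num.sqrt M * normL2 (heat_dev c d Y0).

(** The heat component enters the energy with the weight of order eps, hence the
    loss of a square root of eps in its own decay estimate. *)
Theorem coupled_solution Y0 : full_space Y0 -> exists Y : R -> V3,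
  [/\ mild_solution (@full_space R) (@full_norm R) A Y0 Y,
      L2_time_derivative (fun t => (Y t).1.1) (fun t => (Y t).1.2),
      forall t, 0 <= t -> normH1 (Y t).1.1 + normL2 (Y t).1.2 <=
        3 * expR (mu / 2) * (expR (- om * t) * initial_energy Y0)
    & forall t, 0 <= t -> normL2 (heat_dev c d (Y t)) <=
        (Num.sqrt M)^-1 * (expR (- om * t) * initial_energy Y0)].
Proof.
move=> X0; pose x0 : H := submod_in (S := full_submod R) X0.
have mx : maximal_dissipative ip om G by exact: coupled_graph_maximal.
have M0 := energy_weight_gt0 b mu eps0.
have cH : scomplete ip  by apply: energy_complete; exact: ltW.
pose S t : H := evolution ip G t x0.
have mS := evolution_mild mx omp cH x0.
have dS t : 0 <= t -> nm (S t) <= expR (- om * t) * initial_energy Y0.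
  move=> t0; apply: le_trans (evolution_decay mx omp cH x0 t0) _.
  by rewrite ler_wpM2l ?expR_ge0//; exact: (energy_norm_le d (ltW mu0) c1 M0 x0).
have e0 := expR_ge0 (mu / 2).
exists (fun t => sm_val (S t)); split.
- have [C CP] := full_norm_le_energy d (ltW mu0) c1 M0.
  apply: (@transport_mild R H V3 (fun=> True) nm G (@full_space R) (@full_norm R) A
    (@sm_val _ _ (full_submod R)) C) mS => //.
  + by move=> x _; exact: (submodP x).
  + by move=> x; exact: full_norm_ge0.
- apply: (@mild_component_derivative R H ip G (fun x : H => (sm_val x).1.1)
    (fun x : H => (sm_val x).1.2) (2 * expR (mu / 2)) _ x0 S _ _ _ _ _ _ _ mS).
  + by move=> l x y; exact: (congr1 (fun Y : V3 => Y.1.1) (sm_val_lin l x y)).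
  + by move=> l x y; exact: (congr1 (fun Y : V3 => Y.1.2) (sm_val_lin l x y)).
  + by move=> x; have [[/H1_L2]] := fullP x.
  + by move=> x; have [] := fullP x.
  + move=> x; have [_ h _] := energy_norm_ge d (ltW mu0) c1 M0 x.
    have := normH1_le_wderiv (submodP x); have := normL2_le_normH1 (sm_val x).1.1.
    by move: h; lra.
  + move=> x; have [h _ _] := energy_norm_ge d (ltW mu0) c1 M0 x.
    by have := mulr_ge0 e0 (snorm_ge0 ip x); lra.
  + by move=> x w [ux [uxx [px [pxx [_ _ _ _ ->]]]]].
- move=> t t0; have [h1 h2 _] := energy_norm_ge d (ltW mu0) c1 M0 (S t).
  have h3 := normH1_le_wderiv (submodP (S t)).
  have := ler_wpM2l e0 (dS t t0); by move: h1 h2 h3; lra.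
- move=> t t0; have [_ _ h] := energy_norm_ge d (ltW mu0) c1 M0 (S t).
  by apply: le_trans h _; rewrite ler_wpM2l ?dS// invr_ge0 sqrtr_ge0.
Qed.

End CoupledSolution.

(** * The reduced system and the boundary layer *)

Section ThreeSystems.
Variable R : realType.
Local Notation V2 := ((R -> R) * (R -> R))%type.
Local Notation V3 := (V2 * (R -> R))%type.
Implicit Types (a b c d mu eps om : R).

Lemma full_operatorP eps a b c d (Y W : V3) :
  full_operator eps a b c d Y W <-> coupled_operator eps a 0 b c d Y W.
Proof.
case: Y => [[u v] p]; split=> -[ux [uxx [px [pxx]]]].
  move=> [[/H2_withP[u1 u2] u0 v1 /H2_withP[p1 p2]] bu b0 b1 WE].
  by exists ux, uxx, px, pxx; split => //; rewrite /= mul0r addr0.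
move=> [[u1 u2 p1 p2] [u0 v1] /= bu [b0 b1] WE].
exists ux, uxx, px, pxx; split => //; first by split => //; apply/H2_withP.
by rewrite bu mul0r addr0.
Qed.

Lemma reduced_of_coupled eps a b c d (Y W : V3) :
  coupled_operator eps a (b * d / c) 0 c 0 Y W -> reduced_operator a b c d Y.1 W.1.
Proof.
case: Y => [[u v] p] [ux [uxx [px [pxx [[u1 u2 _ _] [u0 v1] /= bu _ ->]]]]].
by exists ux, uxx; split => //; [apply/H2_withP|rewrite bu mul0r addr0].
Qed.

Lemma coupled_of_reduced eps a b c d (Y W : V2) : reduced_operator a b c d Y W ->
  coupled_operator eps a (b * d / c) 0 c 0 (Y, 0) (W, 0).
Proof.
case: Y => [u v] [ux [uxx [/H2_withP[u1 u2] u0 v1 bu ->]]].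
have z : abs_cont (0 : R -> R) 0 := AC_cst 0.
exists ux, uxx, 0, 0; split => //=.
- by rewrite bu mul0r addr0.
- by split; rewrite -[LHS]/(0 : R) ?mul0r// -[X in _ = c * X]/(0 : R) mulr0.
by rewrite scaler0.
Qed.

Lemma coupled_of_layer c (p w : R -> R) : layer_operator c p w ->
  coupled_operator 1 1 0 0 c 0 ((0, 0), p) ((0, 0), w).
Proof.
move=> /layer_operatorP[px [p1 p2 b0 b1]].
have z : abs_cont (0 : R -> R) 0 := AC_cst 0.
exists 0, 0, px, w; split => //=.
- by split => //; exact: H1L_0.
- rewrite -[LHS]/(0 : R) -[X in _ * X + _]/(0 : R) -[X in 0 * X]/(0 : R); ring.
- by rewrite b0 b1 mul0r.
by rewrite invr1 scale1r.
Qed.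

(** Uniqueness for the layer in L^2 is a special case of the coupled problem,
    with the wave at rest. *)
Lemma layer_unique c (p0 : R -> R) (p p' : R -> R -> R) : 1 <= c -> L2 p0 ->
  mild_solution (@L2 R) (@normL2 R) (layer_operator c) p0 p ->
  mild_solution (@L2 R) (@normL2 R) (layer_operator c) p0 p' ->
  forall t, 0 <= t -> normL2 (p t - p' t) = 0.
Proof.
move=> c1 p02 mp mp' t t0.
have n0 : normH1 (0 : R -> R) = 0.
  apply/eqP; rewrite eq_le normH1_ge0 andbT.
  by apply: le_trans (normH1_le (AC_cst 0)) _; rewrite !normL2_cst normr0 addr0.
have n0' : normL2 (0 : R -> R) = 0 by rewrite -[LHS]/(normL2 (fun=> 0)) normL2_cst normr0.
pose L (q : R -> R) : V3 := ((0, 0), q).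
have T q : mild_solution (@L2 R) (@normL2 R) (layer_operator c) p0 q ->
    mild_solution (@full_space R) (@full_norm R) (coupled_operator 1 1 0 0 c 0) (L p0) (fun t => L (q t)).
  apply: (@transport_mild R _ _ (@L2 R) (@normL2 R) (layer_operator c) (@full_space R)
    (@full_norm R) (coupled_operator 1 1 0 0 c 0) L 1) => //.
  - exact: L2_0.
  - by move=> k x y; exact: L2_lin.
  - move=> k x y _ _; have z : k *: (0 : R -> R) + 0 = 0 by rewrite scaler0 addr0.
    by rewrite /L -[RHS]/((k *: (0 : R -> R) + 0, k *: (0 : R -> R) + 0), k *: x + y) !z.
  - by move=> x x2; apply/full_spaceP; split; [exact: H1L_0|exact: L2_0|].
  - by move=> x _; rewrite full_normE n0 n0' !add0r mul1r.
  - by move=> x; exact: full_norm_ge0.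
  move=> x w xw; split; [| |exact: coupled_of_layer].
    by have [px [[/H1_L2]]] := xw.
  by have /layer_operatorP[px [_ /AC_deriv_L2]] := xw.
have ha : expR 1 * (1 - 1) ^+ 2 <= expR (- 1) * (1 + 1) ^+ 2 / 3 :> R.
  by rewrite subrr expr0n mulr0 mulr_ge0// mulr_ge0 ?expR_ge0.
have hk : 3 * cosh 1 * (0 + 0 * 0 / c) ^+ 2 <= 3 / 10 * 1 * expR (- 1) :> R.
  by rewrite !mul0r addr0 expr0n mulr0 mulr_ge0 ?expR_ge0.
have heps : 128 * heat_weight 0 1 * 0 ^+ 2 * 1 ^+ 2 <= expR (- 1) * (1 + 1) ^+ 2 :> R.
  by rewrite [0 ^+ 2]expr0n mulr0 mul0r mulr_ge0 ?expR_ge0.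
have o1 : (0 : R) <= 1 / 5 by rewrite divr_ge0.
have o2 : 8 * 0 * 1 <= 1 :> R by rewrite mulr0 mul0r.
have Xp : full_space (L p0) by apply/full_spaceP; split; [exact: H1L_0|exact: L2_0|].
have := coupled_unique ltr01 c1 ltr01 ha hk heps (lexx 0) o1 o2 Xp (T _ mp) (T _ mp') t0.
rewrite full_normE => h; apply/eqP; rewrite eq_le normL2_ge0 andbT -h.
by rewrite lerDr addr_ge0 ?normH1_ge0 ?normL2_ge0.
Qed.

(** Existence, continuity and decay hold in the Sobolev norm by [layer_maximal],
    and that evolution is also a solution in the weaker norm. *)
Theorem layer_solution c (p0 : R -> R) : 1 <= c -> H1 p0 ->
  exists p : R -> R -> R,
  [/\ unique_mild_solution (@L2 R) (@normL2 R) (layer_operator c) p0 p,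
      forall t, 0 <= t -> H1 (p t), time_continuous (@normH1 R) p
    & forall t, 0 <= t -> normL2 (p t) <= 2 * (1 + 2 * c) * (expR (- 4^-1 * t) * normH1 p0)].
Proof.
move=> c1 pH; pose x0 := submod_in (S := H1_submod R) pH.
have mx := layer_maximal c1.
have cH : scomplete (layer_inner c1) by exact: layer_complete.
have om0 : 0 < 4^-1 :> R by rewrite invr_gt0.
have mS := evolution_mild mx om0 cH x0.
have dS := evolution_decay mx om0 cH x0.
set S := evolution _ _ in mS dS; clearbody S.
exists (fun t => sm_val (S t x0)); split.
- have mp : mild_solution (@L2 R) (@normL2 R) (layer_operator c) p0 (fun t => sm_val (S t x0)).
    apply: (@transport_mild R _ _ (fun=> True) (snorm (layer_inner c1)) (@layer_graph R c)
      (@L2 R) (@normL2 R) (layer_operator c) (@sm_val _ _ (H1_submod R)) 2) mS => //.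
    + by move=> x _; exact: H1_L2 (submodP x).
    + by move=> x _; exact: normL2_le_layer.
    + by move=> x; exact: normL2_ge0.
  split => // p' mp' t t0.
  exact: (layer_unique c1 (H1_L2 pH) mp' mp t0).
- by move=> t _; exact: (submodP (S t x0)).
- case: mS => _ _ cS _.
  apply: (@transport_time_continuous R _ _ (fun=> True) (snorm (layer_inner c1))
      (@normH1 R) (@sm_val _ _ (H1_submod R)) 3) cS => //.
  + by move=> x _; exact: normH1_le_layer.
  + by move=> x; exact: normH1_ge0.
move=> t t0; have h1 := normL2_le_layer c1 (S t x0); have h2 := dS t t0.
have h3 := ler_wpM2l (expR_ge0 (- 4^-1 * t)) (layer_le_normH1 c1 x0).
by move: h1 h2 h3; rewrite -[sm_val x0]/p0; lra.
Qed.

(** The reduced system is the coupled one with b = d = 0, next to a heat equation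
    at rest. The parameter eps of the latter is free; 1/mu fits the rate mu/8. *)
Theorem reduced_solution a b c d mu (u0 u1 : R -> R) :
  0 < mu -> 1 <= c -> 0 < a -> `|b * d / c| <= 1 ->
  expR mu * (1 - a) ^+ 2 <= expR (- mu) * (1 + a) ^+ 2 / 3 ->
  3 * cosh mu * (b * d / c) ^+ 2 <= 3 / 10 * mu * expR (- mu) ->
  H1L u0 -> L2 u1 ->
  exists u ut : R -> R -> R,
  [/\ unique_mild_solution (@reduced_space R) (@reduced_norm R)
        (reduced_operator a b c d) (u0, u1) (fun t => (u t, ut t)),
      L2_time_derivative u ut,
      forall t, 0 <= t -> H1L (u t) /\ L2 (ut t)
    & forall t, 0 <= t -> normH1 (u t) + normL2 (ut t) <=
        3 * expR mu * (expR (- (mu / 8) * t) * (normH1 u0 + normL2 u1))].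
Proof.
move=> mu0 c1 a0 hbd ha hk u0H u12; pose k := b * d / c.
pose Y0 : V3 := ((u0, u1), 0).
have X0 : full_space Y0 by apply/full_spaceP; split => //; exact: L2_0.
have e0 : 0 < mu^-1 by rewrite invr_gt0.
have hk' : 3 * cosh mu * (k + 0 * 0 / c) ^+ 2 <= 3 / 10 * mu * expR (- mu).
  by rewrite mul0r mul0r addr0.
have he : 128 * heat_weight 0 mu * 0 ^+ 2 * mu^-1 ^+ 2 <= expR (- mu) * (1 + a) ^+ 2.
  by rewrite [0 ^+ 2]expr0n mulr0 mul0r mulr_ge0 ?expR_ge0 ?sqr_ge0.
have o0 : 0 < mu / 8 by rewrite divr_gt0.
have o1 : mu / 8 <= mu / 5 by rewrite ler_pM2l// lef_pV2 ?posrE//; lra.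
have o2 : 8 * (mu / 8) * mu^-1 <= 1.
  by rewrite le_eqVlt; apply/orP; left; apply/eqP; field; rewrite gt_eqF.
have hkb : `|k| + `|0 * 0| / c <= 1 by rewrite mul0r normr0 mul0r addr0.
have [Y [mY dY bY _]] := coupled_solution mu0 c1 e0 ha hk' he o1 o2 o0 a0 hkb X0.
have XY t : 0 <= t -> full_space (Y t) by case: mY => + _ _ _; exact.
exists (fun t => (Y t).1.1), (fun t => (Y t).1.2); split => //.
- have R0 : reduced_space ((0, 0) : V2) by split; [exact: H1L_0|exact: L2_0].
  have Rlin (l : R) (x y : V2) : reduced_space x -> reduced_space y -> reduced_space (l *: x + y).
    by case: x => ? ?; case: y => ? ? [h1 h2] [h3 h4]; split; [exact: H1L_lin|exact: L2_lin].
  have Rge (x : V2) : 0 <= reduced_norm x.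
    by case: x => ? ?; rewrite /= addr_ge0 ?normH1_ge0 ?normL2_ge0.
  have mR : mild_solution (@reduced_space R) (@reduced_norm R) (reduced_operator a b c d)
      (u0, u1) (fun t => ((Y t).1.1, (Y t).1.2)).
    have -> : (fun t => ((Y t).1.1, (Y t).1.2)) = (fun t => (Y t).1).
      by apply/funext => t; case: (Y t) => [[]].
    apply: (@transport_mild R _ _ (@full_space R) (@full_norm R) (coupled_operator mu^-1 a k 0 c 0)
      (@reduced_space R) (@reduced_norm R) (reduced_operator a b c d) fst 1 _ _ _ _ _ _ _ _ Y0) mY => //.
    + exact: full_space0.
    + exact: full_space_lin.
    + by move=> [[? ?] ?] [].
    + by move=> [[? ?] ?] _; rewrite /= mul1r lerDl normL2_ge0.
    + move=> x w xw; have [Xx Xw] := coupled_operator_space xw.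
      by split => //; exact: reduced_of_coupled xw.
  split => // Y' mY' t t0.
  pose L (y : V2) : V3 := (y, 0).
  have mL : mild_solution (@full_space R) (@full_norm R) (coupled_operator mu^-1 a k 0 c 0) Y0
      (fun t => L (Y' t)).
    apply: (@transport_mild R _ _ (@reduced_space R) (@reduced_norm R) (reduced_operator a b c d)
      (@full_space R) (@full_norm R) (coupled_operator mu^-1 a k 0 c 0) L 1 _ _ _ _ _ _ _ _ (u0, u1)) mY' => //.
    + move=> l x y _ _; have z : l *: (0 : R -> R) + 0 = 0 by rewrite scaler0 addr0.
      by rewrite /L -[RHS]/(l *: x + y, l *: (0 : R -> R) + 0) z.
    + by move=> [x y] [h1 h2]; split => //; exact: L2_0.
    + move=> [x y] _; rewrite /L /= mul1r -[normL2 0]/(normL2 (fun=> 0)).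
      by rewrite normL2_cst normr0 addr0.
    + by move=> x; exact: full_norm_ge0.
    + move=> x w xw; have xw' := coupled_of_reduced mu^-1 xw; have [Xx Xw] := coupled_operator_space xw'.
      by split => //; [case: (x) Xx => ? ? []|case: (w) Xw => ? ? []].
  have := coupled_unique mu0 c1 e0 ha hk' he (ltW o0) o1 o2 X0 mL mY t0.
  have -> : L (Y' t) - Y t = (Y' t - (Y t).1, 0 - (Y t).2) by case: (Y t).
  case: (Y t) => [[u v] p]; case: (Y' t) => [u' v']; rewrite /= => h.
  have := normL2_ge0 (0 - p); have := normH1_ge0 (u' - u); have := normL2_ge0 (v' - v).
  by move: h; lra.
- by move=> t /XY/full_spaceP[].
move=> t t0; apply: le_trans (bY t t0) _; rewrite /initial_energy.
have -> : normL2 (heat_dev c 0 Y0) = 0.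
  apply/eqP; rewrite eq_le normL2_ge0 andbT (le_trans (heat_dev_le 0 c1 X0))//.
  by rewrite normr0 mulr0 mul0r addr0 -[normL2 _]/(normL2 (fun=> 0)) normL2_cst normr0.
rewrite mulr0 addr0 /=.
have -> : expR mu = expR (mu / 2) * expR (mu / 2) by rewrite -expRD; congr expR; field.
have h1 := normL2_deriv_le_normH1 (wderivP u0H.1).
have e2 := expR_ge0 (mu / 2); have et := expR_ge0 (- (mu / 8) * t).
have : normL2 u1 + normL2 (wderiv u0) <= normH1 u0 + normL2 u1 by lra.
move/(ler_wpM2l (mulr_ge0 (mulr_ge0 (mulr_ge0 (ler0n _ 3) e2) e2) et)); lra.
Qed.

End ThreeSystems.

(** Norms count as unknowns, so only the linear relations in the goal are used. *)
Ltac norm_lra :=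
  repeat match goal with
  | |- context [normL2 ?f] => generalize (normL2 f)
  | |- context [normH1 ?f] => generalize (normH1 f)
  end; clear; intros; lra.

(** * Small data *)

Section MainEstimate.
Variable R : realType.
Implicit Types (a b c d mu eps K : R).

Lemma full_solution eps a b c d mu (u0 u1 p0 : R -> R) :
  0 < mu -> 1 <= c -> 0 < eps -> 0 < a -> `|b * d / c| <= 1 ->
  expR mu * (1 - a) ^+ 2 <= expR (- mu) * (1 + a) ^+ 2 / 3 ->
  3 * cosh mu * (b * d / c) ^+ 2 <= 3 / 10 * mu * expR (- mu) ->
  128 * heat_weight b mu * d ^+ 2 * eps ^+ 2 <= expR (- mu) * (1 + a) ^+ 2 ->
  mu * eps <= 1 -> H1L u0 -> L2 u1 -> L2 p0 ->
  exists u ut p : R -> R -> R,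
  [/\ unique_mild_solution (@full_space R) (@full_norm R)
        (full_operator eps a b c d) (u0, u1, p0) (fun t => (u t, ut t, p t)),
      L2_time_derivative u ut,
      forall t, 0 <= t -> full_space (u t, ut t, p t),
      forall t, 0 <= t -> normH1 (u t) + normL2 (ut t) <=
        3 * expR (mu / 2) * (expR (- (mu / 8) * t) * initial_energy eps b c d mu (u0, u1, p0))
    & forall t, 0 <= t -> normL2 (heat_dev c d (u t, ut t, p t)) <=
        (Num.sqrt (heat_weight b mu * eps))^-1 *
        (expR (- (mu / 8) * t) * initial_energy eps b c d mu (u0, u1, p0))].
Proof.
move=> mu0 c1 e0 a0 hbd ha hk he me u0H u12 p02; pose Y0 := (u0, u1, p0).
have X0 : full_space Y0 by [].
have c0 : 0 < c := lt_le_trans ltr01 c1.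
have hk' : 3 * cosh mu * (0 + b * d / c) ^+ 2 <= 3 / 10 * mu * expR (- mu).
  by rewrite add0r.
have o0 : 0 < mu / 8 by rewrite divr_gt0.
have o1 : mu / 8 <= mu / 5 by rewrite ler_pM2l// lef_pV2 ?posrE//; lra.
have o2 : 8 * (mu / 8) * eps <= 1 by lra.
have hkb : `|0 : R| + `|b * d| / c <= 1.
  by rewrite normr0 add0r; move: hbd; rewrite normrM normfV (gtr0_norm c0).
have [Y [mY dY bY hY]] := coupled_solution mu0 c1 e0 ha hk' he o1 o2 o0 a0 hkb X0.
have eY : (fun t => ((Y t).1.1, (Y t).1.2, (Y t).2)) = Y.
  by apply/funext => t; case: (Y t) => [[]].
have eYt t : ((Y t).1.1, (Y t).1.2, (Y t).2) = Y t by case: (Y t) => [[]].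
exists (fun t => (Y t).1.1), (fun t => (Y t).1.2), (fun t => (Y t).2); split.
- rewrite eY; split.
    by apply: mild_subgraph mY => x w; move/full_operatorP.
  move=> Y' mY' t t0; have mY'' : mild_solution (@full_space R) (@full_norm R)
    (coupled_operator eps a 0 b c d) Y0 Y' by apply: mild_subgraph mY' => x w; move/full_operatorP.
  exact: (coupled_unique mu0 c1 e0 ha hk' he (ltW o0) o1 o2 X0 mY'' mY t0).
- exact: dY.
- by move=> t t0; rewrite eYt; case: mY => + _ _ _; exact.
- exact: bY.
by move=> t t0; rewrite eYt; exact: hY.
Qed.

(** The initial deviation p0 - d (1 + cx)/c u0(1) is of order eps only, because of
    the layer datum; the weight of order eps under the root restores eps^(3/2). *)
Lemma initial_energy_le eps b c d mu K E (u0 u1 p0 ub0 ub1 pb0 : R -> R) :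
  1 <= c -> 0 < eps -> H1L u0 -> L2 u1 -> L2 p0 -> H1L ub0 -> L2 ub1 -> H1 pb0 ->
  E = Num.sqrt eps * eps -> eps <= 1 ->
  normH1 (u0 - ub0) + normL2 (u1 - ub1)
    + normL2 (fun x => p0 x - pb0 x - d * ((1 + c * x) / c) * u0 1) <= K * E ->
  normH1 pb0 <= K * eps -> normH1 ub0 + normL2 ub1 <= K * E ->
  initial_energy eps b c d mu (u0, u1, p0) <=
    (6 * expR (mu / 2) + 2 * Num.sqrt (heat_weight b mu)) * (K * E).
Proof.
move=> c1 e0 u0H u12 p02 ub0H ub12 pbH EE e1 h1 h2 h3; rewrite /initial_energy /=.
have c0 : 0 < c := lt_le_trans ltr01 c1.
have Y0 : full_space (u0, u1, p0) by [].
have w0 : 0 <= heat_weight b mu := le_trans ler01 (heat_weight_ge1 b mu).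
have s0 := sqrtr_ge0 eps; have sw := sqrtr_ge0 (heat_weight b mu).
have s1 : Num.sqrt eps <= 1 by rewrite -sqrtr1 ler_wsqrtr.
have n1 := normH1_ge0 (u0 - ub0); have n2 := normL2_ge0 (u1 - ub1).
have n4 := normH1_ge0 ub0; have n5 := normL2_ge0 ub1; have n6 := normH1_ge0 pb0.
move: h1; set P := (fun x => _) => h1; have n3 := normL2_ge0 P.
have KE0 : 0 <= K * E by move: n4 n5 h3; norm_lra.
have Ke0 : 0 <= K * eps by move: n6 h2; norm_lra.
have KEe : K * E <= K * eps.
  by rewrite EE mulrCA ler_piMl.
have dH : H1 (u0 - ub0) by exact: AC_H1 (AC_sub (wderivP u0H.1) (wderivP ub0H.1)).
have hu : normL2 (wderiv u0) <= 4 * (K * E).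
  apply: le_trans (normL2_deriv_le_normH1 (wderivP u0H.1)) _.
  have := normH1_triangle dH ub0H.1; rewrite subrK.
  by move: n2 n3 n5 h1 h3; norm_lra.
have hv : normL2 u1 <= 2 * (K * E).
  have := normL2_triangle (L2B u12 ub12) ub12; rewrite subrK.
  by move: n1 n3 n4 h1 h3; norm_lra.
have P2 : L2 P.
  have := L2B (heat_dev_L2 d c1 Y0) (H1_L2 pbH); apply: eq_L2 => x _.
  rewrite -[LHS]/(p0 x - d * u0 1 * lift_profile c x - pb0 x) /P /lift_profile.
  by move: (_ / c) => q; ring.
have hp : normL2 (heat_dev c d (u0, u1, p0)) <= 2 * (K * eps).
  have -> : normL2 (heat_dev c d (u0, u1, p0)) = normL2 (P + pb0).
    congr normL2; apply/funext => x.
    rewrite -[LHS]/(p0 x - d * u0 1 * lift_profile c x) -[RHS]/(P x + pb0 x) /P /lift_profile.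
    by move: (_ / c) => q; ring.
  have := normL2_triangle P2 (H1_L2 pbH); have := normL2_le_normH1 pb0.
  by move: h1 h2 n1 n2 KEe; norm_lra.
have ee := expR_ge0 (mu / 2).
have g1 := ler_wpM2l ee (_ : normL2 u1 + normL2 (wderiv u0) <= 6 * (K * E)).
have {}g1 := g1 ltac:(move: hu hv; norm_lra).
have g2 : Num.sqrt (heat_weight b mu * eps) * normL2 (heat_dev c d (u0, u1, p0)) <=
    2 * Num.sqrt (heat_weight b mu) * (K * E).
  rewrite sqrtrM//; have := ler_wpM2l (mulr_ge0 sw s0) hp; rewrite EE.
  by move: (Num.sqrt _) (Num.sqrt _) (normL2 _) => x y z; clear; lra.
by move: g1 g2; move: (expR _) (Num.sqrt _) (Num.sqrt _) (normL2 (heat_dev _ _ _)) => x y z w; norm_lra.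
Qed.

End MainEstimate.

(** * The conditions on the parameters *)

(** The bound on mu says exp(mu) <= |1 + a| / (sqrt 3 |1 - a|); squared. *)
Lemma wave_reflection_le (R : realType) (a mu : R) : 0 < a -> a != 1 ->
  mu <= ln (`|1 + a| / (Num.sqrt 3 * `|1 - a|)) ->
  expR mu * (1 - a) ^+ 2 <= expR (- mu) * (1 + a) ^+ 2 / 3.
Proof.
move=> a0 a1 hmu; have s3 : (0 : R) < Num.sqrt 3 by rewrite sqrtr_gt0.
have d0 : 0 < `|1 - a| by rewrite normr_gt0 subr_eq0 eq_sym.
have n0 : 0 < `|1 + a| by rewrite normr_gt0 gt_eqF// addr_gt0.
have sd := mulr_gt0 s3 d0.
have r0 : 0 < `|1 + a| / (Num.sqrt 3 * `|1 - a|) by rewrite divr_gt0.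
have h : expR mu <= `|1 + a| / (Num.sqrt 3 * `|1 - a|).
  by rewrite -[leRHS]lnK ?posrE// ler_expR.
move: h; rewrite ler_pdivlMr// => h.
have h2 : (expR mu * (Num.sqrt 3 * `|1 - a|)) ^+ 2 <= `|1 + a| ^+ 2.
  by apply: lerXn2r => //; rewrite nnegrE ?mulr_ge0 ?expR_ge0 ?(ltW sd).
move: h2; rewrite !exprMn sqr_sqrtr// !real_normK ?num_real// => h2.
have E : expR (- mu) * expR mu = 1 by rewrite -expRD addrC subrr expR0.
have h3 := ler_wpM2l (expR_ge0 (- mu)) h2.
have h4 : expR (- mu) * (expR mu ^+ 2 * (3 * (1 - a) ^+ 2)) = 3 * (expR mu * (1 - a) ^+ 2).
  by rewrite expr2 !mulrA E mul1r; ring.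
by move: h3; rewrite h4; lra.
Qed.

(** By the first bound b^2 is at most c / (10 cosh(mu)), so (bd/c)^2 is at most
    d^2 / (10 c cosh(mu)). *)
Lemma feedback_le (R : realType) (b c d mu : R) : 1 <= c -> 0 <= mu ->
  (2 * sinh mu + 10 * cosh mu) * b ^+ 2 <= c -> d ^+ 2 <= mu * expR (- mu) ->
  3 * cosh mu * (b * d / c) ^+ 2 <= 3 / 10 * mu * expR (- mu).
Proof.
move=> c1 mu0 hb hd; have c0 : 0 < c := lt_le_trans ltr01 c1.
have s0 := mulr_ge0 (sinh_ge0 mu0) (sqr_ge0 b).
have h1 : 3 * cosh mu * b ^+ 2 <= 3 / 10 * c by move: hb s0; lra.
have -> : 3 * cosh mu * (b * d / c) ^+ 2 = 3 * cosh mu * b ^+ 2 * (d ^+ 2 / c ^+ 2).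
  by field; rewrite gt_eqF.
have q0 : 0 <= d ^+ 2 / c ^+ 2 by rewrite divr_ge0 ?sqr_ge0.
apply: le_trans (ler_wpM2r q0 h1) _.
have -> : 3 / 10 * c * (d ^+ 2 / c ^+ 2) = 3 / 10 * (d ^+ 2 / c) by field; rewrite gt_eqF.
rewrite -[leRHS]mulrA; apply: ler_wpM2l; first by rewrite divr_ge0.
apply: le_trans hd.
by rewrite ler_pdivrMr// ler_peMr// sqr_ge0.
Qed.

Lemma powR_three_halves (R : realType) (x : R) : 0 < x -> x `^ (3 / 2) = Num.sqrt x * x.
Proof.
move=> x0; have -> : 3 / 2 = 2^-1 + 1 :> R by field.
rewrite powRD; last by rewrite (gt_eqF x0) implybT.
by rewrite powRr1 ?(ltW x0)// powR12_sqrt// ltW.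
Qed.

Theorem theorem6 (R : realType) (a b c d mu : R)
  (eta := (Num.sqrt 3 + 1) / (Num.sqrt 3 - 1) : R)
  (mu_star := ln (`|1 + a| / (Num.sqrt 3 * `|1 - a|)) : R)
  (F := fun m : R => 2 * sinh m + 10 * cosh m) :
  eta^-1 <= a <= eta -> a != 1 ->
  0 < mu <= mu_star ->
  `|b * d / c| <= 1 ->
  pi ^+ 2 / 8 <= c ->
  1 + 2 * (sinh mu + 2 * cosh mu) * b ^+ 2 <= c ->
  `|d| <= 2 * Num.sqrt (mu * expR (- mu)) ->
  pi ^+ 2 / 4 <= c ->
  (pi ^+ 2 + 2) / 4 + F mu * b ^+ 2 <= c ->
  `|d| <= Num.sqrt (mu * expR (- mu)) ->
  exists2 eps_star : R, 0 < eps_star &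
  forall K : R, exists C : R,
  forall eps : R, 0 < eps < eps_star ->
  forall u0 u1 p0 ub0 ub1 pb0 : R -> R,
  H1 u0 -> L2 u1 -> L2 p0 -> H1 ub0 -> L2 ub1 -> H1 pb0 ->
  u0 0 = 0 -> ub0 0 = 0 ->
  normH1 (u0 - ub0) + normL2 (u1 - ub1)
    + normL2 (fun x => p0 x - pb0 x - d * ((1 + c * x) / c) * u0 1)
    <= K * eps `^ (3 / 2) ->
  normH1 pb0 <= K * eps ->
  normH1 ub0 + normL2 ub1 <= K * eps `^ (3 / 2) ->
  exists u ut p ub ubt pb : R -> R -> R,
  [/\ unique_mild_solution (@full_space R) (@full_norm R)
        (full_operator eps a b c d)
        (u0, u1, p0) (fun t => (u t, ut t, p t))
        /\ L2_time_derivative u ut,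
      unique_mild_solution (@reduced_space R) (@reduced_norm R)
        (reduced_operator a b c d)
        (ub0, ub1) (fun t => (ub t, ubt t))
        /\ L2_time_derivative ub ubt,
      unique_mild_solution (@L2 R) (@normL2 R) (layer_operator c) pb0 pb
        /\ (forall t : R, 0 <= t -> H1 (pb t)) /\ time_continuous (@normH1 R) pb,
      forall t : R, 0 <= t ->
        normH1 (u t - ub t) + normL2 (ut t - ubt t)
        <= C * eps `^ (3 / 2) * expR (- (mu / 8) * t)
    & forall t : R, 0 <= t ->
        normL2 (fun x => p t x - pb (t / eps) x - (1 + c * x) / c * d * ub t 1)
        <= C * eps * expR (- (mu / 8) * t)].
Proof.
move=> /andP[ha _] a1 /andP[mu0 hmu] hbd _ _ _ hc hF hd.
have s3 : (1 : R) < Num.sqrt 3 by rewrite -[X in X < _]sqrtr1 ltr_sqrt//; lra.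
have a0 : 0 < a by apply: lt_le_trans ha; rewrite invr_gt0 divr_gt0//; lra.
have c1 : 1 <= c.
  apply: le_trans hc; have := pi_ge2 R => p2.
  have : 2 ^+ 2 <= pi ^+ 2 :> R by apply: lerXn2r; rewrite ?nnegrE// (le_trans _ p2).
  by rewrite ler_pdivlMr//; lra.
have c0 : 0 < c := lt_le_trans ltr01 c1.
have gap := wave_reflection_le a0 a1 hmu.
have d2 : d ^+ 2 <= mu * expR (- mu).
  rewrite -real_normK ?num_real// -[leRHS]sqr_sqrtr; last by rewrite mulr_ge0 ?expR_ge0 ?ltW.
  by apply: lerXn2r => //; rewrite nnegrE ?sqrtr_ge0.
have hb : (2 * sinh mu + 10 * cosh mu) * b ^+ 2 <= c.
  by apply: le_trans hF; rewrite lerDr divr_ge0// addr_ge0// sqr_ge0.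
have feed := feedback_le c1 (ltW mu0) hb d2.
have w1 := heat_weight_ge1 b mu; set kap := heat_weight b mu in w1 *.
pose q := expR (- mu) * (1 + a) ^+ 2.
have q0 : 0 < q by rewrite mulr_gt0 ?expR_gt0// exprn_gt0// addr_gt0.
pose D := 128 * kap * d ^+ 2.
have D0 : 0 <= D by rewrite mulr_ge0 ?sqr_ge0// mulr_ge0// (le_trans ler01).
have Dp : 0 < D + 1 by rewrite ltr_wpDl.
(* mu eps <= 1 makes both heat equations faster than mu/8; the last bound gives
   the smallness of the coupling through u_t(1) *)
exists (Num.min 1 (Num.min mu^-1 (q / (D + 1)))).
  by rewrite !lt_min ltr01 invr_gt0 mu0 divr_gt0.
move=> K; pose B := 6 * expR (mu / 2) + 2 * Num.sqrt kap.
pose C1 := 2 * (3 * expR (mu / 2) * B + 3 * expR mu).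
have B0 : 0 <= B by rewrite addr_ge0// mulr_ge0 ?expR_ge0 ?sqrtr_ge0.
have C10 : 0 <= C1 by rewrite mulr_ge0// addr_ge0// !mulr_ge0 ?expR_ge0.
pose C2 := B + 2 * `|d| * C1 + 2 * (1 + 2 * c).
have C20 : 0 <= C2.
  by rewrite /C2 !addr_ge0// ?mulr_ge0// addr_ge0// mulr_ge0// ltW.
exists ((C1 + C2) * K) => eps /andP[e0]; rewrite !lt_min => /and3P[e1 e2 e3].
move=> u0 u1 p0 ub0 ub1 pb0 u0H u12 p02 ub0H ub12 pbH u00 ub00.
rewrite (powR_three_halves e0); set E := Num.sqrt eps * eps => h1 h2 h3.
have me : mu * eps <= 1 by move: e2; rewrite -[mu^-1]div1r ltr_pdivlMr// mulrC => /ltW.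
have he : 128 * kap * d ^+ 2 * eps ^+ 2 <= expR (- mu) * (1 + a) ^+ 2.
  rewrite -/D -/q; move: e3; rewrite ltr_pdivlMr// => /ltW e3.
  apply: le_trans e3; apply: le_trans (_ : D * eps <= _); last first.
    by rewrite mulrC ler_pM2l// lerDl.
  by rewrite ler_wpM2l// expr2 ler_piMr ?ltW.
have [u [ut [p [mY dY XY bY hY]]]] := full_solution mu0 c1 e0 a0 hbd gap feed he me (conj u0H u00) u12 p02.
have [ub [ubt [mR dR XR bR]]] := reduced_solution mu0 c1 a0 hbd gap feed (conj ub0H ub00) ub12.
have [pb [mP XP cP bP]] := layer_solution c1 pbH.
exists u, ut, p, ub, ubt, pb.
have I0 := initial_energy_le b mu c1 e0 (conj u0H u00) u12 p02 (conj ub0H ub00) ub12 pbH erefl (ltW e1) h1 h2 h3.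
rewrite -/kap -/B -/E in I0.
have KE0 : 0 <= K * E by apply: (le_trans _ h3); rewrite addr_ge0 ?normH1_ge0 ?normL2_ge0.
have Ke0 : 0 <= K * eps by apply: (le_trans _ h2); rewrite normH1_ge0.
have s1 : Num.sqrt eps <= 1 by rewrite -sqrtr1 ler_wsqrtr// ltW.
have KEe : K * E <= K * eps by rewrite /E mulrCA ler_piMl.
have ub_ t : 0 <= t -> normH1 (u t - ub t) + normL2 (ut t - ubt t) <=
    C1 * (K * E) * expR (- (mu / 8) * t).
  move=> t0; have [[uH _] v2 _] := XY _ t0; have [[ubH _] ubt2] := XR _ t0.
  have n1 := normH1_triangle uH (_ : H1 (- ub t)).
  have nH : H1 (- ub t) by have := H1_lin (-1) ubH (H1_0 R); rewrite addr0 scaleN1r.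
  have nE : normH1 (- ub t) = normH1 (ub t).
    have uN := AC_scale (-1) (wderivP ubH).
    have -> : - ub t = (fun x => -1 * ub t x) by apply/funext => x; rewrite mulN1r.
    rewrite (normH1E uN) (normH1E (wderivP ubH)).
    rewrite -[fun x => -1 * ub t x]/(-1 *: ub t) -[fun x => _]/(-1 *: wderiv (ub t)).
    by rewrite !normL2Z ?normrN1 ?mul1r//; [exact: wderiv_L2|exact: H1_L2].
  have {}n1 := n1 nH; rewrite nE in n1.
  have n2 := normL2_triangle v2 (L2N ubt2); rewrite (normL2N ubt2) in n2.
  have b1 := bY _ t0; have b2 := bR _ t0; have et := expR_ge0 (- (mu / 8) * t).
  have b3 := ler_wpM2l (mulr_ge0 (mulr_ge0 (ler0n _ 3) (expR_ge0 (mu / 2))) et) I0.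
  have b4 := ler_wpM2l (mulr_ge0 (mulr_ge0 (ler0n _ 3) (expR_ge0 mu)) et) h3.
  have nn := normL2_ge0 (ut t); have nn' := normL2_ge0 (ubt t).
  rewrite /C1; move: n1 n2 b1 b2 b3 b4 nn nn'.
  move: (initial_energy _ _ _ _ _ _) (expR (- (mu / 8) * t)) (expR (mu / 2)) (expR mu) (B) (K * E).
  by norm_lra.
split => //.
- move=> t t0; apply: le_trans (ub_ t t0) _.
  rewrite mulrA ler_wpM2r ?expR_ge0// mulrDl mulrDl mulrA lerDl -mulrA mulr_ge0//.
move=> t t0; have X := XY _ t0; have [ubH ubt2] := XR _ t0.
have te : 0 <= t / eps by rewrite divr_ge0// ltW.
have [uH _ _] := X.
have pb2 := H1_L2 (XP _ te).
pose del := u t 1 - ub t 1.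
have hd2 := heat_dev_L2 d c1 X; have lp2 := lift_profile_L2 c1.
have -> : (fun x => p t x - pb (t / eps) x - (1 + c * x) / c * d * ub t 1) =
    (heat_dev c d (u t, ut t, p t) + (d * del) *: lift_profile c) + - pb (t / eps).
  apply/funext => x; rewrite -[RHS]/((p t x - d * u t 1 * lift_profile c x
    + d * del * lift_profile c x) - pb (t / eps) x) /del /lift_profile.
  by move: (_ / c) => l; ring.
(* the error in p is the deviation of the full system, plus the profile of the
   error in u(1), minus the layer *)
have l2 := L2Z (d * del) lp2.
apply: le_trans (normL2_triangle (L2D hd2 l2) (L2N pb2)) _; rewrite (normL2N pb2).
have n1 := normL2_triangle hd2 l2; rewrite (normL2Z _ lp2) normrM in n1.
have dH : abs_cont (u t - ub t) (fun x => wderiv (u t) x - wderiv (ub t) x).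
  exact: AC_sub (wderivP uH.1) (wderivP ubH.1).
have hdel : `|del| <= C1 * (K * E) * expR (- (mu / 8) * t).
  apply: le_trans (ub_ t t0); have := AC_bound dH (_ : 0 <= 1 <= 1).
  rewrite lexx ler01 => /(_ isT).
  rewrite -[(u t - ub t) 1]/del -[(u t - ub t) 0]/(u t 0 - ub t 0) uH.2 ubH.2 !subr0 => h.
  have := normL2_deriv_le_normH1 dH; have := normL2_ge0 (ut t - ubt t).
  by move: h; norm_lra.
have et := expR_ge0 (- (mu / 8) * t).
have hl : normL2 (pb (t / eps)) <= 2 * (1 + 2 * c) * (K * eps) * expR (- (mu / 8) * t).
  apply: le_trans (bP _ te) _; rewrite -[leRHS]mulrA [K * eps * _]mulrC ler_wpM2l//.
    by rewrite mulr_ge0// addr_ge0// mulr_ge0// ltW.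
  rewrite ler_pM ?expR_ge0 ?normH1_ge0// ler_expR mulNr mulNr lerN2.
  rewrite mulrA ler_pdivlMr//; move: t0 (ler_wpM2r t0 me); clear; lra.
have hh : normL2 (heat_dev c d (u t, ut t, p t)) <= B * (K * eps) * expR (- (mu / 8) * t).
  apply: le_trans (hY _ t0) _.
  have sk : 1 <= Num.sqrt kap by rewrite -[X in X <= _]sqrtr1 ler_wsqrtr.
  have k0 : 0 <= kap := le_trans ler01 w1.
  have se : 0 < Num.sqrt eps by rewrite sqrtr_gt0.
  have sk0 : 0 < Num.sqrt kap := lt_le_trans ltr01 sk.
  rewrite sqrtrM// ler_pdivrMl ?mulr_gt0//.
  apply: le_trans (ler_wpM2l et I0) _; rewrite /E.
  have h := mulr_ge0 (mulr_ge0 (mulr_ge0 (ltW se) et) (mulr_ge0 B0 Ke0)) (_ : 0 <= Num.sqrt kap - 1).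
  have {}h := h ltac:(by rewrite subr_ge0).
  by move: h; clear; lra.
have g1 : `|d| * `|del| * normL2 (lift_profile c) <=
    2 * `|d| * C1 * (K * eps) * expR (- (mu / 8) * t).
  have hd' : `|del| <= C1 * (K * eps) * expR (- (mu / 8) * t).
    by apply: le_trans hdel _; rewrite ler_wpM2r// ler_wpM2l.
  apply: le_trans (ler_wpM2l _ (lift_profile_norm c1)) _; first by rewrite mulr_ge0.
  have := ler_wpM2l (normr_ge0 d) hd'; clear; lra.
have g2 : 0 <= C1 * (K * eps) * expR (- (mu / 8) * t) := mulr_ge0 (mulr_ge0 C10 Ke0) et.
rewrite /C2; move: n1 hl hh g1 g2; move: (expR _) (B) (C1) `|d| `|del|; norm_lra.
Qed.
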